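(* Let $\sigma,\rho$ be gauges with $\sigma\ll\rho$, let $k\in{}^{\sigma}\widetilde{\mathbb R}_{>0}$ with $k\gg\partial\rho^{-*}$ and $K:=[-k,k]^n\subseteq{}^{\sigma}\widetilde{\mathbb R}^n$. Let $f\in{}^{\sigma}\mathcal{GC}^\infty(X)$ with $K\subseteq X\subseteq{}^{\sigma}\widetilde{\mathbb R}^n$. Then for all $h\in{}^{\sigma}\widetilde{\mathbb R}$ sufficiently large, we have $$\mathcal F_h^{-1}\big(\mathcal F_k(f)\big)(y)=_\rho\mathcal F_h\big(\mathcal F_k^{-1}(f)\big)(y)=_\rho f(y)$$ for all $\rho$-moderate points $y\in K$ (i.e. all $y\in K$ whose components belong to ${}^{\rho}_{\sigma}\widetilde{\mathbb R}$).
   Context: A gauge is a net $\sigma=(\sigma_\varepsilon)_{\varepsilon\in(0,1]}$ in $(0,1]$ with $\sigma_\varepsilon\to0$ as $\varepsilon\to0^+$. ''For $\varepsilon$ small'' means for all $\varepsilon\in(0,\varepsilon_0]$, for some $\varepsilon_0$. A net $(x_\varepsilon)$ of reals is $\sigma$-moderate if for some $N\in\mathbb N$, $|x_\varepsilon|\le\sigma_\varepsilon^{-N}$ for $\varepsilon$ small; $(x_\varepsilon)\sim_\sigma(y_\varepsilon)$ if for every $m\in\mathbb N$, $|x_\varepsilon-y_\varepsilon|\le\sigma_\varepsilon^m$ for $\varepsilon$ small. ${}^{\sigma}\widetilde{\mathbb R}$ is the quotient ring of $\sigma$-moderate nets by $\sim_\sigma$, with classes $[x_\varepsilon]$; ${}^\sigma\widetilde{\mathbb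 C}:={}^\sigma\widetilde{\mathbb R}+i\,{}^\sigma\widetilde{\mathbb R}$. Order: $[x_\varepsilon]\le[y_\varepsilon]$ iff there are representatives with $x_\varepsilon\le y_\varepsilon$ for all $\varepsilon$; $x<y$ means $x\le y$ and $y-x$ is invertible. $|[x_\varepsilon]|:=[|x_\varepsilon|]$. $[a,b]:=\{x\mid a\le x\le b\}$. For gauges $\sigma,\rho$: $\sigma\ll\rho$ (''$\sigma$ is an auxiliary gauge of $\rho$'') means $\exists Q\in\mathbb N\,\forall q\in\mathbb N$: $\sigma_\varepsilon^Q\le\rho_\varepsilon^q$ for $\varepsilon$ small. Then every $\rho$-moderate net is $\sigma$-moderate, and ${}^{\rho}_{\sigma}\widetilde{\mathbb R}:=\{[x_\varepsilon]\in{}^\sigma\widetilde{\mathbb R}\mid (x_\varepsilon)\text{ is }\rho\text{-moderate}\}$. $\partial\rho:=[\rho_\varepsilon]\in{}^\sigma\widetilde{\mathbb R}$. For $x,y$ in ${}^\sigma\widetilde{\mathbb R}$ (or ${}^\sigma\widetilde{\mathbb C}$), $x=_\rho y$ means $|x-y|\le\partial\rho^q$ for all $q\in\mathbb N$. $k\gg\partial\rho^{-*}$ (''$k$ is $\rho$-immoderate'') means $k\ge\partial\rho^{-Q}$ for all $Q\in\mathbb N$. Generalized smooth functions: for $X\subseteq{}^\sigma\widetilde{\mathbb R}^n$, $f\in{}^{\sigma}\mathcal{GC}^\infty(X)$ means that $f:X\to{}^\sigma\widetilde{\mathbb C}$ and there is a net $f_\varepsilon\in\mathcal C^\infty(\mathbb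 R^n,\mathbb C)$ such that for all $[x_\varepsilon]\in X$: $f([x_\varepsilon])=[f_\varepsilon(x_\varepsilon)]$ and $(\partial^\alpha f_\varepsilon(x_\varepsilon))$ is $\sigma$-moderate for all $\alpha\in\mathbb N^n$. For $K=[-k,k]^n$, $\int_Kf\,\mathrm dx:=\big[\int_{[-k_\varepsilon,k_\varepsilon]^n}f_\varepsilon\,\mathrm dx\big]\in{}^\sigma\widetilde{\mathbb C}$. For an infinite $k\in{}^\sigma\widetilde{\mathbb R}_{>0}$ (i.e. $k\geq r$ for all $r\in\mathbb R_{>0}$) and $\omega,x\in{}^\sigma\widetilde{\mathbb R}^n$: $\mathcal F_k(f)(\omega):=\int_K f(x)e^{-ix\cdot\omega}\,\mathrm dx$, $\mathcal F_k^{-1}(f)(x):=(2\pi)^{-n}\int_K f(\omega)e^{ix\cdot\omega}\,\mathrm d\omega$; both are GSF on ${}^\sigma\widetilde{\mathbb R}^n$. ''For all $h\in{}^\sigma\widetilde{\mathbb R}$ sufficiently large'' means: there exists $\bar h\in{}^\sigma\widetilde{\mathbb R}$ such that the property holds for all $h\in{}^\sigma\widetilde{\mathbb R}$ with $h\ge\bar h$. *)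

(* Defs.v *)
From HB Require Import structures.
From mathcomp Require Import all_boot all_order all_algebra.
From mathcomp Require Import all_classical all_reals all_analysis.
From mathcomp Require Import complex.

Set Implicit Arguments.
Unset Strict Implicit.
Unset Printing Implicit Defensive.

Import Order.TTheory GRing.Theory Num.Theory.
Import numFieldNormedType.Exports.

Local Open Scope classical_set_scope.
Local Open Scope ring_scope.
Local Open Scope quotient_scope.

Local Notation reC := complex.Re.
Local Notation imC := complex.Im.
Local Notation normC := Normc.normc.

(* Nets are functions on all of R, but only their values at e in (0, 1] are
   ever used.  "For e small" is [\forall e \near 0^'+, _]. *)
Record gauge (R : realType) := Gauge {
  gauge_val :> R -> R;
  gauge_itv : forall e, 0 < e <= 1 -> 0 < gauge_val e <= 1;
  gauge_cvg : gauge_val e @[e --> 0^'+] --> 0 }.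

Section Ring.
Context {R : realType}.
Implicit Types (sigma : gauge R).

Lemma near_gauge sigma :
  \forall e \near (0 : R)^'+, 0 < sigma e <= 1.
Proof.
near=> e; apply: gauge_itv; apply/andP; split.
  by near: e; exact: nbhs_right_gt.
by near: e; exact: nbhs_right_le.
Unshelve. all: by end_near. Qed.

Definition is_moderate sigma (u : R -> R) : Prop :=
  exists N : nat, \forall e \near 0^'+, `|u e| <= sigma e ^- N.

Definition moderate sigma : {pred (R -> R)} := fun u : R -> R =>
  `[< is_moderate sigma u >].

Lemma moderate_subring sigma : subring_closed (moderate sigma).
Proof.
have mono (x : R) (n m : nat) : 0 < x <= 1 -> (n <= m)%N -> x ^- n <= x ^- m.
  move=> /andP[x0 x1] nm; rewrite lef_pV2 ?posrE ?exprn_gt0//.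
  by apply: ler_wiXn2l => //; exact: ltW.
split.
- apply/asboolP; exists 0%N; near=> e.
  by rewrite expr0 invr1 normr1.
- move=> u v /asboolP[N uN] /asboolP[M vM]; apply/asboolP.
  exists (maxn N M).+1.
  have := @gauge_cvg _ sigma.
  move=> /cvgrPdist_lt /(_ 2^-1 ltac:(by rewrite invr_gt0)).
  move=> s2; near=> e.
  have s01 : 0 < sigma e <= 1 by near: e; exact: near_gauge.
  have /andP[s0 s1] := s01.
  have h2 : 2 <= (sigma e)^-1.
    rewrite -[2]invrK lef_pV2 ?posrE ?invr_gt0//.
    have : `|0 - sigma e| < 2^-1 by near: e; exact: s2.
    by rewrite sub0r normrN gtr0_norm// => /ltW.
  rewrite exprS invfM; apply: le_trans (_ : 2 * sigma e ^- maxn N M <= _).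
    apply: le_trans (ler_normB _ _) _; rewrite mulr_natl mulr2n; apply: lerD.
      apply: le_trans (mono _ N (maxn N M) s01 (leq_maxl _ _)).
      by near: e; exact: uN.
    apply: le_trans (mono _ M (maxn N M) s01 (leq_maxr _ _)).
    by near: e; exact: vM.
  by rewrite ler_wpM2r// invr_ge0 exprn_ge0// ltW.
- move=> u v /asboolP[N uN] /asboolP[M vM]; apply/asboolP.
  exists (N + M)%N; near=> e.
  rewrite [(u * v) e]/(u e * v e) normrM exprD invfM; apply: ler_pM => //.
    by near: e; exact: uN.
  by near: e; exact: vM.
Unshelve. all: by end_near. Qed.

HB.instance Definition _ sigma :=
  GRing.isSubringClosed.Build (R -> R) (moderate sigma) (moderate_subring sigma).

Record mnet sigma := MNet {
  mnet_val :> R -> R; _ : mnet_val \in moderate sigma }.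

HB.instance Definition _ sigma := [isSub for @mnet_val sigma].
HB.instance Definition _ sigma := [Choice of mnet sigma by <:].
HB.instance Definition _ sigma :=
  [SubChoice_isSubComNzRing of mnet sigma by <:].

Definition negligible sigma : {pred mnet sigma} := fun u : mnet sigma =>
  `[< forall m : nat, \forall e \near 0^'+, `|u e| <= sigma e ^+ m >].

Lemma negligible_ideal sigma : idealr_closed (@negligible sigma).
Proof.
have s2 : \forall e \near (0 : R)^'+, sigma e < 2^-1.
  have := @gauge_cvg _ sigma.
  move=> /cvgrPdist_lt /(_ 2^-1 ltac:(by rewrite invr_gt0)).
  apply: filterS2 (near_gauge sigma) => e /andP[s0 _].
  by rewrite sub0r normrN gtr0_norm.
split.
- apply/asboolP => m; near=> e.
  have /andP[s0 _] : 0 < sigma e <= 1 by near: e; exact: near_gauge.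
  by rewrite normr0 exprn_ge0// ltW.
- apply/negP => /asboolP/(_ 1%N) s1.
  have : \forall e \near (0 : R)^'+, False.
    near=> e.
    have : `|(1 : mnet sigma) e| <= sigma e ^+ 1 by near: e; exact: s1.
    rewrite [X in `|X|](_ : _ = 1)// normr1 expr1 leNgt.
    apply/negP/negPn; apply: lt_trans (_ : 2^-1 < 1).
      by near: e.
    by rewrite invf_lt1// ltr1n.
  by move=> /filter_ex[].
- move=> a u v /asboolP un /asboolP vn; apply/asboolP => m.
  have [N aN] : is_moderate sigma a by apply/asboolP; case: a.
  near=> e.
  have /andP[s0 s1] : 0 < sigma e <= 1 by near: e; exact: near_gauge.
  have s12 : sigma e <= 2^-1 by apply/ltW; near: e.
  rewrite [(a * u + v : mnet sigma) e]/(a e * u e + v e).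
  apply: le_trans (ler_normD _ _) _.
  apply: (@le_trans _ _ (sigma e ^+ m.+1 + sigma e ^+ m.+1)).
    apply: lerD; last by near: e; exact: vn.
    rewrite normrM.
    apply: (@le_trans _ _ (sigma e ^- N * sigma e ^+ (N + m.+1))).
      apply: ler_pM => //; first by near: e; exact: aN.
      by near: e; exact: un.
    by rewrite exprD mulrA mulVf ?mul1r// expf_neq0// gt_eqF.
  rewrite exprS -mulrDl -[leRHS]mul1r ler_wpM2r ?exprn_ge0 ?(ltW s0)//.
  by rewrite [leRHS](splitr 1) !div1r lerD.
Unshelve. all: by end_near. Qed.

HB.instance Definition _ sigma :=
  isIdealr.Build (mnet sigma) (@negligible sigma) (negligible_ideal sigma).

Definition gR sigma : Type := {ideal_quot @negligible sigma}.
HB.instance Definition _ sigma := GRing.ComNzRing.on (gR sigma).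

Definition gR_unit sigma : pred (gR sigma) := fun x =>
  `[< exists y, y * x = 1 >].

Definition gR_inv sigma (x : gR sigma) : gR sigma :=
  xget x [set y | y * x = 1].

Lemma gR_mulVr sigma : {in @gR_unit sigma, left_inverse 1 (@gR_inv sigma) *%R}.
Proof. by move=> x /asboolP[y yx]; rewrite /gR_inv; case: xgetP => // /(_ y). Qed.

Lemma gR_unitPl sigma (x y : gR sigma) : y * x = 1 -> @gR_unit sigma x.
Proof. by move=> yx; apply/asboolP; exists y. Qed.

Lemma gR_invr_out sigma : {in [predC @gR_unit sigma], @gR_inv sigma =1 id}.
Proof.
move=> x /asboolP nx; rewrite /gR_inv; case: xgetP => // y _ yx.
by exfalso; apply: nx; exists y.
Qed.

HB.instance Definition _ sigma := GRing.ComNzRing_hasMulInverse.Build (gR sigma)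
  (@gR_mulVr sigma) (@gR_unitPl sigma) (@gR_invr_out sigma).

End Ring.

Section GeneralizedNumbers.
Context {R : realType}.
Implicit Types sigma rho : gauge R.

(* The class [u_e]; it is 0 when u is not sigma-moderate. *)
Definition gclass sigma (u : R -> R) : gR sigma :=
  \pi_(gR sigma) (insubd (0 : mnet sigma) u).

Definition repr_net sigma (x : gR sigma) : R -> R := mnet_val (repr x).

Definition represents sigma (u : R -> R) (x : gR sigma) : Prop :=
  is_moderate sigma u /\ gclass sigma u = x.

Definition gle sigma (x y : gR sigma) : Prop := exists u v,
  [/\ represents u x, represents v y & forall e, 0 < e <= 1 -> u e <= v e].

Definition glt sigma (x y : gR sigma) : Prop :=
  gle x y /\ y - x \is a GRing.unit.

Definition auxiliary_gauge sigma rho : Prop := exists Q : nat, forall q : nat,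
  \forall e \near 0^'+, sigma e ^+ Q <= rho e ^+ q.

Definition drho sigma rho : gR sigma := gclass sigma rho.

Definition rho_moderate sigma rho (x : gR sigma) : Prop :=
  exists u, represents u x /\ is_moderate rho u.

(* [drho sigma rho] is invertible when sigma is an auxiliary gauge of rho. *)
Definition rho_immoderate sigma rho (x : gR sigma) : Prop :=
  forall Q : nat, gle (drho sigma rho ^- Q) x.

(* Only the additive structure of [(gR sigma)[i]] is canonical, since [gR sigma]
   is not a field; its product is [ComplexField.mulc]. *)
Definition gC sigma : Type := (gR sigma)[i].
HB.instance Definition _ sigma := GRing.Zmodule.on (gC sigma).

Definition gmul sigma (z w : gC sigma) : gC sigma := ComplexField.mulc z w.

Definition gCclass sigma (u : R -> R[i]) : gC sigma :=
  (gclass sigma (fun e => reC (u e)) +i*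
   gclass sigma (fun e => imC (u e)))%C.

Definition cmoderate sigma (u : R -> R[i]) : Prop :=
  is_moderate sigma (fun e => normC (u e)).

Definition gnorm sigma (z : gC sigma) : gR sigma := gclass sigma (fun e =>
  normC (repr_net (reC z) e +i* repr_net (imC z) e)%C).

Definition eq_rho sigma rho (z w : gC sigma) : Prop :=
  forall q : nat, gle (gnorm (z - w)) (drho sigma rho ^+ q).

(* e^(i x) for x real *)
Definition gexpi sigma (x : gR sigma) : gC sigma :=
  gCclass sigma (fun e => cos (repr_net x e) +i* sin (repr_net x e))%C.

Definition gdot sigma n (x y : 'rV[gR sigma]_n) : gR sigma :=
  \sum_i x ord0 i * y ord0 i.

Definition gcube sigma n (k : gR sigma) : set 'rV[gR sigma]_n :=
  [set x | forall i, gle (- k) (x ord0 i) /\ gle (x ord0 i) k].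

Definition vrepresents sigma n (u : R -> 'rV[R]_n)
    (x : 'rV[gR sigma]_n) : Prop :=
  forall i, represents (fun e => u e ord0 i) (x ord0 i).

End GeneralizedNumbers.

Section SmoothFunctions.
Context {R : realType}.

Definition partial n (i : 'I_n) (g : 'rV[R]_n -> R) : 'rV[R]_n -> R :=
  fun x => 'D_(delta_mx ord0 i) g x.

Definition partials n (s : seq 'I_n) (g : 'rV[R]_n -> R) : 'rV[R]_n -> R :=
  foldr (@partial n) g s.

Definition smooth n (g : 'rV[R]_n -> R) : Prop := forall s : seq 'I_n,
  continuous (partials s g) /\
  forall i x, derivable (partials s g) x (delta_mx ord0 i).

Definition csmooth n (g : 'rV[R]_n -> R[i]) : Prop :=
  smooth (fun x => reC (g x)) /\ smooth (fun x => imC (g x)).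

Definition multi_index_seq n (alpha : 'I_n -> nat) : seq 'I_n :=
  flatten [seq nseq (alpha i) i | i <- enum 'I_n].

(* alpha-th partial derivative, for a multi-index alpha *)
Definition cpartial n (alpha : 'I_n -> nat) (g : 'rV[R]_n -> R[i]) :
    'rV[R]_n -> R[i] := fun x =>
  (partials (multi_index_seq alpha) (fun t => reC (g t)) x +i*
   partials (multi_index_seq alpha) (fun t => imC (g t)) x)%C.

(* The library has no Lebesgue measure on R^n: the integral of a continuous
   function over the cube [-a, a]^n is the iterated integral (by Fubini, the
   order of the variables does not matter). *)
Fixpoint cube_int n (a : R) : ('rV[R]_n -> R) -> R :=
  match n with
  | 0 => fun g => g 0
  | n'.+1 => fun g => \int[lebesgue_measure]_(t in `[- a, a])
      @cube_int n' a (fun x : 'rV[R]_n' => g (row_mx (t%:M : 'rV[R]_1) x))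
  end.

Definition ccube_int n (a : R) (g : 'rV[R]_n -> R[i]) : R[i] :=
  (cube_int a (fun x => reC (g x)) +i* cube_int a (fun x => imC (g x)))%C.

End SmoothFunctions.

Section GSF.
Context {R : realType}.
Variables (sigma : gauge R) (n : nat).
Implicit Types (X : set 'rV[gR sigma]_n) (f : 'rV[gR sigma]_n -> gC sigma).

(* A function X -> gC is a total function of which only the values on X matter.
   The net is tested on all representatives of the points of X. *)
Definition defining_net X f (F : R -> 'rV[R]_n -> R[i]) : Prop :=
  (forall e, 0 < e <= 1 -> csmooth (F e)) /\
  forall x u, X x -> vrepresents u x ->
    f x = gCclass sigma (fun e => F e (u e)) /\
    forall alpha : 'I_n -> nat,
      cmoderate sigma (fun e => cpartial alpha (F e) (u e)).

Definition GSF X f : Prop := exists F, defining_net X f F.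

(* Integral of a GSF over [-k, k]^n, computed with a defining net of its
   restriction to this cube.  For k >= 0 neither the net selected by [xget] nor
   the representative of k matters. *)
Definition gint (k : gR sigma) f : gC sigma :=
  let F := xget (fun=> cst 0) [set F | defining_net (gcube k) f F] in
  gCclass sigma (fun e => ccube_int (repr_net k e) (F e)).

Definition fourier (k : gR sigma) f : 'rV[gR sigma]_n -> gC sigma :=
  fun w => gint k (fun x => gmul (f x) (gexpi (- gdot x w))).

Definition inv_fourier (k : gR sigma) f : 'rV[gR sigma]_n -> gC sigma :=
  fun x => gmul (real_complex _ (gclass sigma (cst ((2 * pi) ^- n))))
                (gint k (fun w => gmul (f w) (gexpi (gdot x w)))).

End GSF.

(* Main.v *)
Require Import Defs.
From mathcomp Require Import all_boot all_order all_algebra.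
From mathcomp Require Import all_classical all_reals all_analysis.
From mathcomp Require Import complex ring lra.

Set Implicit Arguments.
Unset Strict Implicit.
Unset Printing Implicit Defensive.

Import Order.TTheory GRing.Theory Num.Theory.
Import numFieldNormedType.Exports.

Local Open Scope classical_set_scope.
Local Open Scope ring_scope.

Local Notation reC := complex.Re.
Local Notation imC := complex.Im.
Local Notation normC := Normc.normc.

(* Everything is computed on representatives, for each fixed e.  The function
   w |-> F_k(f)(w) e^(i y w) is represented on [-h, h]^n by a finite
   trigonometric sum, obtained from a quadrature rule on [-k, k]^n whose mesh
   depends on e and is so fine that all errors are negligible.  Integrating that
   sum over [-h, h]^n is elementary and leaves the quadrature of f(x) times the
   product of the kernels 2 sin(h (x_i - y_i)) / (x_i - y_i), so that neither
   Fubini's theorem nor differentiation under the integral sign is needed for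
   the compositions, and both compositions have the same value.
   The Dirichlet kernel is then handled one variable at a time: with P a
   primitive of sin(h z) / z, |P(z) - pi/2| <= 6 / (1 + h z) for z >= 0 (Laplace
   transform), so that integration by parts reproduces f(y) up to C log(1 + hk)/h,
   where C bounds f and its first partial derivatives, while the L^1 norm of the
   kernel grows only like log(1 + hk).  As h is moderate, the logarithms are
   bounded by a fixed power of 1/sigma, and h >= sigma^-M with M large makes the
   error at most sigma^Q, where sigma^Q <= rho^q for all q.  The rho-moderate
   point y is at distance at least 1 from the boundary because k is
   rho-immoderate. *)

(** * Primitives of continuous functions *)

(** Two obstacles shape the proof. First, [gint] selects an arbitrary defining net, and nets are
    known to be moderate or negligible only at generalized points. Maximizing over the compact cube
    for each e yields such a point, so pointwise information becomes uniform; this makes the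
    integral independent of the net and bounds f and its derivatives on K. Second, the threshold for
    h has to be fixed before h and y are known. In the error the constants depend only on f and k,
    and the logarithm of any moderate net is below sigma^-2 for small e; the order of growth of h
    only decides how small e has to be. A mesh of uncontrolled fineness is harmless: the weights of
    the rule are nonnegative and add up to (2k)^n, so the trigonometric sum has moderate total
    amplitude and moderate frequencies x - y, and each of its derivatives is moderate whatever the
    number of nodes. *)

Section OneVariable.
Context {R : realType}.
Notation mu := (@lebesgue_measure R).
Implicit Types (a b x y h : R).

Lemma continuous_integrable (psi : R -> R) a b :
  continuous psi -> mu.-integrable `[a, b] (EFin \o psi).
Proof.
move=> cpsi; apply: continuous_compact_integrable; first exact: segment_compact.
exact: continuous_subspaceT.
Qed.

Lemma Rintegral_itvD (psi : R -> R) a b c : continuous psi -> a <= b -> b <= c ->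
  \int[mu]_(t in `[a, c]) psi t =
  \int[mu]_(t in `[a, b]) psi t + \int[mu]_(t in `[b, c]) psi t.
Proof.
move=> cpsi ab bc.
have := @Rintegral_itvB R psi (BLeft a) (BRight c) b (continuous_integrable a c cpsi).
rewrite !bnd_simp => /(_ ab bc) e.
rewrite [X in _ = _ + X](_ : _ = \int[mu]_(t in `]b, c]) psi t).
  by rewrite -e addrCA subrr addr0.
rewrite Rintegral_itv_obnd_cbnd//.
by apply: integrableS (continuous_integrable b c cpsi) => //; apply: subset_itvr; rewrite bnd_simp.
Qed.

(** By the mean value theorem [g + f] and [g - f] are nondecreasing. Together with [primitive] this
    bounds an integral by the increment of an explicit antiderivative of a bound of the
    integrand. *)
Lemma ler_derive_diff (f g df dg : R -> R) a b : a <= b ->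
  (forall x, x \in `[a, b] -> is_derive x 1 f (df x)) ->
  (forall x, x \in `[a, b] -> is_derive x 1 g (dg x)) ->
  (forall x, x \in `]a, b[ -> `|df x| <= dg x) ->
  `|f b - f a| <= g b - g a.
Proof.
move=> ab df_ dg_ le_fg.
have key (F dF : R -> R) : (forall x, x \in `[a, b] -> is_derive x 1 F (dF x)) ->
    (forall x, x \in `]a, b[ -> 0 <= dF x) -> F a <= F b.
  move=> dF_ dF0; move: ab; rewrite le_eqVlt => /predU1P[->//|ab].
  have dF' x : x \in `]a, b[ -> is_derive x 1 F (dF x).
    by move=> xab; apply: dF_; exact: subset_itv_oo_cc xab.
  have cF : {within `[a, b], continuous F}.
    apply: derivable_within_continuous => x xab.
    by case: (dF_ x xab).
  case: (@MVT R F dF a b ab dF' cF) => c cab e.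
  by rewrite -subr_ge0 e mulr_ge0 ?dF0// subr_ge0 ltW.
rewrite ler_norml; apply/andP; split; rewrite -subr_ge0.
- have : g a + f a <= g b + f b.
    apply: (key (fun x => g x + f x) (fun x => dg x + df x)).
      by move=> x xab; exact: is_deriveD (dg_ x xab) (df_ x xab).
    by move=> x xab; have := le_fg x xab; rewrite ler_norml => /andP[]; lra.
  lra.
- have : g a - f a <= g b - f b.
    apply: (key (fun x => g x - f x) (fun x => dg x - df x)).
      by move=> x xab; exact: is_deriveB (dg_ x xab) (df_ x xab).
    by move=> x xab; have := le_fg x xab; rewrite ler_norml => /andP[]; lra.
  lra.
Qed.

Definition primitive (psi Psi : R -> R) : Prop :=
  (forall x, is_derive x 1 Psi (psi x)) /\
  forall a b, a <= b -> \int[mu]_(t in `[a, b]) psi t = Psi b - Psi a.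

Lemma primitive_exists (psi : R -> R) : continuous psi ->
  exists Psi, primitive psi Psi.
Proof.
move=> cpsi.
pose Psi x := if 0 <= x then \int[mu]_(t in `[0, x]) psi t
              else - \int[mu]_(t in `[x, 0]) psi t.
have PsiE A x : A <= 0 -> A <= x -> Psi x =
    \int[mu]_(t in `[A, x]) psi t - \int[mu]_(t in `[A, 0]) psi t.
  move=> A0 Ax; rewrite /Psi; case: ifPn => [x0|]; last rewrite -ltNge => /ltW x0.
    by rewrite (@Rintegral_itvD _ A 0 x)// addrAC subrr add0r.
  by rewrite (@Rintegral_itvD _ A x 0)// opprD addrA subrr add0r.
exists Psi; split.
  (* [A] is strictly below both x and 0, so near x the function [Psi] is the integral from [A] minus
     a constant, and x is interior to [A, x + 1]. *)
  move=> x; pose A := Num.min x 0 - 1.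
  have A0 : A < 0 by rewrite ltrBlDr add0r gt_min ltr01 orbT.
  have Ax : A < x by rewrite ltrBlDr gt_min ltrDl ltr01.
  pose F x := \int[mu]_(t in `[A, x]) psi t.
  have [dF F'] := @continuous_FTC1_closed R psi A x (x + 1) (ltac:(by rewrite ltrDl))
    (continuous_integrable A (x+1) cpsi) Ax (cpsi x).
  have dF' : is_derive x 1 F (psi x) by apply: (DeriveDef dF); rewrite -derive1E; exact: F'.
  have : is_derive x 1 (fun x => F x - F 0) (psi x - 0) 
    by exact: (is_deriveB dF' (is_derive_cst (F 0) x 1)).
  rewrite subr0; apply: near_eq_is_derive.
  near=> t; rewrite (PsiE A) ?ltW//; near: t.
  exact: lt_nbhsr.
move=> a b ab; pose A := Num.min a 0.
have Aa : A <= a by rewrite ge_min lexx.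
have A0 : A <= 0 by rewrite ge_min lexx orbT.
rewrite (PsiE A b) ?(PsiE A a)// ?(le_trans Aa)//.
by rewrite (@Rintegral_itvD _ A a b)//; lra.
Unshelve. all: by end_near. Qed.

End OneVariable.

(** * The sine kernel and the Dirichlet integral *)

Section Kernel.
Context {R : realType}.
Notation mu := (@lebesgue_measure R).
Implicit Types (a b x y h t : R).

Lemma is_derive1_continuous (f : R -> R) t d :
  is_derive t 1 f d -> {for t, continuous f}.
Proof. by move=> [df _]; exact/differentiable_continuous/derivable1_diffP. Qed.

Lemma Rintegral_FTC (psi F : R -> R) a b : continuous psi ->
  (forall x, is_derive x 1 F (psi x)) -> a <= b ->
  \int[mu]_(t in `[a, b]) psi t = F b - F a.
Proof.
move=> cpsi dF ab; have [Psi [dPsi ->//]] := primitive_exists cpsi.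
have dD x : is_derive x 1 (Psi - F) 0.
  by rewrite -(subrr (psi x)); exact: is_deriveB.
have /= := is_derive_0_is_cst b a dD.
by rewrite -![(Psi - F) _]/(Psi _ - F _); lra.
Qed.

(** The Dirichlet kernel: twice [sinq h z] is the integral of e^(izt) over [-h, h]. The value [h]
    fills the removable singularity. *)
Definition sinq h t := if t == 0 then h else sin (h * t) / t.

Lemma mulr_sinq h t : t * sinq h t = sin (h * t).
Proof.
rewrite /sinq; case: eqVneq => [->|t0]; first by rewrite mul0r mulr0 sin0.
by rewrite mulrC divfK.
Qed.

Lemma sinqN h t : sinq h (- t) = sinq h t.
Proof. by rewrite /sinq oppr_eq0 mulrN sinN invrN mulrNN. Qed.

Lemma is_derive_sinM h t : is_derive t 1 (fun t => sin (h * t)) (h * cos (h * t)).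
Proof.
have d1 : is_derive t 1 (fun x => h * x) h.
  by have := is_deriveZ h (is_derive_id t (1 : R)); rewrite /GRing.scale /= mulr1.
by have := is_derive1_comp (is_derive_sin (h * t)) d1; rewrite mulrC.
Qed.

Lemma continuous_sinq h : continuous (sinq h).
Proof.
have csin : continuous (fun t => sin (h * t)).
  by move=> t; exact: is_derive1_continuous (is_derive_sinM h t).
move=> t; have [->|t0] := eqVneq t 0.
  apply/continuous_withinNx; rewrite /sinq eqxx.
  (* Away from 0, [sinq h] is the difference quotient of sin (h t) at 0, whose limit is the
     derivative h. *)
  have [/cvg_ex[/= l cl] e] := is_derive_sinM h 0.
  have lh : l = h.
    move: e; rewrite mulr0 cos0 mulr1 => <-.
    exact/esym/cvg_lim.
  rewrite -[X in _ --> X]lh; move: cl.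
  apply: cvg_trans; apply: near_eq_cvg; near=> x.
  have /negPf-> : x != 0 by near: x; exact: nbhs_dnbhs_neq.
  by rewrite mulr0 sin0 subr0 addr0 /GRing.scale /= mulr1 mulrC.
have : {for t, continuous (fun t => sin (h * t) / t)}.
  by apply: cvgM; [exact: csin|exact: (@inv_continuous R t)].
rewrite /prop_for /continuous_at /sinq (negPf t0).
apply: cvg_trans; apply: near_eq_cvg; near=> x.
have /negPf->// : x != 0.
near: x; apply: (cvgr_neq0 t) => //.
Unshelve. all: by end_near. Qed.

Lemma normr_sin_le x : `|sin x| <= `|x|.
Proof.
wlog x0 : x / 0 <= x.
  move=> H; have [/H//|/ltW x0] := leP 0 x.
  by rewrite -normrN -sinN -[leRHS]normrN; apply: H; rewrite oppr_ge0.
have := @ler_derive_diff R sin id cos (fun=> 1) 0 x x0.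
rewrite sin0 !subr0 (ger0_norm x0); apply.
by move=> y _; exact: cos_max.
Qed.

Lemma normr_sinq_le h t : 0 <= h -> `|sinq h t| <= h.
Proof.
move=> h0; rewrite /sinq; case: eqVneq => [_|t0]; first by rewrite ger0_norm.
rewrite normrM normfV ler_pdivrMr ?normr_gt0//.
by rewrite -{2}(ger0_norm h0) -normrM normr_sin_le.
Qed.

(** Adds [|sinq| <= h] and [h |t| |sinq| <= h]. For t >= 0 the function h / (1 + h t) has the
    primitive ln (1 + h t), which is the source of all logarithms below. *)
Lemma normr_sinq_decay h t : 0 <= h -> `|sinq h t| <= 2 * (h / (1 + h * `|t|)).
Proof.
move=> h0; have ht0 : 0 <= h * `|t| by rewrite mulr_ge0.
have p : 0 < 1 + h * `|t| by rewrite ltr_wpDr.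
rewrite mulrA ler_pdivlMr// mulrDr mulr1.
have : `|t| * `|sinq h t| <= 1 by rewrite -normrM mulr_sinq sin_max.
have := normr_sinq_le t h0.
move=> H1 H2; have : h * (`|t| * `|sinq h t|) <= h * 1 by rewrite ler_wpM2l.
rewrite mulr1 mulrA [_ * (h * _)]mulrC; lra.
Qed.

(** The phase [th] covers sines as well as cosines, and in several variables it absorbs the
    contribution of the other coordinates. *)
Lemma Rintegral_cos h z th : 0 <= h ->
  \int[mu]_(t in `[- h, h]) cos (th + z * t) = 2 * (cos th * sinq h z).
Proof.
move=> h0; have hh : - h <= h by rewrite ge0_cp.
have dl x : is_derive x 1 (fun t => th + z * t) z.
  have /= := is_deriveD (is_derive_cst th x 1) (is_deriveZ z (is_derive_id x (1 : R))).
  by rewrite /GRing.scale /= mulr1 add0r.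
have cc : continuous (fun t => cos (th + z * t)).
  move=> t; apply: continuous_comp; last exact: continuous_cos.
  exact: is_derive1_continuous (dl t).
have [->|z0] := eqVneq z 0.
  rewrite /sinq eqxx.
  under eq_Rintegral do rewrite mul0r addr0.
  have dF x : is_derive x 1 (fun t => cos th * t) (cos th).
    by have := is_deriveZ (cos th) (is_derive_id x (1 : R)); rewrite /GRing.scale /= mulr1.
  rewrite (Rintegral_FTC _ dF hh); first by lra.
  exact: cst_continuous.
have dF x : is_derive x 1 (fun t => z^-1 * sin (th + z * t)) (cos (th + z * x)).
  have := is_deriveZ z^-1 (@is_derive1_comp R sin (fun t => th + z * t) x _ _ (is_derive_sin _) (dl x)).
  by rewrite /GRing.scale /= mulrCA mulVf// mulr1.
rewrite (Rintegral_FTC cc dF hh).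
rewrite /sinq (negPf z0) mulrN sinB sinD [h * z]mulrC; field.
exact: z0.
Qed.

End Kernel.

Section SineIntegral.
Context {R : realType}.
Notation mu := (@lebesgue_measure R).
Implicit Types (a b x y h t s : R).

Lemma is_derive_ext (f g : R -> R) t d d' :
  is_derive t 1 f d -> f =1 g -> d = d' -> is_derive t 1 g d'.
Proof. by move=> df /funext <- <-. Qed.

Lemma is_derive_expRM s t : is_derive t 1 (fun t => expR (s * t)) (s * expR (s * t)).
Proof.
have d1 : is_derive t 1 (fun x => s * x) s.
  by have := is_deriveZ s (is_derive_id t (1 : R)); rewrite /GRing.scale /= mulr1.
by have := @is_derive1_comp R expR (fun t => s * t) t _ _ (is_derive_expR _) d1; rewrite mulrC.
Qed.

Lemma is_derive_cosM h t : is_derive t 1 (fun t => cos (h * t)) (- (h * sin (h * t))).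
Proof.
have d1 : is_derive t 1 (fun x => h * x) h.
  by have := is_deriveZ h (is_derive_id t (1 : R)); rewrite /GRing.scale /= mulr1.
have := @is_derive1_comp R cos (fun t => h * t) t _ _ (is_derive_cos _) d1.
by rewrite mulNr mulrC.
Qed.

Lemma continuous_expRM s : continuous (fun t => expR (s * t)).
Proof. by move=> t; exact: is_derive1_continuous (is_derive_expRM s t). Qed.

Lemma Rintegral_expR_sin h s a : 0 < h -> 0 <= a ->
  \int[mu]_(t in `[0, a]) (expR (- s * t) * sin (h * t)) =
  (h - expR (- s * a) * (h * cos (h * a) + s * sin (h * a))) / (h ^+ 2 + s ^+ 2).
Proof.
move=> h0 a0.
have p : 0 < h ^+ 2 + s ^+ 2 by rewrite ltr_pwDl ?exprn_gt0 ?sqr_ge0.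
pose F t := - (h ^+ 2 + s ^+ 2)^-1 * (expR (- s * t) * (s * sin (h * t) + h * cos (h * t))).
have dF t : is_derive t 1 F (expR (- s * t) * sin (h * t)).
  have d1 := is_deriveD (is_deriveZ s (is_derive_sinM h t)) (is_deriveZ h (is_derive_cosM h t)).
  apply: (is_derive_ext (is_deriveZ (- (h ^+ 2 + s ^+ 2)^-1)
    (is_deriveM (is_derive_expRM (- s) t) d1))) => //.
  rewrite /GRing.scale /= -![(_ + _) t]/(s * sin (h * t) + h * cos (h * t)).
  by field; rewrite gt_eqF.
have cc : continuous (fun t => expR (- s * t) * sin (h * t)).
  move=> t; apply: cvgM; first exact: continuous_expRM.
  exact: is_derive1_continuous (is_derive_sinM h t).
rewrite (Rintegral_FTC cc dF a0) /F !mulr0 sin0 cos0 expR0.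
by field; rewrite gt_eqF.
Qed.

(** Differentiating in [s] brings down a factor -t, which cancels the denominator of [sinq] and
    leaves the elementary integral of [Rintegral_expR_sin]. *)
Lemma is_derive_laplace_sinq h s a : 0 < h -> 0 <= a ->
  is_derive s 1 (fun s => \int[mu]_(t in `[0, a]) (expR (- s * t) * sinq h t))
   (- \int[mu]_(t in `[0, a]) (expR (- s * t) * sin (h * t))).
Proof.
move=> h0 a0.
pose f s t := expR (- s * t) * sinq h t.
have cf x : continuous (f x).
  by move=> t; apply: cvgM; [exact: continuous_expRM|exact: continuous_sinq].
have df x t : is_derive x 1 (f ^~ t) (- (expR (- x * t) * sin (h * t))).
  have d0 : is_derive x 1 (fun x => expR (- t * x)) (- t * expR (- t * x)).
    exact: is_derive_expRM.
  apply: (is_derive_ext (is_deriveM d0 (is_derive_cst (sinq h t) x 1))).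
    by move=> u; rewrite -[(_ * _) u]/(_ * _) mulNr [t * u]mulrC -mulNr.
  rewrite /GRing.scale /= mulr0 add0r -mulr_sinq [- t * x]mulrC mulrN -mulNr.
  by rewrite /cst; ring.
have sI : s \in `](s - 1), (s + 1)[ by rewrite in_itv /= ltrBlDr ltrDl ltr01.
have intf x : `](s - 1), (s + 1)[%classic x -> mu.-integrable `[0, a] (EFin \o f x).
  by move=> _; exact: continuous_integrable.
have derf x t : `](s - 1), (s + 1)[%classic x -> `[0, a]%classic t -> derivable (f ^~ t) x 1.
  by move=> _ _; case: (df x t).
(* For x > s - 1 and 0 <= t <= a one has -x t <= (|s| + 1) a, so a constant dominates. *)
pose G (t : R) := expR ((`|s| + 1) * a).
have G0 t : 0 <= G t by rewrite expR_ge0.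
have intG : mu.-integrable `[0, a] (EFin \o G).
  by apply: continuous_integrable; exact: cst_continuous.
have d1E x t : partial1of2 f x t = - (expR (- x * t) * sin (h * t)).
  by rewrite partial1of2E; case: (df x t).
have ub x t : `](s - 1), (s + 1)[%classic x -> `[0, a]%classic t -> `|partial1of2 f x t| <= G t.
  rewrite /= !in_itv /= => /andP[sx _] /andP[t0 ta].
  rewrite d1E normrN normrM ger0_norm ?expR_ge0// -[G t]mulr1.
  apply: ler_pM; rewrite ?expR_ge0 ?sin_max//.
  rewrite ler_expR; apply: (@le_trans _ _ ((`|s| + 1) * t)).
    apply: ler_wpM2r => //.
    have : - s <= `|s| by rewrite -normrN ler_norm.
    lra.
  by apply: ler_wpM2l => //; rewrite addr_ge0.
have mI : measurable (`[0, a] : set (measurableTypeR R)) by [].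
have D := @derivable_under_integral R _ _ mu f _ mI s (s - 1) (s + 1) sI intf derf G G0 intG ub.
have E := @differentiation_under_integral R _ _ mu f _ mI s (s - 1) (s + 1) sI intf derf G G0 intG ub.
apply: (DeriveDef D); rewrite -derive1E E.
under eq_Rintegral do rewrite d1E.
under eq_Rintegral do rewrite -mulN1r.
rewrite RintegralZl ?mulN1r//.
apply: continuous_integrable => t; apply: cvgM; first exact: continuous_expRM.
exact: is_derive1_continuous (is_derive_sinM h t).
Qed.

Lemma ler_norm_Rintegral_itv (f g : R -> R) a b : continuous f -> continuous g ->
  (forall t, a <= t <= b -> `|f t| <= g t) ->
  `|\int[mu]_(t in `[a, b]) f t| <= \int[mu]_(t in `[a, b]) g t.
Proof.
move=> cf cg fg; apply: le_trans (le_normr_Rintegral _ _) _ => //.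
  exact: continuous_integrable.
apply: le_Rintegral => //.
- by apply: continuous_integrable => t; apply: continuous_comp; [exact: cf|exact: norm_continuous].
- exact: continuous_integrable.
Qed.

Lemma sine_integral h a : 0 < h -> 0 < a ->
  `|\int[mu]_(t in `[0, a]) sinq h t - pi / 2| <= 2 / (h * a).
Proof.
move=> h0 a0.
pose W s := \int[mu]_(t in `[0, a]) (expR (- s * t) * sinq h t).
(* The arctangent cancels the main term -h / (h^2 + s^2) of W'. Only the boundary term at a survives
   in V', of size at most (2 / h) e^(-a s), and the integral of this bound over s >= 0 is 2 / (h
   a). *)
pose V s := W s + atan (h^-1 * s).
have V0 : V 0 = \int[mu]_(t in `[0, a]) sinq h t.
  rewrite /V mulr0 atan0 addr0; apply: eq_Rintegral => t _.
  by rewrite oppr0 mul0r expR0 mul1r.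
have p s : 0 < h ^+ 2 + s ^+ 2 by rewrite ltr_pwDl ?exprn_gt0 ?sqr_ge0.
have dV s : is_derive s 1 V
    (expR (- s * a) * (h * cos (h * a) + s * sin (h * a)) / (h ^+ 2 + s ^+ 2)).
  have d1 : is_derive s 1 (fun x => h^-1 * x) h^-1.
    by have := is_deriveZ h^-1 (is_derive_id s (1 : R)); rewrite /GRing.scale /= mulr1.
  have d2 := @is_derive1_comp R atan (fun t => h^-1 * t) s _ _ (is_derive1_atan _) d1.
  apply: (is_derive_ext (is_deriveD (is_derive_laplace_sinq s h0 (ltW a0)) d2)) => //.
  rewrite Rintegral_expR_sin// ?ltW//.
  have e : (1 + (h^-1 * s) ^+ 2)^-1 * h^-1 = h / (h ^+ 2 + s ^+ 2).
    have ? : 1 + (h^-1 * s) ^+ 2 != 0.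
      by rewrite gt_eqF// ltr_pwDl// sqr_ge0.
    by field; rewrite !gt_eqF//= addrC.
  by rewrite e; field; rewrite gt_eqF.
pose g s := - (2 / (h * a)) * expR (- a * s).
have dg s : is_derive s 1 g (2 / h * expR (- a * s)).
  apply: (is_derive_ext (is_deriveZ (- (2 / (h * a))) (is_derive_expRM (- a) s))) => //.
  by rewrite /GRing.scale /=; field; rewrite !gt_eqF.
have VS S : 0 <= S -> `|V S - V 0| <= 2 / (h * a).
  move=> S0; apply: (@le_trans _ _ (g S - g 0)).
    apply: (@ler_derive_diff R V g _ _ 0 S S0 (fun s _ => dV s) (fun s _ => dg s)) => s.
    rewrite in_itv/= => /andP[s0 _].
    rewrite -mulrA normrM ger0_norm ?expR_ge0// mulrC mulNr [s * a]mulrC -mulNr.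
    apply: ler_wpM2r; first exact: expR_ge0.
    rewrite normrM normfV (gtr0_norm (p s)) ler_pdivrMr//.
    (* It remains to use h (h + s) <= 2 (h^2 + s^2). *)
    apply: (@le_trans _ _ (h + s)).
      rewrite (le_trans (ler_normD _ _))// !normrM (gtr0_norm h0) (gtr0_norm s0).
      by apply: lerD; rewrite ler_piMr ?cos_max ?sin_max// ltW.
    rewrite mulrAC ler_pdivlMr//.
    have := sqr_ge0 (h - s); have := sqr_ge0 s; rewrite sqrrB !expr2.
    nra.
  rewrite /g mulr0 expR0 mulr1 opprK gerDr mulNr oppr_le0.
  by rewrite mulr_ge0 ?expR_ge0// divr_ge0// mulr_ge0// ltW.
have WS S : 0 < S -> `|W S| <= h / S.
  move=> S0.
  have cE : continuous (fun t => h * expR (- S * t)).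
    by move=> t; apply: cvgM; [exact: cvg_cst|exact: continuous_expRM].
  have cW : continuous (fun t => expR (- S * t) * sinq h t).
    by move=> t; apply: cvgM; [exact: continuous_expRM|exact: continuous_sinq].
  apply: (le_trans (ler_norm_Rintegral_itv cW cE _)).
    move=> t _; rewrite normrM ger0_norm ?expR_ge0// mulrC.
    by apply: ler_wpM2r; [exact: expR_ge0|exact/normr_sinq_le/ltW].
  have dE t : is_derive t 1 (fun t => - (h / S) * expR (- S * t)) (h * expR (- S * t)).
    apply: (is_derive_ext (is_deriveZ (- (h / S)) (is_derive_expRM (- S) t))) => //.
    by rewrite /GRing.scale /=; field; rewrite gt_eqF.
  rewrite (Rintegral_FTC cE dE (ltW a0)) mulr0 expR0 mulr1 opprK gerDr mulNr oppr_le0.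
  by rewrite mulr_ge0 ?expR_ge0// divr_ge0 ?ltW.
rewrite -V0; apply/ler_addgt0Pr => e e0.
have e2 : 0 < e / 2 by rewrite divr_gt0.
(* V is evaluated at s = h x with x so large that both |pi / 2 - atan x| and |W (h x)| <= 1 / x are
   below e / 2; thus V 0 is compared with pi / 2. *)
have := @cvgy_atan R => /cvgrPdist_lt/(_ _ e2) H.
have : \forall x \near +oo, `|pi / 2 - atan x| < e / 2 /\ (e / 2)^-1 < x.
  by near=> x; split; near: x; [exact: H|apply: nbhs_pinfty_gt; exact: num_real].
move=> /filter_ex[x [xe ex]].
have x0 : 0 < x by rewrite (lt_trans _ ex)// invr_gt0.
have hx : 0 < h * x by rewrite mulr_gt0.
have := VS _ (ltW hx); have := WS _ hx.
rewrite {1}/V mulKf ?gt_eqF// invfM mulrA divff ?gt_eqF// mul1r => H1 H2.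
have H3 : x^-1 < e / 2 by rewrite -[ltRHS]invrK ltf_pV2// posrE invr_gt0.
move: H1 H2 xe; rewrite !ler_norml !ltr_norml => /andP[? ?] /andP[? ?] /andP[? ?].
apply/andP; split; lra.
Unshelve. all: by end_near. Qed.

End SineIntegral.

(** * Dirichlet inversion in one variable *)

Section Inversion1.
Context {R : realType}.
Notation mu := (@lebesgue_measure R).
Implicit Types (a b c x y z h t s u : R).

(* [s = 1] and [s = -1] are the two sides of the singularity [y]. *)
Lemma is_derive_lnD h y s t : 0 < 1 + h * (s * (t - y)) ->
  is_derive t 1 (fun t => ln (1 + h * (s * (t - y)))) (h * s / (1 + h * (s * (t - y)))).
Proof.
move=> p.
have d1 : is_derive t 1 (fun t => 1 + h * (s * (t - y))) (h * s).
  apply: (is_derive_ext (is_deriveD (is_derive_cst (1 : R) t (1 : R))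
    (is_deriveZ (h * s) (is_deriveB (is_derive_id t (1 : R)) (is_derive_cst y t (1 : R)))))).
    by move=> u; rewrite mulrA.
  by rewrite /GRing.scale /= subr0 mulr1 add0r.
have := @is_derive1_comp R (@ln R) (fun t => 1 + h * (s * (t - y))) t _ _ (is_derive1_ln p) d1.
by rewrite mulrC.
Qed.

Lemma ler_ln1D h u v : 0 <= h -> 0 <= u -> u <= v -> ln (1 + h * u) <= ln (1 + h * v).
Proof.
move=> h0 u0 uv; have v0 := le_trans u0 uv.
by rewrite ler_ln ?posrE ?ltr_wpDr ?mulr_ge0// lerD2l ler_wpM2l.
Qed.

(** The integral is split at the peak y. On each side its growth is dominated by that of 2 E ln (1 +
    h |t - y|), which vanishes at y, and |t - y| <= 2 a. *)
Lemma norm_Rintegral_sinq h a y E (e : R -> R) : 0 <= h -> continuous e ->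
  - a <= y <= a -> (forall t, - a <= t <= a -> `|e t| <= E) ->
  `|\int[mu]_(t in `[- a, a]) (sinq h (t - y) * e t)| <= 4 * E * ln (1 + h * (2 * a)).
Proof.
move=> h0 ce /andP[ay ya] eE.
have E0 : 0 <= E by apply: le_trans (eE y _); rewrite ?ay.
have cs : continuous (fun t => sinq h (t - y) * e t).
  move=> t; apply: cvgM; last exact: ce.
  apply: (@continuous_comp _ _ _ (fun t => t - y)); last exact: continuous_sinq.
  by apply: cvgB; [exact: cvg_id|exact: cvg_cst].
have [Th [dTh ->]] := primitive_exists cs; last exact: le_trans ya.
have bnd t : - a <= t <= a -> `|sinq h (t - y) * e t| <= 2 * E * (h / (1 + h * `|t - y|)).
  move=> ta; rewrite normrM [2 * E]mulrC -mulrA [leLHS]mulrC.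
  by apply: ler_pM; rewrite ?eE// normr_sinq_decay.
have r : `|Th a - Th y| <= 2 * E * ln (1 + h * (a - y)).
  pose g t := 2 * E * ln (1 + h * (1 * (t - y))).
  have dg t : t \in `[y, a] -> is_derive t 1 g (2 * E * (h * 1 / (1 + h * (1 * (t - y))))).
    rewrite in_itv/= => /andP[yt _].
    by apply: is_deriveZ (is_derive_lnD _); rewrite mul1r ltr_wpDr// mulr_ge0// subr_ge0.
  have := @ler_derive_diff R Th g _ _ y a ya (fun s _ => dTh s) dg.
  rewrite /g !mul1r subrr mulr0 addr0 ln1 mulr0 subr0; apply => t.
  rewrite in_itv/= => /andP[yt ta]; rewrite mul1r mulr1.
  rewrite -{2}(@ger0_norm _ (t - y)) ?subr_ge0 ?(ltW yt)//.
  by apply: bnd; rewrite (ltW ta) andbT (le_trans ay)// ltW.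
have l : `|Th y - Th (- a)| <= 2 * E * ln (1 + h * (y + a)).
  pose g t := - (2 * E) * ln (1 + h * (-1 * (t - y))).
  have dg t : t \in `[- a, y] -> is_derive t 1 g (- (2 * E) * (h * -1 / (1 + h * (-1 * (t - y))))).
    rewrite in_itv/= => /andP[_ yt].
    by apply: is_deriveZ (is_derive_lnD _); rewrite mulN1r opprB ltr_wpDr// mulr_ge0// subr_ge0.
  have := @ler_derive_diff R Th g _ _ (- a) y ay (fun s _ => dTh s) dg.
  rewrite /g subrr !mulr0 addr0 ln1 mulr0 sub0r mulN1r mulNr !opprK opprB opprK; apply => t.
  rewrite in_itv/= => /andP[yt ta]; rewrite mulN1r mulrN1 opprB mulNr mulNr mulrN opprK.
  rewrite -(@ger0_norm _ (y - t)) ?subr_ge0 ?(ltW ta)// distrC.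
  by apply: bnd; rewrite (ltW yt) (le_trans _ ya)// ltW.
have -> : Th a - Th (- a) = (Th a - Th y) + (Th y - Th (- a)) by ring.
apply: le_trans (ler_normD _ _) _.
have H1 : ln (1 + h * (a - y)) <= ln (1 + h * (2 * a)) by apply: ler_ln1D => //; lra.
have H2 : ln (1 + h * (y + a)) <= ln (1 + h * (2 * a)) by apply: ler_ln1D => //; lra.
nra.
Qed.

(** The bound merges two regimes: for h z <= 1 the crude estimate 1 + pi / 2 <= 3, and for h z > 1
    the estimate 2 / (h z) of [sine_integral]. In the form 6 / (1 + h z) it has the primitive (6 /
    h) ln (1 + h z). *)
Lemma sine_primitive h : 0 < h -> exists P : R -> R,
  [/\ forall z, is_derive z 1 P (sinq h z), forall z, P (- z) = - P z &
   forall z, 0 <= z -> `|P z - pi / 2| <= 6 / (1 + h * z)].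
Proof.
move=> h0; have [P0 [dP0 iP0]] := primitive_exists (@continuous_sinq R h).
pose P z := P0 z - P0 0.
have dP z : is_derive z 1 P (sinq h z).
  apply: (is_derive_ext (is_deriveB (dP0 z) (is_derive_cst (P0 0) z (1 : R)))) => //.
  by rewrite subr0.
have P00 : P 0 = 0 by rewrite /P subrr.
exists P; split => //.
  move=> z; have dS u : is_derive u 1 (fun u => P (- u) + P u) 0.
    have dN : is_derive u 1 (fun u => P (- u)) (- sinq h u).
      have := @is_derive1_comp R P -%R u _ _ (dP (- u)) (is_deriveNid u (1 : R)).
      by rewrite mulrN1 sinqN.
    apply: (is_derive_ext (is_deriveD dN (dP u))) => //.
    by rewrite addNr.
  have := is_derive_0_is_cst z 0 dS.
  by rewrite oppr0 P00 addr0 => /eqP; rewrite addr_eq0 => /eqP.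
move=> z z0; have hz0 : 0 <= h * z by rewrite mulr_ge0// ltW.
have p : 0 < 1 + h * z by rewrite ltr_wpDr.
have [hz1|hz1] := leP (h * z) 1.
  have Pz : `|P z| <= h * z.
    have dg t : is_derive t 1 (fun x => h * x) h.
      by have := is_deriveZ h (is_derive_id t (1 : R)); rewrite /GRing.scale /= mulr1.
    have := @ler_derive_diff R P (fun t => h * t) _ _ 0 z z0 (fun s _ => dP s) (fun s _ => dg s).
    rewrite P00 mulr0 !subr0; apply => t _.
    exact/normr_sinq_le/ltW.
  apply: (@le_trans _ _ 3).
    have := pihalf_lt2 R; have := pi_ge0 R => q1 q2.
    rewrite (le_trans (ler_normB _ _))// (@ger0_norm _ (pi / 2)) ?divr_ge0//.
    lra.
  rewrite ler_pdivlMr//; lra.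
have z1 : 0 < z by rewrite lt_neqAle z0 andbT; apply: contraTneq hz1 => <-; rewrite mulr0 ltr10.
have := sine_integral h0 z1; rewrite iP0// => /le_trans; apply.
have hz : 0 < h * z by rewrite mulr_gt0.
by rewrite ler_pdivrMr// mulrAC ler_pdivlMr//; lra.
Qed.

(** Integration by parts against [P (x - y)], recentred on each side of y at its limit there. Each
    side contributes 6 M ln (1 + 2 h a) / h from the integral and 6 M / h from the boundary, whence
    the factor 12. *)
Lemma dirichlet_inversion h a y M (phi dphi : R -> R) : 0 < h ->
  - a + 1 <= y -> y <= a - 1 ->
  (forall x, is_derive x 1 phi (dphi x)) ->
  (forall x, - a <= x <= a -> `|phi x| <= M) ->
  (forall x, - a <= x <= a -> `|dphi x| <= M) ->
  `|\int[mu]_(x in `[- a, a]) (phi x * sinq h (x - y)) - pi * phi y| <=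
  12 * M * (1 + ln (1 + h * (2 * a))) / h.
Proof.
move=> h0 ay ya dp pM dpM.
have [P [dP PN PE]] := sine_primitive h0.
have M0 : 0 <= M by apply: le_trans (pM y _) => //; apply/andP; split; lra.
have cp : continuous phi by move=> x; exact: is_derive1_continuous (dp x).
have cs : continuous (fun x => phi x * sinq h (x - y)).
  move=> t; apply: cvgM; first exact: cp.
  apply: (@continuous_comp _ _ _ (fun t => t - y)); last exact: continuous_sinq.
  by apply: cvgB; [exact: cvg_id|exact: cvg_cst].
have [Th [dTh ->]] := primitive_exists cs; last by lra.
have dPy x : is_derive x 1 (fun x => P (x - y)) (sinq h (x - y)).
  have d1 : is_derive x 1 (fun x => x - y) 1.
    by apply: (is_derive_ext (is_deriveB (is_derive_id x (1 : R)) (is_derive_cst y x (1 : R)))) => //; rewrite subr0.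
  by have := @is_derive1_comp R P (fun x => x - y) x _ _ (dP _) d1; rewrite mulr1.
(* Integration by parts in differential form: Q' = phi' (c - P (x - y)) no longer contains the
   kernel. With c = pi / 2 to the right of y and c = - pi / 2 to the left, c - P is small away from
   y, and the jump of c at y produces pi phi(y). *)
pose Q c x := Th x - phi x * P (x - y) + c * phi x.
have dQ c x : is_derive x 1 (Q c) (dphi x * (c - P (x - y))).
  apply: (is_derive_ext (is_deriveD (is_deriveB (dTh x) (is_deriveM (dp x) (dPy x)))
    (is_deriveZ c (dp x)))) => //.
  by rewrite /GRing.scale /=; ring.
have ay0 : - a <= y by lra.
have ya0 : y <= a by lra.
have r : `|Q (pi / 2) a - Q (pi / 2) y| <= 6 * M / h * ln (1 + h * (a - y)).
  pose g t := 6 * M / h * ln (1 + h * (1 * (t - y))).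
  have dg t : t \in `[y, a] -> is_derive t 1 g (6 * M / h * (h * 1 / (1 + h * (1 * (t - y))))).
    rewrite in_itv/= => /andP[yt _].
    by apply: is_deriveZ (is_derive_lnD _); rewrite mul1r ltr_wpDr// mulr_ge0 ?subr_ge0// ltW.
  have := @ler_derive_diff R _ g _ _ y a ya0 (fun s _ => dQ (pi / 2) s) dg.
  rewrite /g !mul1r subrr mulr0 addr0 ln1 mulr0 subr0; apply => t.
  rewrite in_itv/= => /andP[/ltW yt /ltW ta]; rewrite mul1r mulr1 normrM distrC.
  have ht : 0 < 1 + h * (t - y) by rewrite ltr_wpDr// mulr_ge0 ?subr_ge0// ltW.
  rewrite [leRHS](_ : _ = M * (6 / (1 + h * (t - y)))); last first.
    by field; rewrite !gt_eqF.
  by apply: ler_pM => //; [apply: dpM; rewrite ta (le_trans ay0)|rewrite PE// subr_ge0].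
have l : `|Q (- (pi / 2)) y - Q (- (pi / 2)) (- a)| <= 6 * M / h * ln (1 + h * (y + a)).
  pose g t := - (6 * M / h) * ln (1 + h * (-1 * (t - y))).
  have dg t : t \in `[- a, y] -> is_derive t 1 g (- (6 * M / h) * (h * -1 / (1 + h * (-1 * (t - y))))).
    rewrite in_itv/= => /andP[_ yt].
    by apply: is_deriveZ (is_derive_lnD _); rewrite mulN1r opprB ltr_wpDr// mulr_ge0 ?subr_ge0// ltW.
  have := @ler_derive_diff R _ g _ _ (- a) y ay0 (fun s _ => dQ (- (pi / 2)) s) dg.
  rewrite /g subrr !mulr0 addr0 ln1 mulr0 sub0r mulN1r mulNr !opprK opprB opprK; apply => t.
  rewrite in_itv/= => /andP[/ltW yt /ltW ta]; rewrite mulN1r mulrN1 opprB normrM.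
  have ht : 0 < 1 + h * (y - t) by rewrite ltr_wpDr// mulr_ge0 ?subr_ge0// ltW.
  rewrite [leRHS](_ : _ = M * (6 / (1 + h * (y - t)))); last first.
    by field; rewrite !gt_eqF.
  apply: ler_pM => //; first by apply: dpM; rewrite yt (le_trans ta).
  by rewrite -[t - y]opprB PN opprK addrC PE// subr_ge0.
(* The endpoints are at distance z + 1 >= 1 from y, which turns the boundary terms into O(1 / h). *)
have Lam0 z : 0 <= z -> 6 / (1 + h * (z + 1)) <= 6 / h.
  move=> z0; rewrite ler_pM2l// lef_pV2 ?posrE//; last first.
    by rewrite ltr_wpDr// mulr_ge0 ?addr_ge0 ?(ltW h0).
  have : 0 <= h * z by rewrite mulr_ge0// ltW.
  rewrite mulrDr mulr1; lra.
have b1 : `|phi a * (P (a - y) - pi / 2)| <= M * (6 / h).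
  rewrite normrM; apply: ler_pM => //; first by apply: pM; apply/andP; split; lra.
  apply: le_trans (PE _ _) _; first by lra.
  by have := Lam0 (a - y - 1); rewrite subrK; apply; lra.
have b2 : `|phi (- a) * (P (- a - y) + pi / 2)| <= M * (6 / h).
  rewrite normrM; apply: ler_pM => //; first by apply: pM; apply/andP; split; lra.
  have -> : - a - y = - (a + y) by ring.
  rewrite PN [_ + pi / 2]addrC distrC; apply: le_trans (PE _ _) _; first by lra.
  by have := Lam0 (a + y - 1); rewrite subrK; apply; lra.
have H1 : ln (1 + h * (a - y)) <= ln (1 + h * (2 * a)) by apply: ler_ln1D; lra.
have H2 : ln (1 + h * (y + a)) <= ln (1 + h * (2 * a)) by apply: ler_ln1D; lra.
have -> : Th a - Th (- a) - pi * phi y = (Q (pi / 2) a - Q (pi / 2) y) +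
   (Q (- (pi / 2)) y - Q (- (pi / 2)) (- a)) +
   phi a * (P (a - y) - pi / 2) - phi (- a) * (P (- a - y) + pi / 2).
  by rewrite /Q; field.
apply: le_trans (ler_normB _ _) _.
have c0 : 0 <= 6 * M / h by rewrite divr_ge0 ?mulr_ge0// ltW.
have r' := le_trans r (ler_wpM2l c0 H1).
have l' := le_trans l (ler_wpM2l c0 H2).
set A := Q _ a - _ in r' *; set B := Q _ y - _ in l' *.
set C := phi a * _ in b1 *; set D := phi (- a) * _ in b2 *.
have := ler_normD (A + B) C; have := ler_normD A B.
have -> : 12 * M * (1 + ln (1 + h * (2 * a))) / h =
  6 * M / h * ln (1 + h * (2 * a)) + 6 * M / h * ln (1 + h * (2 * a)) + M * (6 / h) + M * (6 / h).
  by field; rewrite gt_eqF.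
lra.
Qed.

End Inversion1.

(** * Iterated integrals over cubes *)

Section Cube.
Context {R : realType}.
Notation mu := (@lebesgue_measure R).
Implicit Types (a b c t d : R) (n : nat).

Lemma continuous_fctD (T : topologicalType) (f g : T -> R) :
  continuous f -> continuous g -> continuous (fun x => f x + g x).
Proof. by move=> cf cg x; exact: cvgD (cf x) (cg x). Qed.

Lemma continuous_fctB (T : topologicalType) (f g : T -> R) :
  continuous f -> continuous g -> continuous (fun x => f x - g x).
Proof. by move=> cf cg x; exact: cvgB (cf x) (cg x). Qed.

Lemma continuous_fctM (T : topologicalType) (f g : T -> R) :
  continuous f -> continuous g -> continuous (fun x => f x * g x).
Proof. by move=> cf cg x; exact: cvgM (cf x) (cg x). Qed.

Lemma continuous_fctZ (T : topologicalType) c (f : T -> R) :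
  continuous f -> continuous (fun x => c * f x).
Proof. by move=> cf; apply: continuous_fctM => // x; exact: cvg_cst. Qed.

Definition cube n a : set 'rV[R]_n := [set x | forall i, - a <= x ord0 i <= a].

(** Spelled as in [cube_int], so that one step of the iterated integral unfolds by conversion. *)
Definition cons_mx n t (x : 'rV[R]_n) : 'rV[R]_n.+1 := row_mx (t%:M : 'rV_1) x.

Lemma cons_mx0 n t (x : 'rV[R]_n) : cons_mx t x ord0 ord0 = t.
Proof.
transitivity (row_mx (t%:M : 'rV_1) x ord0 (lshift n ord0)).
  by congr (fun_of_matrix _ _ _); exact: val_inj.
by rewrite row_mxEl mxE mulr1n.
Qed.

Lemma cons_mxS n t (x : 'rV[R]_n) i : cons_mx t x ord0 (lift ord0 i) = x ord0 i.
Proof.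
transitivity (row_mx (t%:M : 'rV_1) x ord0 (rshift 1 i)).
  by congr (fun_of_matrix _ _ _); exact: val_inj.
by rewrite row_mxEr.
Qed.

Lemma cons_mx_ind n (P : 'rV[R]_n.+1 -> Prop) :
  (forall t x, P (cons_mx t x)) -> forall x, P x.
Proof.
move=> Pc x; have := Pc (x ord0 ord0) (\row_i x ord0 (lift ord0 i)).
congr P; apply/rowP => i; case: (unliftP ord0 i) => [j|] ->.
  by rewrite cons_mxS mxE.
by rewrite cons_mx0.
Qed.

Lemma cube_cons n a t (x : 'rV[R]_n) : cube a (cons_mx t x) <-> - a <= t <= a /\ cube a x.
Proof.
split=> [c|[ta xa] i].
  by split; [have := c ord0; rewrite cons_mx0|move=> i; have := c (lift ord0 i); rewrite cons_mxS].
by case: (unliftP ord0 i) => [j|] ->; rewrite ?cons_mxS ?cons_mx0.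
Qed.

Lemma cube_compact n a : compact (@cube n a).
Proof.
have := @rV_compact R n (fun=> `[- a, a]%classic) (fun=> @segment_compact R _ _).
by congr compact; apply/seteqP; split => x /= H i; have := H i; rewrite in_itv.
Qed.

Lemma ball_rVP n (x y : 'rV[R]_n) d : 0 < d ->
  ball x d y <-> forall i, `|x ord0 i - y ord0 i| < d.
Proof.
move=> d0; split=> [[_ H] i|H]; first exact: H.
by split=> // i j; rewrite ord1; exact: H.
Qed.

Lemma continuous_cons n (g : 'rV[R]_n.+1 -> R) t :
  continuous g -> continuous (fun x => g (cons_mx t x)).
Proof.
move=> cg x; apply: (@continuous_comp _ _ _ (cons_mx t) g); last exact: cg.
move=> A /nbhs_ballP[e /= e0 eA]; apply/nbhs_ballP; exists e => //= y xy.
apply: eA; apply/ball_rVP => // i.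
case: (unliftP ord0 i) => [j|] ->; last by rewrite !cons_mx0 subrr normr0.
by rewrite !cons_mxS; move: j; apply/ball_rVP.
Qed.

Lemma continuous_cons_hd n (g : 'rV[R]_n.+1 -> R) (x : 'rV[R]_n) :
  continuous g -> continuous (fun t => g (cons_mx t x)).
Proof.
move=> cg t; apply: (@continuous_comp _ _ _ (fun t => cons_mx t x) g); last exact: cg.
move=> A /nbhs_ballP[e /= e0 eA]; apply/nbhs_ballP; exists e => //= y xy.
apply: eA; apply/ball_rVP => // i.
by case: (unliftP ord0 i) => [j|] ->; rewrite ?cons_mx0 ?cons_mxS ?subrr ?normr0.
Qed.

(** Only [x] has to lie in the cube: in [cube_tube] the second point may leave it. *)
Lemma cube_unif n a (g : 'rV[R]_n -> R) (e : R) : continuous g -> 0 < e ->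
  exists2 d, 0 < d & forall x y : 'rV[R]_n, cube a x -> (forall i, `|x ord0 i - y ord0 i| <= d) ->
    `|g x - g y| < e.
Proof.
move=> cg e0.
have : \forall d \near 0^'+, cube a `<=` [set x | forall y, ball x d y -> `|g x - g y| < e].
  have /compact_near_coveringP := @cube_compact n a.
  apply => x ax.
  have e2 : 0 < e / 2 by rewrite divr_gt0.
  have /cvgrPdist_lt/(_ _ e2)/nbhs_ballP[r /= r0 xr] := cg x.
  exists (ball x (r / 2), [set d | 0 < d < r / 2]) => /=.
    split; first by apply: nbhsx_ballx; rewrite divr_gt0.
    near=> d; apply/andP; split; first by near: d; exact: nbhs_right_gt.
    by near: d; apply: nbhs_right_lt; rewrite divr_gt0.
  move=> [x' d] /= [xx' /andP[d0 dr]] y x'y.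
  have -> : g x' - g y = (g x - g y) - (g x - g x') by ring.
  rewrite (splitr e) (le_lt_trans (ler_normB _ _))// ltrD//; apply: xr.
    rewrite (splitr r); apply: ball_triangle xx' _.
    exact: (le_ball (ltW dr)).
  by apply: le_ball xx'; rewrite ler_pdivrMr// ler_pMr// ler1n.
move=> /(@filterI _ _ _ _ _ (nbhs_right_gt 0))/filter_ex[d [/= d0 H]].
(* Halving passes from the closed condition [<= d] to an open ball. *)
exists (d / 2); first by rewrite divr_gt0.
move=> x y ax xy; apply: H => //; apply/ball_rVP => // i.
by rewrite (le_lt_trans (xy i))// ltr_pdivrMr// ltr_pMr// ltr1n.
Unshelve. all: by end_near. Qed.

Lemma cube_tube n a (g : 'rV[R]_n.+1 -> R) t (e : R) : continuous g -> 0 < e ->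
  \forall s \near t, forall x, cube a x -> `|g (cons_mx t x) - g (cons_mx s x)| < e.
Proof.
move=> cg e0; pose b := Num.max a `|t|.
have [d d0 H] := @cube_unif _ b _ _ cg e0.
near=> s => x ax; apply: H.
  apply/cube_cons; split; first by rewrite -ler_norml le_max lexx orbT.
  move=> i; have /andP[u v] := ax i; have ab : a <= b by rewrite le_max lexx.
  by rewrite (le_trans v ab) (le_trans _ u)// lerN2.
move=> i; case: (unliftP ord0 i) => [j|] ->; rewrite ?cons_mxS ?subrr ?normr0 ?(ltW d0)// !cons_mx0.
by apply: ltW; near: s; exact: (nbhsx_ballx t).
Unshelve. all: by end_near. Qed.

(** Linearity and the bound form a single induction: together they give continuity of the inner
    integral in the first variable, and this makes the outer integral of the next dimension linear
    and bounded. *)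
Let linear_bounded n a : Prop :=
  (forall c (g1 g2 : 'rV[R]_n -> R), continuous g1 -> continuous g2 ->
     cube_int a (fun x => c * g1 x + g2 x) = c * cube_int a g1 + cube_int a g2) /\
  (forall (g : 'rV[R]_n -> R) M, continuous g -> 0 <= M -> (forall x, cube a x -> `|g x| <= M) ->
     `|cube_int a g| <= (2 * a) ^+ n * M).

Let linear_bounded_continuous n a : 0 <= a -> linear_bounded n a ->
  forall g : 'rV[R]_n.+1 -> R, continuous g ->
  continuous (fun t => cube_int a (fun x => g (cons_mx t x))).
Proof.
move=> a0 [lin bnd] g cg t; apply/cvgrPdist_le => e e0.
(* The summand 1 makes the final comparison work for every a >= 0, including a = 0. *)
pose e' := e / (1 + (2 * a) ^+ n).
have p : 0 < 1 + (2 * a) ^+ n by rewrite ltr_wpDr// exprn_ge0// mulr_ge0.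
have e'0 : 0 < e' by rewrite divr_gt0.
near=> s.
have -> : cube_int a (fun x => g (cons_mx t x)) - cube_int a (fun x => g (cons_mx s x)) =
    cube_int a (fun x => -1 * g (cons_mx s x) + g (cons_mx t x)).
  by rewrite lin ?mulN1r 1?addrC//; exact: continuous_cons.
apply: (@le_trans _ _ ((2 * a) ^+ n * e')).
  apply: bnd; rewrite ?ltW//.
    apply: continuous_fctD; last exact: continuous_cons.
    by apply: continuous_fctZ; exact: continuous_cons.
  move=> x ax; rewrite mulN1r addrC ltW//; move: x ax; near: s.
  exact: cube_tube.
rewrite /e' mulrCA ger_pMr// ler_pdivrMr// mul1r.
by rewrite lerDr.
Unshelve. all: by end_near. Qed.

Let cube_int_lb n a : 0 <= a -> linear_bounded n a.
Proof.
move=> a0; elim: n => [|n IH].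
  split=> [//|g M cg M0 gM]; rewrite expr0 mul1r.
  by apply: gM => -[].
have [lin bnd] := IH.
have ci := linear_bounded_continuous a0 IH.
split.
  move=> c g1 g2 c1 c2 /=.
  transitivity (\int[mu]_(t in `[- a, a])
      (c * cube_int a (fun x => g1 (cons_mx t x)) + cube_int a (fun x => g2 (cons_mx t x)))).
    by apply: eq_Rintegral => t _; apply: lin; exact: continuous_cons.
  rewrite RintegralD ?RintegralZl//; try exact: (continuous_integrable _ _ (ci _ _)).
  by apply: continuous_integrable; apply: continuous_fctZ; exact: ci.
move=> g M cg M0 gM /=.
have H t : - a <= t <= a -> `|cube_int a (fun x => g (cons_mx t x))| <= (2 * a) ^+ n * M.
  move=> ta; apply: bnd => //; first exact: continuous_cons.
  by move=> x ax; apply: gM; apply/cube_cons.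
apply: (le_trans (ler_norm_Rintegral_itv (ci _ cg) (@cst_continuous _ _ ((2 * a) ^+ n * M)) H)).
have dF (x : R) : is_derive x 1 (fun t => (2 * a) ^+ n * M * t) ((2 * a) ^+ n * M).
  by have := is_deriveZ ((2 * a) ^+ n * M) (is_derive_id x (1 : R)); rewrite /GRing.scale /= mulr1.
rewrite (Rintegral_FTC (@cst_continuous _ _ _) dF) ?ge0_cp//.
by rewrite exprS le_eqVlt; apply/orP; left; apply/eqP; ring.
Qed.

Lemma cube_int_lin n a c (g1 g2 : 'rV[R]_n -> R) : 0 <= a ->
  continuous g1 -> continuous g2 ->
  cube_int a (fun x => c * g1 x + g2 x) = c * cube_int a g1 + cube_int a g2.
Proof. by move=> a0; exact: (cube_int_lb n a0).1. Qed.

Lemma normr_cube_int n a (g : 'rV[R]_n -> R) M : 0 <= a -> 0 <= M ->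
  continuous g -> (forall x, cube a x -> `|g x| <= M) ->
  `|cube_int a g| <= (2 * a) ^+ n * M.
Proof. by move=> a0 M0 cg; exact: (cube_int_lb n a0).2. Qed.

Lemma continuous_cube_int n a (g : 'rV[R]_n.+1 -> R) : 0 <= a -> continuous g ->
  continuous (fun t => cube_int a (fun x => g (cons_mx t x))).
Proof. by move=> a0; exact: linear_bounded_continuous (cube_int_lb n a0) g. Qed.

Lemma cube_int_cst0 n a : @cube_int R n a (fun=> 0) = 0.
Proof.
elim: n => [//|n IH] /=; under eq_Rintegral do rewrite IH.
by rewrite Rintegral_cst// mul0r.
Qed.

Lemma cube_intZ n a c (g : 'rV[R]_n -> R) : 0 <= a -> continuous g ->
  cube_int a (fun x => c * g x) = c * cube_int a g.
Proof.
move=> a0 cg; have := @cube_int_lin n a c g (fun=> 0) a0 cg (@cst_continuous _ _ _).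
rewrite cube_int_cst0 addr0 => <-; congr cube_int; apply/funext => x.
by rewrite addr0.
Qed.

Lemma cube_intB n a (g1 g2 : 'rV[R]_n -> R) : 0 <= a -> continuous g1 -> continuous g2 ->
  cube_int a (fun x => g1 x - g2 x) = cube_int a g1 - cube_int a g2.
Proof.
move=> a0 c1 c2; have := cube_int_lin (-1) a0 c2 c1.
rewrite mulN1r addrC => <-; congr cube_int; apply/funext => x.
by rewrite mulN1r addrC.
Qed.

End Cube.

(** * Quadrature rules on intervals and cubes *)

Section Quadrature.
Context {R : realType}.
Notation mu := (@lebesgue_measure R).
Implicit Types (a b c t d h M : R) (n : nat).

Definition qsum (T : Type) (r : seq (R * T)) (g : T -> R) : R := \sum_(p <- r) p.1 * g p.2.

(** The nodes are chosen before [psi], from the interval and the mesh alone: one rule must later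
    serve a whole family of frequencies. They are the left endpoints of pieces of length at most
    [d], the last piece being peeled off at each induction step. *)
Lemma Rintegral_quadrature a b d : a <= b -> 0 < d -> exists r : seq (R * R),
  [/\ forall p, p \in r -> 0 <= p.1 /\ a <= p.2 <= b, \sum_(p <- r) p.1 = b - a &
   forall (psi : R -> R) (e : R), continuous psi ->
     (forall s t, a <= s <= b -> a <= t <= b -> `|s - t| <= d -> `|psi s - psi t| <= e) ->
     `|\int[mu]_(t in `[a, b]) psi t - qsum r psi| <= (b - a) * e].
Proof.
move=> ab d0.
have [N bN] : exists N : nat, b - a <= N%:R * d.
  exists (Num.truncn ((b - a) / d)).+1; rewrite -ler_pdivrMr//.
  by apply/ltW; apply: truncnS_gt.
elim: N b ab bN => [|N IH] b ab bN.
  have -> : b = a by move: bN; rewrite mul0r; lra.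
  exists [::]; split=> [//||psi e _ _]; first by rewrite big_nil subrr.
  by rewrite set_itv1 Rintegral_set1 /qsum big_nil !subrr normr0 mul0r.
pose c := Num.max a (b - d).
have ac : a <= c by rewrite le_max lexx.
have cb : c <= b by rewrite ge_max ab gerBl ltW.
have bc : b - c <= d by rewrite lerBlDl -lerBlDr le_max lexx orbT.
have cN : c - a <= N%:R * d.
  rewrite lerBlDl ge_max lerDl mulr_ge0 ?(ltW d0)//=.
  by move: bN; rewrite -natr1 mulrDl mul1r; lra.
have [r [rP rS rE]] := IH c ac cN.
exists ((b - c, c) :: r); split.
- move=> p; rewrite inE => /predU1P[->/=|/rP[-> /andP[-> pc]]]; first by rewrite subr_ge0 cb ac.
  by rewrite (le_trans pc).
- by rewrite big_cons rS /=; lra.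
move=> psi e cpsi H; rewrite /qsum big_cons (Rintegral_itvD cpsi ac cb) -/(qsum r psi).
have {}rE := rE psi e cpsi.
have {rE} H1 : `|\int[mu]_(t in `[a, c]) psi t - qsum r psi| <= (c - a) * e.
  apply: rE => s t /andP[a1 b1] /andP[a2 b2]; apply: H.
    by rewrite a1 (le_trans b1).
  by rewrite a2 (le_trans b2).
have cc := @cst_continuous R R (psi c).
have H2 : `|\int[mu]_(t in `[c, b]) psi t - (b - c) * psi c| <= (b - c) * e.
  have dF (k : R) (x : R) : is_derive x 1 (fun t => k * t) k.
    by have := is_deriveZ k (is_derive_id x (1 : R)); rewrite /GRing.scale /= mulr1.
  have -> : \int[mu]_(t in `[c, b]) psi t - (b - c) * psi c =
      \int[mu]_(t in `[c, b]) (psi t - psi c).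
    rewrite RintegralB//; try exact: continuous_integrable.
    by rewrite (Rintegral_FTC cc (dF (psi c)) cb); ring.
  have cD : continuous (fun t => psi t - psi c) by move=> t; exact: cvgB (cpsi t) (cc t).
  apply: (le_trans (ler_norm_Rintegral_itv cD (@cst_continuous _ _ e) _)).
    move=> t /andP[ct tb]; apply: H; rewrite ?ac ?cb ?(le_trans ac ct) ?tb//.
    rewrite ger0_norm ?subr_ge0//; lra.
  by rewrite (Rintegral_FTC (@cst_continuous _ _ _) (dF e) cb) -mulrBr mulrC.
rewrite [X in `|X|](_ : _ = (\int[mu]_(t in `[a, c]) psi t - qsum r psi) +
  (\int[mu]_(t in `[c, b]) psi t - (b - c) * psi c)); last by rewrite /=; ring.
by rewrite (le_trans (ler_normD _ _))//; lra.
Qed.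

(** The product rule. The outer rule errs by 2 a times the oscillation (2 a)^n e of the inner
    integral, and the inner errors are averaged with weights of sum 2 a; this adds one unit to the
    factor n. *)
Lemma cube_quadrature n a d : 0 <= a -> 0 < d -> exists r : seq (R * 'rV[R]_n),
  [/\ forall p, p \in r -> 0 <= p.1 /\ cube a p.2, \sum_(p <- r) p.1 = (2 * a) ^+ n &
   forall (g : 'rV[R]_n -> R) (e : R), 0 <= e -> continuous g ->
     (forall x y : 'rV[R]_n, cube a x -> cube a y ->
        (forall i, `|x ord0 i - y ord0 i| <= d) -> `|g x - g y| <= e) ->
     `|cube_int a g - qsum r g| <= n%:R * (2 * a) ^+ n * e].
Proof.
move=> a0 d0; have aa : - a <= a by rewrite ge0_cp.
elim: n => [|n [rn [rnP rnS rnE]]].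
  exists [:: (1, 0)]; split.
  - by move=> p; rewrite inE => /eqP->; split=> // -[].
  - by rewrite big_seq1 expr0.
  - move=> g e _ _ _; rewrite /qsum big_seq1 /= mul1r.
    by rewrite subrr normr0 mul0r mul0r.
have [r1 [r1P r1S r1E]] := Rintegral_quadrature aa d0.
exists [seq (p.1 * q.1, cons_mx p.2 q.2) | p <- r1, q <- rn]; split.
- move=> _ /allpairsP[[p q] [/= /r1P[p0 pa] /rnP[q0 qa] ->]] /=.
  by split; [exact: mulr_ge0|exact/cube_cons].
- rewrite big_allpairs_dep /= exprS -rnS (_ : 2 * a = a - - a); last by ring.
  by rewrite -r1S mulr_suml; apply: eq_bigr => p _; rewrite mulr_sumr.
move=> g e e0 cg H.
have q0 : 0 <= (2 * a) ^+ n by rewrite exprn_ge0// mulr_ge0.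
pose I t := cube_int a (fun x => g (cons_mx t x)).
have cI : continuous I := continuous_cube_int a0 cg.
have oI s t : - a <= s <= a -> - a <= t <= a -> `|s - t| <= d -> `|I s - I t| <= (2 * a) ^+ n * e.
  move=> sa ta st; rewrite /I -cube_intB//; try exact: continuous_cons.
  apply: normr_cube_int => //.
    by apply: continuous_fctB; exact: continuous_cons.
  move=> x ax; apply: H; try exact/cube_cons.
  by move=> i; case: (unliftP ord0 i) => [j|] ->; rewrite ?cons_mx0 ?cons_mxS ?subrr ?normr0 ?(ltW d0).
have E1 := r1E _ _ cI oI.
have E2 : `|qsum r1 I - \sum_(p <- r1) p.1 * qsum rn (fun x => g (cons_mx p.2 x))| <=
    (2 * a) * (n%:R * (2 * a) ^+ n * e).
  rewrite [leRHS](_ : _ = (\sum_(p <- r1) p.1) * (n%:R * (2 * a) ^+ n * e)); last by rewrite r1S; ring.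
  rewrite /qsum -sumrB mulr_suml big_seq [leRHS]big_seq.
  rewrite (le_trans (ler_norm_sum _ _ _))//; apply: ler_sum => p /r1P[p0 pa].
  rewrite -mulrBr normrM ger0_norm// ler_wpM2l//; apply: rnE => //.
    exact: continuous_cons.
  move=> x y xa ya xy; apply: H; try exact/cube_cons.
  by move=> i; case: (unliftP ord0 i) => [j|] ->; rewrite ?cons_mx0 ?cons_mxS ?subrr ?normr0 ?(ltW d0).
rewrite /qsum big_allpairs_dep /=.
rewrite [X in `|_ - X|](_ : _ = \sum_(p <- r1) p.1 * qsum rn (fun x => g (cons_mx p.2 x))); last first.
  by apply: eq_bigr => p _; rewrite /qsum mulr_sumr; apply: eq_bigr => q _; rewrite mulrA.
rewrite [X in `|X - _|](_ : _ = \int[mu]_(t in `[- a, a]) I t)//.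
set A := Rintegral _ _ _ in E1 *; set B := qsum r1 I in E1 E2 *; set C := \sum_(p <- r1) _ in E2 *.
have -> : A - C = (A - B) + (B - C) by ring.
rewrite (le_trans (ler_normD _ _))//.
rewrite -natr1 exprS.
have -> : (n%:R + 1) * (2 * a * (2 * a) ^+ n) * e =
  (a - - a) * ((2 * a) ^+ n * e) + 2 * a * (n%:R * (2 * a) ^+ n * e) by ring.
exact: lerD.
Qed.

Definition dotp n (z x : 'rV[R]_n) : R := \sum_i z ord0 i * x ord0 i.

Lemma dotp_cons n t (z : 'rV[R]_n.+1) (x : 'rV[R]_n) :
  dotp z (cons_mx t x) = z ord0 ord0 * t + dotp (\row_i z ord0 (lift ord0 i)) x.
Proof.
rewrite /dotp big_ord_recl cons_mx0; congr (_ + _).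
by apply: eq_bigr => i _; rewrite cons_mxS mxE.
Qed.

(** The first coordinate is moved into the phase, where the induction hypothesis leaves a
    one-variable cosine integral. *)
Lemma cube_int_cos n h (z : 'rV[R]_n) th : 0 <= h ->
  cube_int h (fun x => cos (th + dotp z x)) = cos th * \prod_i (2 * sinq h (z ord0 i)).
Proof.
move=> h0; elim: n => [|n IH] in z th *.
  by rewrite /= /dotp !big_ord0 addr0 mulr1.
pose z' := \row_i z ord0 (lift ord0 i) : 'rV_n.
rewrite big_ord_recl.
rewrite -[LHS]/(\int[mu]_(t in `[- h, h]) cube_int h (fun x => cos (th + dotp z (cons_mx t x)))).
transitivity (\int[mu]_(t in `[- h, h]) ((\prod_i (2 * sinq h (z' ord0 i))) * cos (th + z ord0 ord0 * t))).
  apply: eq_Rintegral => t _; rewrite mulrC -IH; congr cube_int; apply/funext => x.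
  by rewrite dotp_cons addrA.
rewrite RintegralZl//; last first.
  apply: continuous_integrable => t; apply: continuous_comp; last exact: continuous_cos.
  by apply: cvgD; [exact: cvg_cst|apply: cvgM; [exact: cvg_cst|exact: cvg_id]].
rewrite Rintegral_cos// mulrC !mulrA [2 * cos th]mulrC; congr (_ * _).
by apply: eq_bigr => i _; rewrite mxE.
Qed.

End Quadrature.

(** * Dirichlet inversion on cubes *)

Section InversionN.
Context {R : realType}.
Notation mu := (@lebesgue_measure R).
Implicit Types (a b c t d h M : R) (n : nat).

(** A directional derivative sees only the restriction to a line. This transfers it between spaces
    of different dimension: from R, or from a slice of the cube, to the full space. *)
Lemma derive_line (V W : normedModType R) (G : V -> R) (F : W -> R) x v y w :
  (forall s : R, G (s *: v + x) = F (s *: w + y)) -> derivable F y w ->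
  derivable G x v /\ 'D_v G x = 'D_w F y.
Proof.
move=> GF; have Gx : G x = F y by have := GF 0; rewrite !scale0r !add0r.
rewrite /derivable /derive.
rewrite (_ : (fun h : R => h^-1 *: ((F \o shift y) (h *: w) - F y)) =
   (fun h : R => h^-1 *: ((G \o shift x) (h *: v) - G x)))//.
by apply/funext => s /=; rewrite GF Gx.
Qed.

Lemma cons_mx_line0 n t (x : 'rV[R]_n) s :
  cons_mx (s *: 1 + t) x = s *: delta_mx ord0 ord0 + cons_mx t x.
Proof.
apply/rowP => i; rewrite [RHS]mxE [X in _ = X + _]mxE [X in _ * X]mxE; case: (unliftP ord0 i) => [j|] ->.
  by rewrite !cons_mxS /= mulr0 add0r.
by rewrite !cons_mx0.
Qed.

Lemma cons_mx_lineS n t (x : 'rV[R]_n) s i :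
  cons_mx t (s *: delta_mx ord0 i + x) =
  s *: delta_mx ord0 (lift ord0 i) + cons_mx t x.
Proof.
apply/rowP => k; rewrite [RHS]mxE [X in _ = X + _]mxE [X in _ * X]mxE; case: (unliftP ord0 k) => [j|] ->.
  by rewrite !cons_mxS !mxE /= (inj_eq lift_inj).
by rewrite !cons_mx0 /= mulr0 add0r.
Qed.

Lemma continuous_prod_sinq n h (y : 'rV[R]_n) :
  continuous (fun x : 'rV[R]_n => \prod_i sinq h (x ord0 i - y ord0 i)).
Proof.
have ci (i : 'I_n) : continuous (fun x : 'rV[R]_n => sinq h (x ord0 i - y ord0 i)).
  move=> x; apply: (@continuous_comp _ _ _ (fun x : 'rV[R]_n => x ord0 i - y ord0 i)).
    by move: x; apply: continuous_fctB; [exact: coord_continuous|exact: cst_continuous].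
  exact: continuous_sinq.
elim: (index_enum _) => [|i s IH].
  rewrite (_ : (fun _ => _) = fun=> 1); first exact: cst_continuous.
  by apply/funext => x; rewrite big_nil.
rewrite (_ : (fun _ => _) = fun x : 'rV[R]_n => sinq h (x ord0 i - y ord0 i) *
   \prod_(j <- s) sinq h (x ord0 j - y ord0 j)); first exact: continuous_fctM.
by apply/funext => x; rewrite big_cons.
Qed.

(** Induction on n with error recursion err(n+1) <= 4 L err(n) + pi^n E. The inner integral is
    replaced by pi^n times the slice of F through y before the first variable is treated, so only F
    itself is ever differentiated. *)
Lemma cube_inversion n h a M (F : 'rV[R]_n -> R) (y : 'rV[R]_n) :
  0 < h -> 0 <= a -> 0 <= M -> continuous F ->
  (forall i x, derivable F x (delta_mx ord0 i)) ->
  (forall x, cube a x -> `|F x| <= M) ->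
  (forall i x, cube a x -> `|partial i F x| <= M) ->
  cube (a - 1) y ->
  `|cube_int a (fun x => F x * \prod_i sinq h (x ord0 i - y ord0 i)) - pi ^+ n * F y| <=
  n%:R * (4 * (1 + ln (1 + h * (2 * a)))) ^+ n * (12 * M * (1 + ln (1 + h * (2 * a))) / h).
Proof.
move=> h0 a0 M0; set L := ln _; set E := _ / h.
have L0 : 0 <= L by rewrite ln_ge0// lerDl !mulr_ge0// ltW.
have E0 : 0 <= E by rewrite divr_ge0 ?mulr_ge0 ?addr_ge0// ltW.
have pi0 : (0 : R) <= pi := pi_ge0 R.
have pi4 : pi <= 4 :> R by have := pihalf_lt2 R; lra.
elim: n => [|n IH] in F y *.
  move=> _ _ _ _ _; rewrite /= big_ord0 mulr1 expr0 mul1r !mul0r.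
  by rewrite [y](_ : _ = 0) ?subrr ?normr0//; apply/rowP => -[].
move=> cF dF FM dFM; move: y; apply: cons_mx_ind => y0 y /cube_cons[y0a ya].
have ayy : - a <= y0 <= a by move/andP: y0a => [? ?]; apply/andP; split; lra.
pose I t := cube_int a (fun x => F (cons_mx t x) * \prod_i sinq h (x ord0 i - y ord0 i)).
have cG : continuous (fun x : 'rV[R]_n.+1 => F x * \prod_(i < n) sinq h (x ord0 (lift ord0 i) - y ord0 i)).
  pose r (x : 'rV[R]_n.+1) : 'rV[R]_n := \row_i x ord0 (lift ord0 i).
  apply: continuous_fctM => // x.
  have -> : (fun x : 'rV[R]_n.+1 => \prod_(i < n) sinq h (x ord0 (lift ord0 i) - y ord0 i)) =
      (fun z : 'rV[R]_n => \prod_(i < n) sinq h (z ord0 i - y ord0 i)) \o r.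
    by apply/funext => z /=; apply: eq_bigr => i _; rewrite mxE.
  apply: continuous_comp; last exact: continuous_prod_sinq.
  move=> A /nbhs_ballP[e /= e0 eA]; apply/nbhs_ballP; exists e => //= z xz.
  by apply: eA; apply/ball_rVP => // i; rewrite !mxE; move: (lift ord0 i); apply/ball_rVP.
have IE t : I t = cube_int a (fun x => F (cons_mx t x) *
     \prod_(i < n) sinq h (cons_mx t x ord0 (lift ord0 i) - y ord0 i)).
  congr cube_int; apply/funext => x; congr (_ * _).
  by apply: eq_bigr => i _; rewrite cons_mxS.
have cI : continuous I.
  by rewrite (funext IE : I = _); exact: (continuous_cube_int a0 cG).
pose phi t := F (cons_mx t y).
have cphi : continuous phi by exact: continuous_cons_hd.
(* Cost of replacing the inner integral by its limit: the induction error, multiplied by the L^1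
   bound 4 L of the kernel. *)
have step1 : `|\int[mu]_(t in `[- a, a]) (sinq h (t - y0) * (I t - pi ^+ n * phi t))| <=
    4 * (n%:R * (4 * (1 + L)) ^+ n * E) * L.
  apply: norm_Rintegral_sinq => //; first exact: ltW.
    by apply: continuous_fctB => //; exact: continuous_fctZ.
  move=> t ta; apply: IH.
  - exact: continuous_cons.
  - move=> i x; apply: (derive_line _ (dF (lift ord0 i) (cons_mx t x))).1 => s.
    by rewrite cons_mx_lineS.
  - by move=> x ax; apply: FM; apply/cube_cons.
  - move=> i x ax; rewrite /partial.
    rewrite (derive_line _ (dF (lift ord0 i) (cons_mx t x))).2; last first.
      by move=> s; rewrite cons_mx_lineS.
    by apply: dFM; apply/cube_cons.
  - exact: ya.
have ya' : cube a y.
  by move=> i; have /andP[? ?] := ya i; apply/andP; split; lra.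
have dphi t : is_derive t 1 phi (partial ord0 F (cons_mx t y)).
  have [|d1 d2] := @derive_line _ _ phi F t 1 (cons_mx t y) (delta_mx ord0 ord0) _ (dF _ _).
    by move=> s; rewrite /phi cons_mx_line0.
  by apply: (DeriveDef d1).
(* The remaining slice is a function of one variable whose derivative is a partial derivative of
   F. *)
have step2 : `|\int[mu]_(t in `[- a, a]) (phi t * sinq h (t - y0)) - pi * phi y0| <= E.
  move/andP: y0a => [? ?].
  apply: (dirichlet_inversion h0 _ _ dphi); [lra|lra| |].
    by move=> t ta; apply: FM; apply/cube_cons.
  by move=> t ta; apply: dFM; apply/cube_cons.
have cs : continuous (fun t => sinq h (t - y0)).
  move=> t; apply: (@continuous_comp _ _ _ (fun t => t - y0)); last exact: continuous_sinq.
  by apply: cvgB; [exact: cvg_id|exact: cvg_cst].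
have -> : cube_int a (fun x => F x * \prod_i sinq h (x ord0 i - cons_mx y0 y ord0 i)) =
    \int[mu]_(t in `[- a, a]) (sinq h (t - y0) * (I t - pi ^+ n * phi t)) +
    pi ^+ n * \int[mu]_(t in `[- a, a]) (phi t * sinq h (t - y0)).
  have i1 : mu.-integrable `[- a, a] (EFin \o (fun t => sinq h (t - y0) * (I t - pi ^+ n * phi t))).
    apply: continuous_integrable; apply: continuous_fctM => //.
    by apply: continuous_fctB => //; exact: continuous_fctZ.
  have i2 : mu.-integrable `[- a, a] (EFin \o (fun t => phi t * sinq h (t - y0))).
    by apply: continuous_integrable; exact: continuous_fctM.
  have i3 : mu.-integrable `[- a, a] (EFin \o (fun t => pi ^+ n * (phi t * sinq h (t - y0)))).
    by apply: continuous_integrable; apply: continuous_fctZ; exact: continuous_fctM.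
  rewrite -RintegralZl// -RintegralD//.
  rewrite -[LHS]/(\int[mu]_(t in `[- a, a]) cube_int a (fun x => F (cons_mx t x) *
     \prod_i sinq h (cons_mx t x ord0 i - cons_mx y0 y ord0 i))).
  apply: eq_Rintegral => t _.
  rewrite [RHS](_ : _ = sinq h (t - y0) * I t); last by ring.
  rewrite /I -cube_intZ//; last first.
    by apply: continuous_fctM; [exact: continuous_cons|exact: continuous_prod_sinq].
  congr cube_int; apply/funext => x; rewrite big_ord_recl !cons_mx0 mulrCA; congr (_ * (_ * _)).
  by apply: eq_bigr => i _; rewrite !cons_mxS.
set A := Rintegral _ _ _ in step1 *; set B := Rintegral _ _ _ in step2 *.
have -> : A + pi ^+ n * B - pi ^+ n.+1 * F (cons_mx y0 y) = A + pi ^+ n * (B - pi * phi y0).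
  by rewrite /phi exprS; ring.
rewrite (le_trans (ler_normD _ _))// normrM (ger0_norm (exprn_ge0 _ pi0)).
(* [D] dominates both pi and 4 L, so each induction step costs one factor [D] and one further
   summand. *)
set D := 4 * (1 + L) in step1 *.
have pD : pi ^+ n <= D ^+ n.
  by apply: lerXn2r; rewrite ?nnegrE//; rewrite /D; lra.
have D1 : 1 <= D by rewrite /D; lra.
have H2 : pi ^+ n * `|B - pi * phi y0| <= D ^+ n.+1 * E.
  apply: (@le_trans _ _ (D ^+ n * E)); first by apply: ler_pM; rewrite ?exprn_ge0.
  by rewrite ler_wpM2r// ler_weXn2l.
have H1 : 4 * (n%:R * D ^+ n * E) * L <= n%:R * D ^+ n.+1 * E.
  have -> : 4 * (n%:R * D ^+ n * E) * L = (4 * L) * (n%:R * D ^+ n * E) by ring.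
  have -> : n%:R * D ^+ n.+1 * E = D * (n%:R * D ^+ n * E) by rewrite exprS; ring.
  have ? : 0 <= n%:R * D ^+ n * E 
    by apply: mulr_ge0 => //; apply: mulr_ge0 => //; apply: exprn_ge0; apply: le_trans D1.
  by rewrite ler_wpM2r// /D; lra.
have -> : n.+1%:R * D ^+ n.+1 * E = n%:R * D ^+ n.+1 * E + D ^+ n.+1 * E.
  by rewrite -[n.+1%:R]natr1; ring.
apply: lerD => //.
exact: le_trans step1 H1.
Qed.

End InversionN.

(** * Smooth functions and trigonometric sums *)

Section Smooth.
Context {R : realType} {n : nat}.
Implicit Types (F G g : 'rV[R]_n -> R) (i : 'I_n) (s : seq 'I_n).

Lemma partials_rcons s i g : partials (rcons s i) g = partials s (partial i g).
Proof. by rewrite /partials foldr_rcons. Qed.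

Lemma smooth_partial i g : smooth g -> smooth (partial i g).
Proof. by move=> sg s; rewrite -partials_rcons; exact: sg. Qed.

Lemma smooth_partials s g : smooth g -> smooth (partials s g).
Proof. by move=> sg; elim: s => [//|i s]; exact: smooth_partial. Qed.

Lemma smooth_continuous g : smooth g -> continuous g.
Proof. by move=> /(_ [::])[]. Qed.

Lemma smooth_derivable g i x : smooth g -> derivable g x (delta_mx ord0 i).
Proof. by move=> /(_ [::])[_]. Qed.

(** Smoothness as a greatest fixed point: it suffices to find a class of continuous, partially
    derivable functions that is stable under [partial]. *)
Lemma smooth_coind (P : ('rV[R]_n -> R) -> Prop) :
  (forall g, P g -> [/\ continuous g, forall i x, derivable g x (delta_mx ord0 i) &
    forall i, P (partial i g)]) ->
  forall g, P g -> smooth g.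
Proof.
move=> HP g Pg s; have : P (partials s g).
  by elim: s => [//|i s /HP[_ _ H]]; exact: H.
by move=> /HP[].
Qed.

Lemma partialD i F G : smooth F -> smooth G ->
  partial i (fun x => F x + G x) = fun x => partial i F x + partial i G x.
Proof.
move=> sF sG; apply/funext => x.
by rewrite /partial; apply: deriveD; apply: smooth_derivable.
Qed.

Lemma partialM i F G : smooth F -> smooth G ->
  partial i (fun x => F x * G x) = fun x => partial i F x * G x + F x * partial i G x.
Proof.
move=> sF sG; apply/funext => x; rewrite /partial.
have -> : (fun x => F x * G x) = F * G by [].
rewrite deriveM; try exact: smooth_derivable.
by rewrite /GRing.scale /= addrC [G x * _]mulrC.
Qed.

(** A class for [smooth_coind]: products of smooth functions are not visibly stable under [partial],
    but finite sums of them are, by the product rule. *)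
Inductive polysmooth : ('rV[R]_n -> R) -> Prop :=
| polysmooth_cst c : polysmooth (fun=> c)
| polysmooth_mul F G : smooth F -> smooth G -> polysmooth (fun x => F x * G x)
| polysmooth_add F G : polysmooth F -> polysmooth G -> polysmooth (fun x => F x + G x).

Lemma polysmooth_smooth g : polysmooth g -> smooth g.
Proof.
apply: smooth_coind => {}g; elim=> [c|F G sF sG|F G pF [cF dF pdF] pG [cG dG pdG]].
- split; [exact: cst_continuous|move=> i x; exact: derivable_cst|move=> i].
  rewrite (_ : partial i _ = fun=> 0); first exact: polysmooth_cst.
  by apply/funext => x; rewrite /partial derive_cst.
- split; first by apply: continuous_fctM; exact: smooth_continuous.
    by move=> i x; apply: derivableM; exact: smooth_derivable.
  move=> i; rewrite (partialM i sF sG); apply: polysmooth_add.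
    exact: polysmooth_mul (smooth_partial i sF) sG.
  exact: polysmooth_mul sF (smooth_partial i sG).
- split; first exact: continuous_fctD.
    by move=> i x; apply: derivableD.
  move=> i; rewrite (_ : partial i _ = fun x => partial i F x + partial i G x).
    exact: polysmooth_add.
  by apply/funext => x; rewrite /partial; exact: deriveD.
Qed.

Lemma smooth_cst c : smooth (fun _ : 'rV[R]_n => c).
Proof. exact/polysmooth_smooth/polysmooth_cst. Qed.

Lemma smoothM F G : smooth F -> smooth G -> smooth (fun x => F x * G x).
Proof. by move=> sF sG; exact/polysmooth_smooth/polysmooth_mul. Qed.

Lemma smoothD F G : smooth F -> smooth G -> smooth (fun x => F x + G x).
Proof.
move=> sF sG; have -> : (fun x => F x + G x) = fun x => F x * 1 + G x * 1.
  by apply/funext => x; rewrite !mulr1.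
apply: polysmooth_smooth; apply: polysmooth_add.
  exact: polysmooth_mul sF (smooth_cst 1).
exact: polysmooth_mul sG (smooth_cst 1).
Qed.

Lemma smoothB F G : smooth F -> smooth G -> smooth (fun x => F x - G x).
Proof.
move=> sF sG; have -> : (fun x => F x - G x) = fun x => F x + -1 * G x.
  by apply/funext => x; rewrite mulN1r.
exact: smoothD sF (smoothM (smooth_cst (-1)) sG).
Qed.

Lemma partialsD s F G : smooth F -> smooth G ->
  partials s (fun x => F x + G x) = fun x => partials s F x + partials s G x.
Proof.
move=> sF sG; elim: s => [|i s IH]; first by [].
rewrite -[LHS]/(partial i (partials s _)) IH.
exact: partialD (smooth_partials s sF) (smooth_partials s sG).
Qed.

Lemma partialsZ s c G : smooth G ->
  partials s (fun x => c * G x) = fun x => c * partials s G x.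
Proof.
move=> sG; elim: s => [|i s IH]; first by [].
rewrite -[LHS]/(partial i (partials s _)) IH; apply/funext => x.
by rewrite /partial; apply: deriveZ; apply: smooth_derivable; exact: smooth_partials.
Qed.

Lemma partialsB s F G : smooth F -> smooth G ->
  partials s (fun x => F x - G x) = fun x => partials s F x - partials s G x.
Proof.
move=> sF sG; have -> : (fun x => F x - G x) = fun x => F x + -1 * G x.
  by apply/funext => x; rewrite mulN1r.
rewrite (partialsD s sF (smoothM (smooth_cst (-1)) sG)) (partialsZ s (-1) sG).
by apply/funext => x; rewrite mulN1r.
Qed.

(* [psum r g x] is the sum of [`|partials t g x|] over the subsequences [t] of
   [rev r]. *)
Fixpoint psum (r : seq 'I_n) g x : R :=
  if r is i :: r' then psum r' g x + psum r' (partial i g) x else `|g x|.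

Lemma psum_ge0 r g x : 0 <= psum r g x.
Proof. by elim: r g => [|i r IH] g //=; rewrite addr_ge0. Qed.

(** A crude Leibniz rule: every product of derivatives along complementary subsequences occurs in
    the expansion of the right side, and the remaining terms are nonnegative. This form passes
    through the induction without counting. *)
Lemma normr_partialsM s F G x : smooth F -> smooth G ->
  `|partials s (fun x => F x * G x) x| <= psum (rev s) F x * psum (rev s) G x.
Proof.
elim/last_ind: s F G => [|s i IH] F G sF sG; first by rewrite /= normrM.
rewrite partials_rcons rev_rcons /= (partialM i sF sG).
have sF' := smooth_partial i sF; have sG' := smooth_partial i sG.
rewrite (partialsD s (smoothM sF' sG) (smoothM sF sG')).
rewrite (le_trans (ler_normD _ _))//.
have H1 := IH _ _ sF' sG; have H2 := IH _ _ sF sG'.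
rewrite (le_trans (lerD H1 H2))// !mulrDl !mulrDr.
have := mulr_ge0 (psum_ge0 (rev s) F x) (psum_ge0 (rev s) G x).
have := mulr_ge0 (psum_ge0 (rev s) (partial i F) x) (psum_ge0 (rev s) (partial i G) x).
lra.
Qed.

(** An entry consists of amplitude, phase and frequency vector. With phases, sines need no separate
    treatment, and differentiation stays in the class: it multiplies the amplitude by a frequency
    and adds pi / 2 to the phase. *)
Definition trig (L : seq (R * R * 'rV[R]_n)) (x : 'rV[R]_n) : R :=
  \sum_(p <- L) p.1.1 * cos (p.1.2 + dotp p.2 x).

Lemma trig_nil : trig [::] = fun=> 0.
Proof. by apply/funext => x; rewrite /trig big_nil. Qed.

Lemma trig_cons p L : trig (p :: L) = fun x => p.1.1 * cos (p.1.2 + dotp p.2 x) + trig L x.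
Proof. by apply/funext => x; rewrite /trig big_cons. Qed.

Lemma dotp_line (z x : 'rV[R]_n) i (s : R) :
  dotp z (s *: delta_mx ord0 i + x) = dotp z x + z ord0 i * s.
Proof.
rewrite /dotp (eq_bigr (fun j => z ord0 j * x ord0 j + z ord0 j * (s * (j == i)%:R))).
  rewrite big_split /=; congr (_ + _); rewrite (bigD1 i)//= eqxx mulr1 big1 ?addr0//.
  by move=> j /negPf ->; rewrite !mulr0.
by move=> j _; rewrite !mxE eqxx /= mulrDr addrC.
Qed.

Lemma continuous_dotp (z : 'rV[R]_n) : continuous (dotp z).
Proof.
rewrite /dotp; elim: (index_enum _) => [|i s IH].
  by rewrite (_ : (fun _ => _) = fun=> 0); [exact: cst_continuous|apply/funext => x; rewrite big_nil].
rewrite (_ : (fun _ => _) = fun x : 'rV[R]_n => z ord0 i * x ord0 i + \sum_(j <- s) z ord0 j * x ord0 j).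
  by apply: continuous_fctD => //; apply: continuous_fctZ; exact: coord_continuous.
by apply/funext => x; rewrite big_cons.
Qed.

Lemma continuous_cos_dotp (z : 'rV[R]_n) th : continuous (fun x => cos (th + dotp z x)).
Proof.
move=> x; apply: continuous_comp; last exact: continuous_cos.
by move: x; apply: continuous_fctD; [exact: cst_continuous|exact: continuous_dotp].
Qed.

Lemma cos_dotp_line (z x : 'rV[R]_n) i th :
  derivable (fun x => cos (th + dotp z x)) x (delta_mx ord0 i) /\
  'D_(delta_mx ord0 i) (fun x => cos (th + dotp z x)) x = z ord0 i * cos (th + pi / 2 + dotp z x).
Proof.
pose A t := th + dotp z x + z ord0 i * t.
have dA : is_derive (0 : R) 1 A (z ord0 i).
  apply: (is_derive_ext (is_deriveD (is_derive_cst (th + dotp z x) (0 : R) (1 : R))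
     (is_deriveZ (z ord0 i) (is_derive_id 0 (1 : R))))) => //.
  by rewrite /GRing.scale /= mulr1 add0r.
have [d1 d2] := @is_derive1_comp R cos A 0 _ _ (is_derive_cos _) dA.
have [|e1 e2] := @derive_line R _ _ (fun x => cos (th + dotp z x)) (cos \o A) x
    (delta_mx ord0 i) 0 1 _ d1.
  by move=> s; rewrite dotp_line /A /= addrA addr0 /GRing.scale /= mulr1.
split=> //; rewrite e2 d2 /A mulr0 addr0 addrAC cosDpihalf mulrC.
by [].
Qed.

Lemma smooth_trig L : smooth (trig L).
Proof.
have sc (z : 'rV[R]_n) th : smooth (fun x => cos (th + dotp z x)).
  pose P g := exists c th, g = fun x => c * cos (th + dotp z x).
  apply: (@smooth_coind P); last first.
    by exists 1, th; apply/funext => x; rewrite mul1r.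
  move=> _ [c [th' ->]]; split.
  - by apply: continuous_fctZ; exact: continuous_cos_dotp.
  - by move=> i x; apply: derivableZ; exact: (cos_dotp_line z x i th').1.
  - move=> i; exists (c * z ord0 i), (th' + pi / 2); apply/funext => x.
    have [e1 e2] := cos_dotp_line z x i th'.
    by rewrite /partial deriveZ// e2 /GRing.scale /= mulrA.
elim: L => [|p L IH]; first by rewrite trig_nil; exact: smooth_cst.
rewrite trig_cons; exact: smoothD (smoothM (smooth_cst _) (sc _ _)) IH.
Qed.

Lemma partial_trig L i :
  partial i (trig L) = trig [seq (p.1.1 * p.2 ord0 i, p.1.2 + pi / 2, p.2) | p : R * R * 'rV[R]_n <- L].
Proof.
elim: L => [|p L IH] /=.
  by rewrite trig_nil; apply/funext => x; rewrite /partial derive_cst.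
have e1 : trig (p :: L) = fun x => trig [:: p] x + trig L x.
  by rewrite !trig_cons trig_nil; apply/funext => x; rewrite addr0.
rewrite e1 (partialD i (smooth_trig _) (smooth_trig _)).
rewrite IH [RHS]trig_cons /=; apply/funext => x; congr (_ + _).
rewrite trig_cons trig_nil /partial.
have [d1 d2] := cos_dotp_line p.2 x i p.1.2.
have -> : (fun x => p.1.1 * cos (p.1.2 + dotp p.2 x) + 0) =
    p.1.1 \*: (fun x => cos (p.1.2 + dotp p.2 x)).
  by apply/funext => y; rewrite addr0.
by rewrite deriveZ// d2 /GRing.scale /= mulrA.
Qed.

(** The length of the list enters only through the total amplitude, which is what allows an
    arbitrarily fine quadrature. *)
Lemma normr_partials_trig s L b x : 0 <= b ->
  (forall p : R * R * 'rV[R]_n, p \in L -> forall i, `|p.2 ord0 i| <= b) ->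
  `|partials s (trig L) x| <= (\sum_(p <- L) `|p.1.1|) * b ^+ size s.
Proof.
move=> b0; elim/last_ind: s L => [|s i IH] L Lb.
  rewrite expr0 mulr1 (le_trans (ler_norm_sum _ _ _))//; apply: ler_sum => p _.
  by rewrite normrM ler_piMr// cos_max.
rewrite partials_rcons partial_trig; apply: le_trans (IH _ _) _.
  by move=> _ /mapP[p pL ->]; exact: (Lb p pL).
rewrite big_map size_rcons exprS mulrA ler_wpM2r ?exprn_ge0// mulr_suml.
rewrite big_seq [leRHS]big_seq; apply: ler_sum => p pL /=.
by rewrite normrM ler_wpM2l// Lb.
Qed.

Lemma psum_trig_le r L b x : 0 <= b ->
  (forall p : R * R * 'rV[R]_n, p \in L -> forall i, `|p.2 ord0 i| <= b) ->
  psum r (trig L) x <= (\sum_(p <- L) `|p.1.1|) * (1 + b) ^+ size r.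
Proof.
move=> b0; elim: r L => [|i r IH] L Lb.
  by have := @normr_partials_trig [::] L b x b0 Lb; rewrite /= !expr0.
rewrite /= exprS mulrCA mulrDl mul1r partial_trig; apply: lerD; first exact: IH.
apply: le_trans (IH _ _) _; first by move=> _ /mapP[p pL ->]; exact: (Lb p pL).
rewrite big_map mulrA ler_wpM2r ?exprn_ge0 ?addr_ge0// mulr_sumr.
rewrite big_seq [leRHS]big_seq; apply: ler_sum => p pL /=.
by rewrite normrM mulrC ler_wpM2r// Lb.
Qed.

Lemma cube_int_trig h L : 0 <= h ->
  cube_int h (trig L) = \sum_(p <- L) p.1.1 * (cos p.1.2 * \prod_i (2 * sinq h (p.2 ord0 i))).
Proof.
move=> h0; elim: L => [|p L IH]; first by rewrite trig_nil cube_int_cst0 big_nil.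
rewrite trig_cons big_cons -IH cube_int_lin//; last 2 first.
- exact: continuous_cos_dotp.
- exact/smooth_continuous/smooth_trig.
by rewrite cube_int_cos.
Qed.

End Smooth.

(** * The ring of generalized numbers *)

Section GR.
Local Open Scope quotient_scope.
Context {R : realType}.
Variable sigma : gauge R.
Implicit Types (u v : R -> R).

Lemma near_gauge_lt c : 0 < c -> \forall e \near 0^'+, sigma e < c.
Proof.
move=> c0; have /cvgrPdist_lt/(_ _ c0) := @gauge_cvg _ sigma.
apply: filterS2 (near_gauge sigma) => e /andP[s0 _].
by rewrite sub0r normrN gtr0_norm.
Qed.

Lemma moderateP u : reflect (is_moderate sigma u) (u \in moderate sigma).
Proof. exact: asboolP. Qed.

Lemma moderateD u v : is_moderate sigma u -> is_moderate sigma v ->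
  is_moderate sigma (fun e => u e + v e).
Proof. by move=> /moderateP uM /moderateP vM; apply/moderateP; exact: (rpredD uM vM). Qed.

Lemma moderateM u v : is_moderate sigma u -> is_moderate sigma v ->
  is_moderate sigma (fun e => u e * v e).
Proof. by move=> /moderateP uM /moderateP vM; apply/moderateP; exact: (rpredM uM vM). Qed.

Lemma gclassE u (uM : u \in moderate sigma) : gclass sigma u = \pi_(gR sigma) (MNet uM).
Proof.
rewrite /gclass; congr (\pi_(_) _); apply: val_inj.
by rewrite val_insubd uM.
Qed.

Lemma gclassD u v : is_moderate sigma u -> is_moderate sigma v ->
  gclass sigma (fun e => u e + v e) = gclass sigma u + gclass sigma v.
Proof.
move=> /moderateP uM /moderateP vM.
rewrite (gclassE uM) (gclassE vM) (gclassE (rpredD uM vM)).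
pose Q := {ideal_quot (@Defs.negligible R sigma)}.
rewrite -[RHS]/((\pi_Q (MNet uM)) + (\pi_Q (MNet vM))).
rewrite -rmorphD.
by congr (\pi_(_) _); apply: val_inj.
Qed.

Lemma gclassM u v : is_moderate sigma u -> is_moderate sigma v ->
  gclass sigma (fun e => u e * v e) = gclass sigma u * gclass sigma v.
Proof.
move=> /moderateP uM /moderateP vM.
rewrite (gclassE uM) (gclassE vM) (gclassE (rpredM uM vM)).
pose Q := {ideal_quot (@Defs.negligible R sigma)}.
rewrite -[RHS]/((\pi_Q (MNet uM)) * (\pi_Q (MNet vM))) -rmorphM.
by congr (\pi_(_) _); apply: val_inj.
Qed.

Lemma gclass_repr (x : gR sigma) : gclass sigma (repr_net x) = x.
Proof.
have xM : repr_net x \in moderate sigma by rewrite /repr_net; case: (repr x).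
rewrite (gclassE xM) -[RHS]reprK; congr (\pi_(_) _); exact: val_inj.
Qed.


Definition null u : Prop := forall m : nat, \forall e \near 0^'+, `|u e| <= sigma e ^+ m.

Lemma gclassPM u v : is_moderate sigma u -> is_moderate sigma v ->
  gclass sigma u = gclass sigma v <-> null (fun e => u e - v e).
Proof.
move=> /moderateP uM /moderateP vM; rewrite (gclassE uM) (gclassE vM).
have := Quotient.idealrBE (@Defs.negligible R sigma) (MNet uM) (MNet vM).
move=> E; split=> [/eqP|H].
  by rewrite -E => /asboolP.
by apply/eqP; rewrite -E; apply/asboolP.
Qed.

Lemma moderate_le u v : is_moderate sigma v ->
  (\forall e \near 0^'+, `|u e| <= `|v e|) -> is_moderate sigma u.
Proof.
move=> [N vN] uv; exists N; apply: filterS2 uv vN => e; exact: le_trans.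
Qed.

Lemma moderateN u : is_moderate sigma u -> is_moderate sigma (fun e => - u e).
Proof.
by move=> uM; apply: moderate_le uM _; near=> e; rewrite normrN.
Unshelve. all: by end_near. Qed.

Lemma moderateB u v : is_moderate sigma u -> is_moderate sigma v ->
  is_moderate sigma (fun e => u e - v e).
Proof. by move=> uM vM; apply: moderateD => //; exact: moderateN. Qed.

Lemma moderate_cst c : is_moderate sigma (fun=> c).
Proof.
exists 1%N; have c0 : 0 < (1 + `|c|)^-1 by rewrite invr_gt0 ltr_pwDl.
apply: filterS2 (near_gauge sigma) (near_gauge_lt c0) => e /andP[s0 _] sc.
rewrite expr1; apply: (@le_trans _ _ (1 + `|c|)); first by rewrite lerDr.
by rewrite -[leLHS]invrK lef_pV2 ?posrE ?invr_gt0 ?ltr_pwDl// ltW.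
Qed.

Lemma moderate_norm u : is_moderate sigma u -> is_moderate sigma (fun e => `|u e|).
Proof.
by move=> uM; apply: moderate_le uM _; near=> e; rewrite normr_id.
Unshelve. all: by end_near. Qed.

Lemma moderateX u n : is_moderate sigma u -> is_moderate sigma (fun e => u e ^+ n).
Proof.
move=> uM; elim: n => [|n IH]; first exact: moderate_cst.
rewrite (_ : (fun _ => _) = fun e => u e * u e ^+ n); first exact: moderateM.
by apply/funext => e; rewrite exprS.
Qed.

Lemma moderateV_gauge N : is_moderate sigma (fun e => sigma e ^- N).
Proof.
exists N; apply: filterS (near_gauge sigma) => e /andP[s0 _].
by rewrite ger0_norm// invr_ge0 exprn_ge0// ltW.
Qed.

Lemma moderate_repr (x : gR sigma) : is_moderate sigma (repr_net x).
Proof. by apply/moderateP; rewrite /repr_net; case: (repr x). Qed.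

Lemma null_moderate u : null u -> is_moderate sigma u.
Proof.
move=> /(_ 0%N) u0; apply: moderate_le (moderate_cst 1) _.
by apply: filterS u0 => e; rewrite normr1.
Qed.

Lemma null_le u v : null v -> (\forall e \near 0^'+, `|u e| <= `|v e|) -> null u.
Proof. by move=> v0 uv m; apply: filterS2 uv (v0 m) => e; exact: le_trans. Qed.

Lemma nullN u : null u -> null (fun e => - u e).
Proof.
by move=> u0; apply: null_le u0 _; near=> e; rewrite normrN.
Unshelve. all: by end_near. Qed.

Lemma nullM u v : is_moderate sigma u -> null v -> null (fun e => u e * v e).
Proof.
move=> [N uN] v0 m; near=> e.
have /andP[s0 _] : 0 < sigma e <= 1 by near: e; exact: near_gauge.
rewrite normrM; apply: (@le_trans _ _ (sigma e ^- N * sigma e ^+ (N + m))).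
  by apply: ler_pM => //; near: e; [exact: uN|exact: v0].
by rewrite exprD mulrA mulVf ?mul1r// expf_neq0// gt_eqF.
Unshelve. all: by end_near. Qed.

Lemma nullD u v : null u -> null v -> null (fun e => u e + v e).
Proof.
move=> u0 v0.
have H : null (fun e => 2 * Num.max `|u e| `|v e|).
  apply: nullM; first exact: moderate_cst.
  move=> m; apply: filterS2 (u0 m) (v0 m) => e ue ve.
  by rewrite ger0_norm ?le_max ?normr_ge0// ge_max ue.
apply: null_le H _; near=> e.
rewrite (le_trans (ler_normD _ _))// [leRHS]ger0_norm ?mulr_ge0// ?le_max ?normr_ge0//.
by rewrite mulr_natl mulr2n; apply: lerD; rewrite le_max lexx ?orbT.
Unshelve. all: by end_near. Qed.

Lemma gclass_eq u v : null (fun e => u e - v e) -> gclass sigma u = gclass sigma v.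
Proof.
move=> uv; have [uM|uM] := pselect (is_moderate sigma u).
  apply/gclassPM => //; rewrite (_ : v = fun e => u e - (u e - v e)).
    by apply: moderateB => //; exact: null_moderate.
  by apply/funext => e; rewrite subKr.
(* Otherwise neither net is moderate, and both classes are the default 0. *)
have vM : ~ is_moderate sigma v.
  move=> vM; apply: uM; rewrite (_ : u = fun e => v e + (u e - v e)).
    by apply: moderateD => //; exact: null_moderate.
  by apply/funext => e; rewrite addrC subrK.
rewrite /gclass /insubd !insubF//.
  by apply/negP => /moderateP.
by apply/negP => /moderateP.
Qed.

Lemma near_null u : (\forall e \near 0^'+, u e = 0) -> null u.
Proof.
move=> u0 m; apply: filterS2 u0 (near_gauge sigma) => e -> /andP[s0 _].
by rewrite normr0 exprn_ge0// ltW.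
Qed.

Lemma gclass_near u v : (\forall e \near 0^'+, u e = v e) -> gclass sigma u = gclass sigma v.
Proof.
by move=> uv; apply: gclass_eq; apply: near_null; apply: filterS uv => e ->; rewrite subrr.
Qed.

Lemma gclassN u : is_moderate sigma u -> gclass sigma (fun e => - u e) = - gclass sigma u.
Proof.
move=> uM; apply/eqP; rewrite -addr_eq0 -gclassD//; last exact: moderateN.
rewrite (_ : (fun _ => _) = fun=> 0); last by apply/funext => e; rewrite addNr.
apply/eqP; have := gclassD (moderate_cst 0) (moderate_cst 0).
rewrite (_ : (fun _ => _) = fun=> 0); last by apply/funext => e; rewrite addr0.
by move=> /eqP; rewrite -{1}[gclass _ _]addr0 => /eqP/addrI.
Qed.

Lemma gclassB u v : is_moderate sigma u -> is_moderate sigma v ->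
  gclass sigma (fun e => u e - v e) = gclass sigma u - gclass sigma v.
Proof. by move=> uM vM; rewrite gclassD ?gclassN//; exact: moderateN. Qed.

Lemma gclass0 : gclass sigma (fun=> 0) = 0.
Proof.
have := gclassB (moderate_cst 0) (moderate_cst 0).
rewrite [in RHS]subrr => <-; congr gclass; apply/funext => e; exact/esym/subrr.
Qed.

Lemma gclass1 : gclass sigma (fun=> 1) = 1.
Proof.
have /moderateP cM := moderate_cst 1; rewrite (gclassE cM).
pose Q := {ideal_quot (@Defs.negligible R sigma)}.
rewrite -[RHS]/(1 : Q) -(rmorph1 \pi_Q).
by congr (\pi_(_) _); apply: val_inj.
Qed.

Lemma gclassX u n : is_moderate sigma u ->
  gclass sigma (fun e => u e ^+ n) = gclass sigma u ^+ n.
Proof.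
move=> uM; elim: n => [|n IH]; first exact: gclass1.
rewrite exprS -IH -gclassM//; last exact: moderateX.
by congr gclass; apply/funext => e; rewrite exprS.
Qed.

Lemma gclass_sum n (u : 'I_n -> R -> R) : (forall i, is_moderate sigma (u i)) ->
  is_moderate sigma (fun e => \sum_i u i e) /\
  gclass sigma (fun e => \sum_i u i e) = \sum_i gclass sigma (u i).
Proof.
move=> uM; elim: (index_enum _) => [|i s [IM IE]].
  rewrite (_ : (fun _ => _) = fun=> 0); last by apply/funext => e; rewrite big_nil.
  by rewrite big_nil gclass0; split => //; exact: moderate_cst.
rewrite (_ : (fun _ => _) = fun e => u i e + \sum_(j <- s) u j e); last first.
  by apply/funext => e; rewrite big_cons.
by rewrite big_cons gclassD// IE; split => //; exact: moderateD.
Qed.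

Lemma represents_repr (x : gR sigma) : represents (repr_net x) x.
Proof. by split; [exact: moderate_repr|exact: gclass_repr]. Qed.

Lemma represents_gclass u : is_moderate sigma u -> represents u (gclass sigma u).
Proof. by []. Qed.

Lemma represents_null u v (x : gR sigma) : represents u x -> represents v x ->
  null (fun e => u e - v e).
Proof. by move=> [uM <-] [vM E]; exact/gclassPM. Qed.

Lemma representsN u (x : gR sigma) : represents u x -> represents (fun e => - u e) (- x).
Proof. by move=> [uM <-]; split; [exact: moderateN|rewrite gclassN]. Qed.

Lemma representsM u v (x y : gR sigma) : represents u x -> represents v y ->
  represents (fun e => u e * v e) (x * y).
Proof. by move=> [uM <-] [vM <-]; split; [exact: moderateM|rewrite gclassM]. Qed.

(** [gle] demands the inequality at every e. Replacing u by the minimum of u and v achieves this and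
    changes u only away from 0, hence not its class. *)
Lemma gle_near u v (x y : gR sigma) : represents u x -> represents v y ->
  (\forall e \near 0^'+, u e <= v e) -> gle x y.
Proof.
move=> [uM ux] vy uv; exists (fun e => Num.min (u e) (v e)), v; split => //; last first.
  by move=> e _; rewrite ge_min lexx orbT.
have E : \forall e \near 0^'+, Num.min (u e) (v e) = u e by apply: filterS uv => e /min_idPl.
split; last by rewrite -ux; exact: gclass_near.
by apply: moderate_le uM _; apply: filterS E => e ->.
Qed.

(** Arbitrary representatives differ from those witnessing [gle] by negligible nets, so the
    inequality survives up to any power of sigma. The case m = 0, a slack of 1, is mostly enough
    below. *)
Lemma gle_bound u v (x y : gR sigma) : gle x y -> represents u x -> represents v y ->
  forall m : nat, \forall e \near 0^'+, u e <= v e + sigma e ^+ m.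
Proof.
move=> [u' [v' [ux' vy' uv']]] ux vy m.
have H := nullD (represents_null ux ux') (nullN (represents_null vy vy')).
near=> e.
have e01 : 0 < e <= 1.
  by apply/andP; split; near: e; [exact: nbhs_right_gt|exact: nbhs_right_le].
have := uv' e e01.
have : `|u e - u' e + - (v e - v' e)| <= sigma e ^+ m by near: e; exact: H.
by rewrite ler_norml => /andP[_]; lra.
Unshelve. all: by end_near. Qed.

End GR.

(** * Generalized smooth functions and their integrals *)

Section MultiIndex.
Context {n : nat}.
Implicit Types (t : seq 'I_n) (alpha : 'I_n -> nat).

Let leo (i j : 'I_n) := (i <= j)%N.
Let leo_trans : transitive leo. Proof. by move=> j i k; exact: leq_trans. Qed.
Let leo_anti : antisymmetric leo.
Proof. by move=> i j /andP[ij ji]; apply/val_inj/anti_leq/andP. Qed.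

Lemma sorted_multi_index_seq alpha : sorted leo (multi_index_seq alpha).
Proof.
rewrite (sorted_pairwise leo_trans) /multi_index_seq.
have : pairwise leo (enum 'I_n).
  rewrite -(sorted_pairwise leo_trans) -(@sorted_map _ _ val leq) val_enum_ord.
  exact: iota_sorted.
elim: (enum 'I_n) => [//|i s IH] /= /andP[/allP is_ /IH ps].
rewrite pairwise_cat ps andbT; apply/andP; split.
  apply/allrelP => j l /nseqP[-> _] /flattenP[_ /mapP[m ms ->] /nseqP[-> _]].
  exact: is_.
rewrite -(sorted_pairwise leo_trans).
by case: (alpha i) => // m; elim: m => //= m ->; rewrite /leo leqnn.
Qed.

Lemma count_multi_index_seq alpha i : count_mem i (multi_index_seq alpha) = alpha i.
Proof.
rewrite /multi_index_seq count_flatten -map_comp sumnE big_map big_enum /=.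
rewrite (bigD1 i)//= count_nseq /= eqxx mul1n big1 ?addn0// => j ji.
by rewrite count_nseq /= (negPf ji) mul0n.
Qed.

Lemma multi_index_seq_sorted t : sorted leo t ->
  multi_index_seq (fun i => count_mem i t) = t.
Proof.
move=> st; apply: (sorted_eq leo_trans leo_anti (sorted_multi_index_seq _) st).
by apply/allP => i _ /=; rewrite count_multi_index_seq.
Qed.

(** Moderateness is given for derivatives in the sorted order of a multi-index, while the Leibniz
    rule produces subsequences of that order. These are sorted too, hence again multi-indices, and
    the symmetry of mixed partial derivatives is avoided. *)
Lemma subseq_multi_index alpha t : subseq t (multi_index_seq alpha) ->
  exists beta, t = multi_index_seq beta.
Proof.
move=> ts; have st := subseq_sorted leo_trans ts (sorted_multi_index_seq alpha).
by exists (fun i => count_mem i t); apply: esym; exact: multi_index_seq_sorted.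
Qed.

Lemma multi_index_seq0 : multi_index_seq (fun=> 0%N) = [::] :> seq 'I_n.
Proof. exact: (@multi_index_seq_sorted [::]). Qed.

Lemma multi_index_seq1 i : exists alpha, multi_index_seq alpha = [:: i].
Proof. by exists (fun j => count_mem j [:: i]); exact: multi_index_seq_sorted. Qed.

End MultiIndex.

(** * Generalized complex numbers and exponentials *)

Section Complex.
Context {R : realType}.
Variable sigma : gauge R.
Implicit Types (u v a b c d : R -> R).

Lemma normc_ge (a b : R) : `|a| <= normC (a +i* b)%C /\ `|b| <= normC (a +i* b)%C.
Proof.
by split; rewrite /Normc.normc -sqrtr_sqr ler_wsqrtr// ?lerDl ?lerDr sqr_ge0.
Qed.

Lemma normc_le (a b : R) : normC (a +i* b)%C <= `|a| + `|b|.
Proof.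
rewrite /Normc.normc -[leRHS]ger0_norm ?addr_ge0// -sqrtr_sqr ler_wsqrtr//.
rewrite sqrrD !real_normK ?num_real// lerD2r lerDl mulrn_wge0// mulr_ge0//.
Qed.

Lemma cmoderateP (u : R -> R[i]) : cmoderate sigma u <->
  is_moderate sigma (fun e => reC (u e)) /\ is_moderate sigma (fun e => imC (u e)).
Proof.
split=> [uM|[rM iM]].
  split; apply: moderate_le uM _; apply: nearW => e; case: (u e) => a b /=;
  have [H1 H2] := normc_ge a b; rewrite [leRHS]ger0_norm//; exact: le_trans H1.
apply: moderate_le (moderateD (moderate_norm rM) (moderate_norm iM)) _.
apply: nearW => e; case: (u e) => a b; rewrite [leRHS]ger0_norm ?addr_ge0//.
have [H1 _] := normc_ge a b; rewrite [leLHS]ger0_norm ?normc_le//.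
exact: le_trans H1.
Qed.

Lemma gmul_gclass a b c d : is_moderate sigma a -> is_moderate sigma b ->
  is_moderate sigma c -> is_moderate sigma d ->
  gmul (gclass sigma a +i* gclass sigma b)%C (gclass sigma c +i* gclass sigma d)%C =
  (gclass sigma (fun e => a e * c e - b e * d e)%R +i*
   gclass sigma (fun e => a e * d e + b e * c e)%R)%C.
Proof.
move=> aM bM cM dM; rewrite gclassB ?gclassD; try exact: moderateM.
by rewrite !gclassM.
Qed.

Lemma cos_sin_lip (x y : R) : `|cos x - cos y| <= `|x - y| /\ `|sin x - sin y| <= `|x - y|.
Proof.
wlog xy : x y / y <= x.
  move=> H; have [/H//|/ltW /H [H1 H2]] := leP y x.
  by rewrite distrC [`|sin _ - _|]distrC [`|x - _|]distrC.
rewrite (ger0_norm (_ : 0 <= x - y)) ?subr_ge0//; split.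
  apply: (@ler_derive_diff R cos id (fun t => - sin t) (fun=> 1) y x xy) => t _.
  by rewrite normrN sin_max.
by apply: (@ler_derive_diff R sin id cos (fun=> 1) y x xy) => t _; exact: cos_max.
Qed.

Lemma moderate_cos u : is_moderate sigma (fun e => cos (u e)).
Proof.
apply: moderate_le (moderate_cst sigma 1) _; apply: nearW => e.
by rewrite normr1 cos_max.
Qed.

Lemma moderate_sin u : is_moderate sigma (fun e => sin (u e)).
Proof.
apply: moderate_le (moderate_cst sigma 1) _; apply: nearW => e.
by rewrite normr1 sin_max.
Qed.

Lemma gexpi_represents u (x : gR sigma) : represents u x ->
  gexpi x = (gclass sigma (fun e => cos (u e)) +i* gclass sigma (fun e => sin (u e)))%C.
Proof.
move=> ux; have H := represents_null (represents_repr x) ux.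
rewrite /gexpi /gCclass /=; congr (_ +i* _)%C; apply: gclass_eq.
  by apply: null_le H _; apply: nearW => e; exact: (cos_sin_lip _ _).1.
by apply: null_le H _; apply: nearW => e; exact: (cos_sin_lip _ _).2.
Qed.

Lemma gdot_represents n (u w : R -> 'rV[R]_n) (x y : 'rV[gR sigma]_n) :
  vrepresents u x -> vrepresents w y -> represents (fun e => dotp (w e) (u e)) (gdot x y).
Proof.
move=> ux wy; have H i := representsM (wy i) (ux i).
have [M E] := gclass_sum (fun i => (H i).1).
split=> //; rewrite /dotp E; apply: eq_bigr => i _.
by rewrite (H i).2 mulrC.
Qed.

Lemma vrepresentsN n (u : R -> 'rV[R]_n) (x : 'rV[gR sigma]_n) :
  vrepresents u x -> vrepresents (fun e => - u e) (- x).
Proof.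
move=> ux i; have := representsN (ux i); rewrite mxE.
by congr represents; apply/funext => e; rewrite mxE.
Qed.

Lemma vrepresents_repr n (x : 'rV[gR sigma]_n) :
  vrepresents (fun e => \row_i repr_net (x ord0 i) e) x.
Proof.
move=> i; have := represents_repr (x ord0 i).
by congr represents; apply/funext => e; rewrite mxE.
Qed.

End Complex.

Section Integral.
Context {R : realType}.
Variables (sigma : gauge R) (n : nat) (k : gR sigma).
Hypothesis k_gt0 : \forall e \near 0^'+, 0 < repr_net k e.
Implicit Types (f : 'rV[gR sigma]_n -> gC sigma) (F : R -> 'rV[R]_n -> R[i]).

Lemma near_01 : \forall e \near (0 : R)^'+, 0 < e <= 1.
Proof.
by near=> e; apply/andP; split; near: e; [exact: nbhs_right_gt|exact: nbhs_right_le].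
Unshelve. all: by end_near. Qed.

Lemma gcube_near (u : R -> 'rV[R]_n) : (\forall e \near 0^'+, cube (repr_net k e) (u e)) ->
  exists2 x, gcube k x & vrepresents u x.
Proof.
move=> ku; pose x : 'rV[gR sigma]_n := \row_i gclass sigma (fun e => u e ord0 i).
have ux : vrepresents u x.
  move=> i; rewrite /x mxE; apply: represents_gclass.
  apply: moderate_le (moderate_repr k) _; near=> e.
  have /(_ i) : cube (repr_net k e) (u e) by near: e; exact: ku.
  rewrite -ler_norml => /le_trans; apply; exact: ler_norm.
exists x => // i; split.
  apply: gle_near (representsN (represents_repr k)) (ux i) _.
  by apply: filterS ku => e /(_ i)/andP[].
apply: gle_near (ux i) (represents_repr k) _.
by apply: filterS ku => e /(_ i)/andP[].
Unshelve. all: by end_near. Qed.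

(** Passage from pointwise to uniform statements: for each e the maximum of |g e| over the compact
    cube is attained, and the maximizers represent a point of [gcube k], where the hypotheses on
    nets apply. *)
Lemma cube_maximizer (g : R -> 'rV[R]_n -> R) :
  (forall e, 0 < e <= 1 -> continuous (g e)) ->
  exists u x, [/\ gcube k x, vrepresents u x &
    \forall e \near 0^'+, forall y, cube (repr_net k e) y -> `|g e y| <= `|g e (u e)| ].
Proof.
move=> cg.
(* Where e is out of range or the cube may be empty, [u] takes the default value 0; only small e
   matter. *)
have /choice[u uP] : forall e, exists u : 'rV[R]_n, 0 < e <= 1 -> 0 < repr_net k e ->
    cube (repr_net k e) u /\ forall y, cube (repr_net k e) y -> `|g e y| <= `|g e u|.
  move=> e; have [e01|] := pselect (0 < e <= 1); last by exists 0.
  have [k0|] := pselect (0 < repr_net k e); last by exists 0.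
  have cne : @cube R n (repr_net k e) !=set0.
    exists 0 => i; rewrite mxE; apply/andP; split; last exact: ltW.
    by rewrite oppr_le0 ltW.
  have cgn : {within cube (repr_net k e), continuous (fun y => `|g e y|)}.
    apply: continuous_subspaceT => y; apply: continuous_comp; first exact: cg.
    exact: norm_continuous.
  have [c cc cm] := EVT_max_rV cne (@cube_compact R n _) cgn.
  exists c => _ _; split; first exact: set_mem.
  by move=> y yc; apply: cm; exact: mem_set.
have H : \forall e \near 0^'+, cube (repr_net k e) (u e) /\
    forall y, cube (repr_net k e) y -> `|g e y| <= `|g e (u e)|.
  by apply: filterS2 near_01 k_gt0 => e e01 k0; exact: uP.
have [|x kx ux] := @gcube_near u.
  by apply: filterS H => e [].
by exists u, x; split => //; apply: filterS H => e [].
Qed.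

Lemma null_cube_int (g : R -> 'rV[R]_n -> R) :
  (forall e, 0 < e <= 1 -> continuous (g e)) ->
  (forall x u, gcube k x -> vrepresents u x -> null sigma (fun e => g e (u e))) ->
  null sigma (fun e => cube_int (repr_net k e) (g e)).
Proof.
move=> cg gn; have [u [x [kx ux max]]] := cube_maximizer cg.
have B0 := nullM (moderateX n (moderateM (moderate_cst sigma 2) (moderate_repr k))) (gn _ _ kx ux).
apply: null_le B0 _; near=> e.
have k0 : 0 < repr_net k e by near: e.
rewrite normrM ger0_norm; last by rewrite exprn_ge0// mulr_ge0// ltW.
apply: normr_cube_int => //; first exact: ltW.
  by apply: cg; near: e; exact: near_01.
by near: e.
Unshelve. all: by end_near. Qed.

Lemma cube_sup_moderate (g : R -> 'rV[R]_n -> R) :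
  (forall e, 0 < e <= 1 -> continuous (g e)) ->
  (forall x u, gcube k x -> vrepresents u x -> is_moderate sigma (fun e => g e (u e))) ->
  exists2 B, is_moderate sigma B &
   \forall e \near 0^'+, forall y, cube (repr_net k e) y -> `|g e y| <= B e.
Proof.
move=> cg gn; have [u [x [kx ux max]]] := cube_maximizer cg.
exists (fun e => `|g e (u e)|) => //; apply: moderate_norm; exact: gn kx ux.
Qed.

Lemma moderate_cube_int (g : R -> 'rV[R]_n -> R) :
  (forall e, 0 < e <= 1 -> continuous (g e)) ->
  (forall x u, gcube k x -> vrepresents u x -> is_moderate sigma (fun e => g e (u e))) ->
  is_moderate sigma (fun e => cube_int (repr_net k e) (g e)).
Proof.
move=> cg gn; have [u [x [kx ux max]]] := cube_maximizer cg.
have B0 := moderateM (moderateX n (moderateM (moderate_cst sigma 2) (moderate_repr k))) (gn _ _ kx ux).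
apply: moderate_le B0 _; near=> e.
have k0 : 0 < repr_net k e by near: e.
rewrite normrM ger0_norm; last by rewrite exprn_ge0// mulr_ge0// ltW.
apply: normr_cube_int => //; first exact: ltW.
  by apply: cg; near: e; exact: near_01.
by near: e.
Unshelve. all: by end_near. Qed.

Lemma defining_net_moderate (X : set 'rV[gR sigma]_n) f F x u t alpha :
  defining_net X f F -> X x -> vrepresents u x -> multi_index_seq alpha = t ->
  is_moderate sigma (fun e => partials t (fun y => reC (F e y)) (u e)) /\
  is_moderate sigma (fun e => partials t (fun y => imC (F e y)) (u e)).
Proof. by move=> [_ FM] Xx ux <-; have [_ /(_ alpha)/cmoderateP] := FM x u Xx ux. Qed.

(** Two defining nets differ by a negligible net at each point of [gcube k], hence uniformly on the
    cube by [null_cube_int]; so the net selected by [xget] is immaterial. *)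
Lemma gint_defining_net f F : defining_net (gcube k) f F ->
  gint k f = gCclass sigma (fun e => ccube_int (repr_net k e) (F e)).
Proof.
move=> FP; rewrite /gint; case: xgetP => [G _ /= GP|/(_ F)//].
have cF H e : defining_net (gcube k) f H -> 0 < e <= 1 ->
    continuous (fun y => reC (H e y)) /\ continuous (fun y => imC (H e y)).
  move=> [Hs _] e01; have [h1 h2] := Hs e e01.
  by split; [exact: smooth_continuous h1|exact: smooth_continuous h2].
rewrite /gCclass /ccube_int /=.
have key (p : R[i] -> R) : (p = @complex.Re R \/ p = @complex.Im R) ->
   gclass sigma (fun e => cube_int (repr_net k e) (fun y => p (G e y))) =
   gclass sigma (fun e => cube_int (repr_net k e) (fun y => p (F e y))).
  move=> pE; have cp H e : defining_net (gcube k) f H -> 0 < e <= 1 -> continuous (fun y => p (H e y)).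
    by move=> HP e01; case: pE => ->; have [] := cF H e HP e01.
  apply: gclass_eq.
  have N : null sigma (fun e => cube_int (repr_net k e) (fun y => p (G e y) - p (F e y))).
    apply: (@null_cube_int (fun e y => p (G e y) - p (F e y))).
      by move=> e e01; apply: continuous_fctB; exact: cp.
    move=> x u kx ux; apply/gclassPM.
    - by have [] := defining_net_moderate GP kx ux (@multi_index_seq0 n); case: pE => ->.
    - by have [] := defining_net_moderate FP kx ux (@multi_index_seq0 n); case: pE => ->.
    have [Gx _] := GP.2 x u kx ux; have [Fx _] := FP.2 x u kx ux.
    move: Fx; rewrite Gx /gCclass => -[e1 e2].
    by case: pE => ->.
  apply: null_le N _; near=> e.
  have e01 : 0 < e <= 1 by near: e; exact: near_01.
  have k0 : 0 < repr_net k e by near: e.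
  by rewrite -cube_intB//; [exact: ltW|exact: cp|exact: cp].
by congr (_ +i* _)%C; apply: key; [left|right].
Unshelve. all: by end_near. Qed.

End Integral.

(** * Quadrature of Fourier integrals *)

Section Rule.
Context {R : realType} {n : nat}.
Implicit Types (a d e h H th tau : R) (g F G : 'rV[R]_n -> R) (z eta nu : 'rV[R]_n).

Definition oscillates_le a g d e : Prop := forall x y : 'rV[R]_n,
  cube a x -> cube a y -> (forall i, `|x ord0 i - y ord0 i| <= d) -> `|g x - g y| <= e.

Lemma oscillates_leW a g d d' e : d' <= d -> oscillates_le a g d e -> oscillates_le a g d' e.
Proof. by move=> dd ho x y ax ay xy; apply: ho => // i; exact: le_trans (xy i) dd. Qed.

Lemma oscillates_le_exists a g e : continuous g -> 0 < e ->
  exists2 d, 0 < d & oscillates_le a g d e.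
Proof.
move=> cg e0; have [d d0 H] := @cube_unif R n a g e cg e0.
by exists d => // x y ax _ xy; apply/ltW/H.
Qed.

Lemma dotpB z (x y : 'rV[R]_n) : dotp z (x - y) = dotp z x - dotp z y.
Proof. by rewrite /dotp -sumrB; apply: eq_bigr => i _; rewrite !mxE mulrBr. Qed.

Lemma dotpC z (x : 'rV[R]_n) : dotp z x = dotp x z.
Proof. by apply: eq_bigr => i _; rewrite mulrC. Qed.

Lemma dotpN z (x : 'rV[R]_n) : dotp z (- x) = - dotp z x.
Proof. by rewrite /dotp -sumrN; apply: eq_bigr => i _; rewrite mxE mulrN. Qed.

Lemma cube_bounded a g : 0 <= a -> continuous g ->
  exists2 B, 0 <= B & forall x, cube a x -> `|g x| <= B.
Proof.
move=> a0 cg.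
have cne : @cube R n a !=set0 by exists 0 => i; rewrite mxE oppr_le0 a0.
have cgn : {within cube a, continuous (fun y => `|g y|)}.
  apply: continuous_subspaceT => y; apply: continuous_comp; first exact: cg.
  exact: norm_continuous.
have [c cc cm] := EVT_max_rV cne (@cube_compact R n _) cgn.
by exists `|g c| => // y yc; apply: cm; exact: mem_set.
Qed.

(** The modulus of continuity is uniform in phase and frequency, because on bounded frequencies the
    cosine factor is Lipschitz with constant n H in the sup norm. *)
Lemma oscillates_le_cos a H g e : 0 <= a -> 0 <= H -> continuous g -> 0 < e ->
  exists2 d, 0 < d & forall z th, cube H z ->
    oscillates_le a (fun x => g x * cos (th + dotp z x)) d e.
Proof.
move=> a0 H0 cg e0; have [B B0 gB] := cube_bounded a0 cg.
have e2 : 0 < e / 2 by rewrite divr_gt0.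
have [d d0 ho] := oscillates_le_exists a cg e2.
pose q := B * (n%:R * H) + 1.
have q0 : 0 < q by rewrite ltr_wpDl// !mulr_ge0.
exists (Num.min d (e / 2 / q)); first by rewrite lt_min d0 divr_gt0.
move=> z th Hz x y ax ay xy.
have xyd i : `|x ord0 i - y ord0 i| <= d by rewrite (le_trans (xy i))// ge_min lexx.
have xyq i : `|x ord0 i - y ord0 i| <= e / 2 / q by rewrite (le_trans (xy i))// ge_min lexx orbT.
have -> : g x * cos (th + dotp z x) - g y * cos (th + dotp z y) =
  (g x - g y) * cos (th + dotp z x) + g y * (cos (th + dotp z x) - cos (th + dotp z y)) by ring.
rewrite (le_trans (ler_normD _ _))// (splitr e) lerD//.
  rewrite normrM -[leRHS]mulr1; apply: ler_pM => //; [exact: ho|exact: cos_max].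
rewrite normrM; apply: (@le_trans _ _ (B * (n%:R * H * (e / 2 / q)))).
  apply: ler_pM => //; first exact: gB.
  apply: (le_trans (cos_sin_lip _ _).1).
  rewrite opprD addrACA subrr add0r -dotpB /dotp (le_trans (ler_norm_sum _ _ _))//.
  rewrite -mulrA -[X in X%:R]card_ord mulr_natl -sumr_const; apply: ler_sum => i _.
  rewrite normrM !mxE; apply: ler_pM => //; rewrite ler_norml; exact: Hz.
rewrite [leLHS](_ : _ = e / 2 * (B * (n%:R * H) / q)); last by ring.
by rewrite ger_pMr// ler_pdivrMr// mul1r lerDl.
Qed.

(** A single rule handles the real and imaginary parts, all frequencies in the cube, and the product
    with [K]: the same nodes represent the inner transform and return at the end in front of the
    Dirichlet kernel. *)
Lemma uniform_rule a H tau F G K : 0 <= a -> 0 <= H -> 0 < tau ->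
  continuous F -> continuous G -> continuous K ->
  exists r : seq (R * 'rV[R]_n),
  [/\ forall p, p \in r -> 0 <= p.1 /\ cube a p.2, \sum_(p <- r) p.1 = (2 * a) ^+ n,
   forall z th, cube H z ->
    `|cube_int a (fun x => F x * cos (th + dotp z x)) -
      qsum r (fun x => F x * cos (th + dotp z x))| <= tau /\
    `|cube_int a (fun x => G x * cos (th + dotp z x)) -
      qsum r (fun x => G x * cos (th + dotp z x))| <= tau &
   `|cube_int a (fun x => F x * K x) - qsum r (fun x => F x * K x)| <= tau /\
   `|cube_int a (fun x => G x * K x) - qsum r (fun x => G x * K x)| <= tau].
Proof.
move=> a0 H0 tau0 cF cG cK.
pose q := n%:R * (2 * a) ^+ n + 1.
have q0 : 0 < q by rewrite ltr_wpDl// mulr_ge0// exprn_ge0// mulr_ge0.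
pose e := tau / q; have e0 : 0 < e by rewrite divr_gt0.
have [d1 d10 o1] := oscillates_le_cos a0 H0 cF e0.
have [d2 d20 o2] := oscillates_le_cos a0 H0 cG e0.
have cFK := continuous_fctM cF cK; have cGK := continuous_fctM cG cK.
have [d3 d30 o3] := oscillates_le_exists a cFK e0.
have [d4 d40 o4] := oscillates_le_exists a cGK e0.
pose d := Num.min (Num.min d1 d2) (Num.min d3 d4).
have d0 : 0 < d by rewrite !lt_min d10 d20 d30 d40.
have [r [rP rS rE]] := cube_quadrature n a0 d0.
have key g : continuous g -> oscillates_le a g d e -> `|cube_int a g - qsum r g| <= tau.
  move=> cg og; apply: (le_trans (rE g e (ltW e0) cg og)).
  by rewrite /e mulrCA ger_pMr// ler_pdivrMr// mul1r lerDl.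
have cc z th g : continuous g -> continuous (fun x => g x * cos (th + dotp z x)).
  by move=> cg; apply: continuous_fctM => //; exact: continuous_cos_dotp.
exists r; split=> //.
  move=> z th Hz; split; apply: key; try exact: cc.
    by apply: oscillates_leW (o1 _ _ Hz); rewrite !ge_min lexx.
  by apply: oscillates_leW (o2 _ _ Hz); rewrite !ge_min lexx !orbT.
split; apply: key => //.
  by apply: oscillates_leW o3; rewrite !ge_min lexx !orbT.
by apply: oscillates_leW o4; rewrite !ge_min lexx !orbT.
Qed.

(** Multiplication by e^(-i nu.eta), the exponential of the outer transform, shifts x to x - eta in
    the quadrature. Four real errors occur (F and G, each with cosine and sine), and the sines are
    the instances with phase - pi / 2. *)
Lemma rule_shift a F G (r : seq (R * 'rV[R]_n)) eta nu tau : 0 <= a ->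
  continuous F -> continuous G ->
  (forall th, `|cube_int a (fun x => F x * cos (th + dotp nu x)) -
      qsum r (fun x => F x * cos (th + dotp nu x))| <= tau /\
    `|cube_int a (fun x => G x * cos (th + dotp nu x)) -
      qsum r (fun x => G x * cos (th + dotp nu x))| <= tau) ->
  let th := - dotp nu eta in
  let A := cube_int a (fun x => F x * cos (dotp nu x) - G x * sin (dotp nu x)) in
  let B := cube_int a (fun x => F x * sin (dotp nu x) + G x * cos (dotp nu x)) in
  `|A * cos th - B * sin th - qsum r (fun x => F x * cos (dotp nu (x - eta)) -
      G x * sin (dotp nu (x - eta)))| <= 4 * tau /\
  `|A * sin th + B * cos th - qsum r (fun x => F x * sin (dotp nu (x - eta)) +
      G x * cos (dotp nu (x - eta)))| <= 4 * tau.
Proof.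
move=> a0 cF cG H th A B.
have cs x : cos (- (pi / 2) + dotp nu x) = sin (dotp nu x).
  by rewrite addrC cosBpihalf.
have c00 x : cos (0 + dotp nu x) = cos (dotp nu x) by rewrite add0r.
have E00 (g : 'rV[R]_n -> R) : (fun x => g x * cos (0 + dotp nu x)) = (fun x => g x * cos (dotp nu x)).
  by apply/funext => x; rewrite c00.
have Es (g : 'rV[R]_n -> R) : (fun x => g x * cos (- (pi / 2) + dotp nu x)) = (fun x => g x * sin (dotp nu x)).
  by apply/funext => x; rewrite cs.
have ccos g : continuous g -> continuous (fun x => g x * cos (dotp nu x)).
  by move=> cg; rewrite -E00; apply: continuous_fctM => //; exact: continuous_cos_dotp.
have csin g : continuous g -> continuous (fun x => g x * sin (dotp nu x)).
  by move=> cg; rewrite -Es; apply: continuous_fctM => //; exact: continuous_cos_dotp.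
have := H 0; rewrite !E00 => -[]; have := H (- (pi / 2)); rewrite !Es => -[].
rewrite /A /B cube_intB//; try exact: ccos; try exact: csin.
have -> : cube_int a (fun x => F x * sin (dotp nu x) + G x * cos (dotp nu x)) =
   cube_int a (fun x => F x * sin (dotp nu x)) + cube_int a (fun x => G x * cos (dotp nu x)).
  rewrite -[in RHS](mul1r (cube_int a (fun x => F x * sin (dotp nu x)))) -cube_int_lin//; [|exact: csin|exact: ccos].
  by congr cube_int; apply/funext => x; rewrite mul1r.
set IFs := cube_int a _; set QFs := qsum r _; set IGs := cube_int a _; set QGs := qsum r _.
set IFc := cube_int a _; set QFc := qsum r _; set IGc := cube_int a _; set QGc := qsum r _.
move=> h1 h2 h3 h4.
have thE x : dotp nu (x - eta) = dotp nu x + th by rewrite dotpB.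
have -> : qsum r (fun x => F x * cos (dotp nu (x - eta)) - G x * sin (dotp nu (x - eta))) =
   (QFc - QGs) * cos th - (QFs + QGc) * sin th.
  rewrite /QFc /QGs /QFs /QGc /qsum -sumrB -big_split /= !mulr_suml -sumrB.
  by apply: eq_bigr => p _; rewrite thE cosD sinD; ring.
have -> : qsum r (fun x => F x * sin (dotp nu (x - eta)) + G x * cos (dotp nu (x - eta))) =
   (QFc - QGs) * sin th + (QFs + QGc) * cos th.
  rewrite /QFc /QGs /QFs /QGc /qsum -sumrB -big_split /= !mulr_suml -big_split.
  by apply: eq_bigr => p _; rewrite /= thE cosD sinD; ring.
have bnd (u v : R) : `|u| <= 1 -> `|v| <= tau -> `|v * u| <= tau.
  by move=> u1 vt; rewrite normrM -[leRHS]mulr1; apply: ler_pM.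
have C1 : `|cos th| <= 1 := cos_max _; have S1 : `|sin th| <= 1 := sin_max _.
have N1 (u : R) : `|u| <= 1 -> `|- u| <= 1 by rewrite normrN.
have four (u1 u2 u3 u4 : R) : `|u1| <= tau -> `|u2| <= tau -> `|u3| <= tau -> `|u4| <= tau ->
    `|u1 + u2 + u3 + u4| <= 4 * tau.
  rewrite !ler_norml => /andP[? ?] /andP[? ?] /andP[? ?] /andP[? ?].
  by apply/andP; split; lra.
split.
  rewrite [X in `|X|](_ : _ = (IFc - QFc) * cos th + (IGs - QGs) * (- cos th) +
     (IFs - QFs) * (- sin th) + (IGc - QGc) * (- sin th)); last by ring.
  by apply: four; apply: bnd => //; exact: N1.
rewrite [X in `|X|](_ : _ = (IFc - QFc) * sin th + (IGs - QGs) * (- sin th) +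
     (IFs - QFs) * cos th + (IGc - QGc) * cos th); last by ring.
by apply: four; apply: bnd => //; exact: N1.
Qed.

End Rule.

(** * Defining nets of exponential products and trigonometric sums *)

Section Nets.
Context {R : realType}.
Variables (sigma : gauge R) (n : nat).
Implicit Types (z : 'rV[R]_n) (b : bool).

Lemma trig_cos1 z : trig [:: (1, 0, z)] = fun x => cos (dotp z x).
Proof. by apply/funext => x; rewrite trig_cons trig_nil mul1r add0r addr0. Qed.

Lemma trig_sin1 z : trig [:: (1, - (pi / 2), z)] = fun x => sin (dotp z x).
Proof. by apply/funext => x; rewrite trig_cons trig_nil mul1r addr0 addrC cosBpihalf. Qed.

Lemma smooth_cos_dotp z : smooth (fun x : 'rV[R]_n => cos (dotp z x)).
Proof. rewrite -trig_cos1; exact: smooth_trig. Qed.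

Lemma smooth_sin_dotp z : smooth (fun x : 'rV[R]_n => sin (dotp z x)).
Proof. rewrite -trig_sin1; exact: smooth_trig. Qed.

Lemma psum_moderate (r : seq 'I_n) (G : R -> 'rV[R]_n -> R) (u : R -> 'rV[R]_n) :
  (forall t, subseq t (rev r) -> is_moderate sigma (fun e => partials t (G e) (u e))) ->
  is_moderate sigma (fun e => psum r (G e) (u e)).
Proof.
elim: r G => [|i r IH] G H /=; first by apply: moderate_norm; exact: (H [::]).
apply: moderateD; apply: IH => t tr.
  by apply: H; rewrite rev_cons; apply: subseq_trans tr (subseq_rcons _ _).
rewrite (_ : (fun _ => _) = fun e => partials (rcons t i) (G e) (u e)).
  by apply: H; rewrite rev_cons -!cats1; apply: cat_subseq.
by apply/funext => e; rewrite partials_rcons.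
Qed.

Lemma vrepresents_moderate (u : R -> 'rV[R]_n) (x : 'rV[gR sigma]_n) :
  vrepresents u x -> is_moderate sigma (fun e => \sum_i `|u e ord0 i|).
Proof.
move=> ux; apply: (gclass_sum (fun i => moderate_norm (ux i).1)).1.
Qed.

Lemma coord_le_sum (z : 'rV[R]_n) i : `|z ord0 i| <= \sum_j `|z ord0 j|.
Proof. by rewrite (bigD1 i)//= lerDl sumr_ge0. Qed.

(** The Leibniz bound involves the derivatives of G along all subsequences of [s], hence the
    quantification over them. *)
Lemma moderate_partialsM s (G : R -> 'rV[R]_n -> R) c th (nu u : R -> 'rV[R]_n) (w : 'rV[gR sigma]_n) :
  (forall e, 0 < e <= 1 -> smooth (G e)) ->
  vrepresents nu w ->
  (forall t, subseq t s -> is_moderate sigma (fun e => partials t (G e) (u e))) ->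
  is_moderate sigma (fun e => partials s (fun y => G e y * trig [:: (c, th, nu e)] y) (u e)).
Proof.
move=> sG nuw H.
have M1 : is_moderate sigma (fun e => psum (rev s) (G e) (u e)).
  by apply: psum_moderate => t; rewrite revK; exact: H.
have M2 : is_moderate sigma (fun e => `|c| * (1 + \sum_i `|nu e ord0 i|) ^+ size (rev s)).
  apply: moderateM; first exact: moderate_cst.
  apply: moderateX; apply: moderateD; first exact: moderate_cst.
  exact: vrepresents_moderate nuw.
apply: moderate_le (moderateM M1 M2) _; near=> e.
have e01 : 0 < e <= 1 by near: e; exact: near_01.
apply: (le_trans (normr_partialsM s (u e) (sG e e01) (smooth_trig _))).
rewrite [leRHS]ger0_norm; last first.
  rewrite mulr_ge0 ?psum_ge0// mulr_ge0// exprn_ge0// addr_ge0//.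
  by apply: sumr_ge0.
apply: ler_wpM2l; first exact: psum_ge0.
have := @psum_trig_le R n (rev s) [:: (c, th, nu e)] (\sum_i `|nu e ord0 i|) (u e).
rewrite big_seq1 /=; apply; first by apply: sumr_ge0.
by move=> p; rewrite inE => /eqP -> i /=; exact: coord_le_sum.
Unshelve. all: by end_near. Qed.

(* the net [F_e(x) e^{i x . nu_e}] *)
Definition expnet (F : R -> 'rV[R]_n -> R[i]) (nu : R -> 'rV[R]_n) e (x : 'rV[R]_n) : R[i] :=
  ((reC (F e x) * cos (dotp (nu e) x) - imC (F e x) * sin (dotp (nu e) x)) +i*
   (reC (F e x) * sin (dotp (nu e) x) + imC (F e x) * cos (dotp (nu e) x)))%C.

Lemma defining_net_exp X (f : 'rV[gR sigma]_n -> gC sigma) F nu w :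
  defining_net X f F -> vrepresents nu w ->
  defining_net X (fun x => gmul (f x) (gexpi (gdot x w))) (expnet F nu).
Proof.
move=> FP nuw; have [Fs FM] := FP.
have sr e : 0 < e <= 1 -> smooth (fun y => reC (F e y)) by move=> /Fs[].
have si e : 0 < e <= 1 -> smooth (fun y => imC (F e y)) by move=> /Fs[].
split.
  move=> e e01; have h1 := sr e e01; have h2 := si e e01.
  have sc := smooth_cos_dotp (nu e); have ss := smooth_sin_dotp (nu e).
  split; first exact: smoothB (smoothM h1 sc) (smoothM h2 ss).
  exact: smoothD (smoothM h1 ss) (smoothM h2 sc).
move=> x u Xx ux; have [fx _] := FM x u Xx ux; split.
  have [m1 m2] := defining_net_moderate FP Xx ux (@multi_index_seq0 n).
  rewrite fx (gexpi_represents (gdot_represents ux nuw)) /gCclass.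
  rewrite gmul_gclass//; [exact: moderate_cos|exact: moderate_sin].
move=> alpha; apply/cmoderateP.
set s := multi_index_seq alpha.
have Mr t : subseq t s -> is_moderate sigma (fun e => partials t (fun y => reC (F e y)) (u e)).
  by move=> /subseq_multi_index[beta /esym/(defining_net_moderate FP Xx ux)[]].
have Mi t : subseq t s -> is_moderate sigma (fun e => partials t (fun y => imC (F e y)) (u e)).
  by move=> /subseq_multi_index[beta /esym/(defining_net_moderate FP Xx ux)[]].
have rc := moderate_partialsM 1 0 sr nuw Mr.
have rs := moderate_partialsM 1 (- (pi / 2)) sr nuw Mr.
have ic := moderate_partialsM 1 0 si nuw Mi.
have is_ := moderate_partialsM 1 (- (pi / 2)) si nuw Mi.
split.
  apply: moderate_le (moderateB rc is_) _; near=> e.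
  have e01 : 0 < e <= 1 by near: e; exact: near_01.
  have h1 := sr e e01; have h2 := si e e01.
  rewrite /cpartial /= -/s trig_cos1 trig_sin1.
  by rewrite (partialsB s (smoothM h1 (smooth_cos_dotp (nu e))) (smoothM h2 (smooth_sin_dotp (nu e)))).
apply: moderate_le (moderateD rs ic) _; near=> e.
have e01 : 0 < e <= 1 by near: e; exact: near_01.
have h1 := sr e e01; have h2 := si e e01.
rewrite /cpartial /= -/s trig_cos1 trig_sin1.
by rewrite (partialsD s (smoothM h1 (smooth_sin_dotp (nu e))) (smoothM h2 (smooth_cos_dotp (nu e)))).
Unshelve. all: by end_near. Qed.

Lemma real_complex_gclass c : real_complex (gR sigma) (gclass sigma (cst c)) =
  (gclass sigma (cst c) +i* gclass sigma (fun=> 0))%C.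
Proof. by rewrite gclass0. Qed.

Lemma defining_netZ X (f : 'rV[gR sigma]_n -> gC sigma) F c :
  defining_net X f F ->
  defining_net X (fun x => gmul (real_complex _ (gclass sigma (cst c))) (f x))
    (fun e x => ((c * reC (F e x)) +i* (c * imC (F e x)))%C).
Proof.
move=> FP; have [Fs FM] := FP; split.
  move=> e e01; have [h1 h2] := Fs e e01.
  by split; apply: smoothM (smooth_cst c) _.
have cM : is_moderate sigma (cst c) := moderate_cst sigma c.
move=> x u Xx ux; have [fx _] := FM x u Xx ux; split.
  have [m1 m2] := defining_net_moderate FP Xx ux (@multi_index_seq0 n).
  rewrite fx /gCclass real_complex_gclass gmul_gclass//; last exact: moderate_cst.
  congr (_ +i* _)%C; congr gclass; apply/funext => e /=; first by rewrite mul0r subr0.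
  by rewrite mul0r addr0.
move=> alpha; have [m1 m2] := defining_net_moderate FP Xx ux (erefl (multi_index_seq alpha)).
apply/cmoderateP; split.
  apply: moderate_le (moderateM cM m1) _; near=> e.
  have e01 : 0 < e <= 1 by near: e; exact: near_01.
  by have [h1 h2] := Fs e e01; rewrite /cpartial /= (partialsZ _ _ h1).
apply: moderate_le (moderateM cM m2) _; near=> e.
have e01 : 0 < e <= 1 by near: e; exact: near_01.
by have [h1 h2] := Fs e e01; rewrite /cpartial /= (partialsZ _ _ h2).
Unshelve. all: by end_near. Qed.

(** In F_h(F_k^-1 f) the constant (2 pi)^-n stands inside the outer integral and has to be pulled
    out. *)
Lemma gintZ (k : gR sigma) (f : 'rV[gR sigma]_n -> gC sigma) F c :
  (\forall e \near 0^'+, 0 < repr_net k e) ->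
  defining_net (gcube k) f F ->
  gint k (fun x => gmul (real_complex _ (gclass sigma (cst c))) (f x)) =
  gmul (real_complex _ (gclass sigma (cst c))) (gint k f).
Proof.
move=> k0 FP; rewrite (gint_defining_net k0 FP) (gint_defining_net k0 (defining_netZ c FP)).
have [Fs FM] := FP.
have cr e : 0 < e <= 1 -> continuous (fun y => reC (F e y)).
  by move=> /Fs[h _]; exact: smooth_continuous h.
have ci e : 0 < e <= 1 -> continuous (fun y => imC (F e y)).
  by move=> /Fs[_ h]; exact: smooth_continuous h.
have mr : is_moderate sigma (fun e => cube_int (repr_net k e) (fun y => reC (F e y))).
  apply: (moderate_cube_int k0 cr) => x u kx ux.
  by have [] := defining_net_moderate FP kx ux (@multi_index_seq0 n).
have mi : is_moderate sigma (fun e => cube_int (repr_net k e) (fun y => imC (F e y))).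
  apply: (moderate_cube_int k0 ci) => x u kx ux.
  by have [] := defining_net_moderate FP kx ux (@multi_index_seq0 n).
have M := gmul_gclass (moderate_cst sigma c) (moderate_cst sigma 0) mr mi.
rewrite real_complex_gclass; apply: etrans (esym M); rewrite /gCclass.
congr (_ +i* _)%C; apply: gclass_near; near=> e.
  have e01 : 0 < e <= 1 by near: e; exact: near_01.
  have ke : 0 < repr_net k e by near: e.
  rewrite mul0r subr0; apply: cube_intZ; [exact: ltW|exact: cr].
have e01 : 0 < e <= 1 by near: e; exact: near_01.
have ke : 0 < repr_net k e by near: e.
rewrite mul0r addr0; apply: cube_intZ; [exact: ltW|exact: ci].
Unshelve. all: by end_near. Qed.

(* [b] selects the sign of the exponent, to treat both compositions at once *)
Definition signed (V : zmodType) b (x : V) : V := if b then - x else x.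

(** Exchanges the roles of the variables: a node x of the rule becomes the frequency x - eta, up to
    sign, of a trigonometric sum in w, with amplitude the weight times G(x). *)
Definition nodes b (r : seq (R * 'rV[R]_n)) (G : 'rV[R]_n -> R) (th : R)
    (eta : 'rV[R]_n) : seq (R * R * 'rV[R]_n) :=
  [seq (p.1 * G p.2, th, signed b (p.2 - eta)) | p : R * 'rV[R]_n <- r].

Lemma dotp_signed b z (x : 'rV[R]_n) : dotp (signed b z) x = dotp (signed b x) z.
Proof.
rewrite /signed; case: b; last exact: dotpC.
by rewrite dotpC dotpN [RHS]dotpC dotpN dotpC.
Qed.

Lemma trig_nodes b r G th eta nu :
  trig (nodes b r G th eta) nu = qsum r (fun x => G x * cos (th + dotp (signed b nu) (x - eta))).
Proof.
rewrite /trig /nodes big_map; apply: eq_bigr => p _ /=.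
by rewrite dotp_signed mulrA.
Qed.

End Nets.

Definition re_net (R : realType) n (F : R -> 'rV[R]_n -> R[i]) e x : R := reC (F e x).
Definition im_net (R : realType) n (F : R -> 'rV[R]_n -> R[i]) e x : R := imC (F e x).
Definition sinq_kernel (R : realType) n (h : R) (eta x : 'rV[R]_n) : R :=
  \prod_i sinq h (x ord0 i - eta ord0 i).

(** * The double transform as a trigonometric sum *)

Section Composition.
Context {R : realType}.
Variables (sigma : gauge R) (n : nat) (k h : gR sigma).
Variables (f : 'rV[gR sigma]_n -> gC sigma) (F : R -> 'rV[R]_n -> R[i]).
Hypothesis FP : defining_net (gcube k) f F.
Hypothesis k_gt0 : \forall e \near 0^'+, 0 < repr_net k e.
Hypothesis h_gt0 : \forall e \near 0^'+, 0 < repr_net h e.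
Variables (y : 'rV[gR sigma]_n) (eta : R -> 'rV[R]_n).
Hypothesis eta_y : vrepresents eta y.

Local Notation kp := (repr_net k).
Local Notation hp := (repr_net h).
Local Notation Fr := (re_net F).
Local Notation Fi := (im_net F).
Local Notation kernel e := (sinq_kernel (hp e) (eta e)).

(** Accuracy is required on the cube of half-width h + 1 because a representative of a point of
    [gcube h] may slightly leave the cube given by the chosen representative of h. *)
Lemma near_sinq_rule : exists (r : R -> seq (R * 'rV[R]_n)) (tau : R -> R), [/\
   null sigma tau,
   \forall e \near 0^'+, forall p, p \in r e -> 0 <= p.1 /\ cube (kp e) p.2,
   \forall e \near 0^'+, \sum_(p <- r e) p.1 = (2 * kp e) ^+ n,
   \forall e \near 0^'+, forall z th, cube (hp e + 1) z ->
    `|cube_int (kp e) (fun x => Fr e x * cos (th + dotp z x)) -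
      qsum (r e) (fun x => Fr e x * cos (th + dotp z x))| <= tau e /\
    `|cube_int (kp e) (fun x => Fi e x * cos (th + dotp z x)) -
      qsum (r e) (fun x => Fi e x * cos (th + dotp z x))| <= tau e &
   \forall e \near 0^'+,
    `|cube_int (kp e) (fun x => Fr e x * kernel e x) - qsum (r e) (fun x => Fr e x * kernel e x)| <= tau e /\
    `|cube_int (kp e) (fun x => Fi e x * kernel e x) - qsum (r e) (fun x => Fi e x * kernel e x)| <= tau e].
Proof.
(* An explicit tolerance: positive for e in (0, 1], as [uniform_rule] requires, and eventually below
   each power of sigma because the exponent tends to infinity. *)
pose tau e := sigma e ^+ Num.truncn (sigma e)^-1.
have [Fs _] := FP.
have tau0 : null sigma tau.
  move=> m; have m0 : 0 < (m.+1%:R : R)^-1 by rewrite invr_gt0.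
  apply: filterS2 (near_gauge sigma) (near_gauge_lt sigma m0) => e /andP[s0 s1] sm.
  rewrite /tau ger0_norm ?exprn_ge0 ?(ltW s0)//.
  apply: ler_wiXn2l; [exact: ltW|exact: s1|].
  rewrite truncn_ge_nat ?invr_ge0 ?(ltW s0)//.
  apply: (@le_trans _ _ m.+1%:R); first by rewrite ler_nat.
  by rewrite -[leLHS]invrK lef_pV2 ?posrE ?invr_gt0// ltW.
have /choice[r rP] : forall e, exists r : seq (R * 'rV[R]_n), 0 < e <= 1 -> 0 < kp e -> 0 < hp e -> [/\
   forall p, p \in r -> 0 <= p.1 /\ cube (kp e) p.2,
   \sum_(p <- r) p.1 = (2 * kp e) ^+ n,
   forall z th, cube (hp e + 1) z ->
    `|cube_int (kp e) (fun x => Fr e x * cos (th + dotp z x)) -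
      qsum r (fun x => Fr e x * cos (th + dotp z x))| <= tau e /\
    `|cube_int (kp e) (fun x => Fi e x * cos (th + dotp z x)) -
      qsum r (fun x => Fi e x * cos (th + dotp z x))| <= tau e &
   `|cube_int (kp e) (fun x => Fr e x * kernel e x) - qsum r (fun x => Fr e x * kernel e x)| <= tau e /\
   `|cube_int (kp e) (fun x => Fi e x * kernel e x) - qsum r (fun x => Fi e x * kernel e x)| <= tau e].
  move=> e; have [e01|] := pselect (0 < e <= 1); last by exists [::].
  have [ke|] := pselect (0 < kp e); last by exists [::].
  have [he|] := pselect (0 < hp e); last by exists [::].
  have /andP[s0 _] := gauge_itv sigma e01.
  have [sr si] := Fs e e01.
  have h1 : 0 <= hp e + 1 by rewrite addr_ge0// ltW.
  have t0 : 0 < tau e by rewrite exprn_gt0.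
  have [r [? ? ? ?]] := uniform_rule (ltW ke) h1 t0 (smooth_continuous sr)
    (smooth_continuous si) (@continuous_prod_sinq R n (hp e) (eta e)).
  by exists r.
have small : \forall e \near 0^'+, [/\ 0 < e <= 1, 0 < kp e & 0 < hp e].
  by near=> e; split; near: e => //; exact: near_01.
exists r, tau; split; first exact: tau0.
- by apply: filterS small => e [e01 ke he]; have [] := rP e e01 ke he.
- by apply: filterS small => e [e01 ke he]; have [] := rP e e01 ke he.
- by apply: filterS small => e [e01 ke he]; have [] := rP e e01 ke he.
- by apply: filterS small => e [e01 ke he]; have [] := rP e e01 ke he.
Unshelve. all: by end_near. Qed.

Variables (r : R -> seq (R * 'rV[R]_n)) (tau : R -> R).
Hypothesis tau_null : null sigma tau.
Hypothesis rP : \forall e \near 0^'+, forall p, p \in r e -> 0 <= p.1 /\ cube (kp e) p.2.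
Hypothesis rS : \forall e \near 0^'+, \sum_(p <- r e) p.1 = (2 * kp e) ^+ n.
Hypothesis rE : \forall e \near 0^'+, forall z th, cube (hp e + 1) z ->
    `|cube_int (kp e) (fun x => Fr e x * cos (th + dotp z x)) -
      qsum (r e) (fun x => Fr e x * cos (th + dotp z x))| <= tau e /\
    `|cube_int (kp e) (fun x => Fi e x * cos (th + dotp z x)) -
      qsum (r e) (fun x => Fi e x * cos (th + dotp z x))| <= tau e.

(** The quadrature of f(x) e^(i w.(x - eta)), with the sign of w reversed for b = true; the phase -
    pi / 2 encodes the sine. Written with [trig], its derivatives and its integral over a cube are
    available in closed form. *)
Definition quad_net b e (w : 'rV[R]_n) : R[i] :=
  (trig (nodes b (r e) (Fr e) 0 (eta e) ++
         nodes b (r e) (fun x => - Fi e x) (- (pi / 2)) (eta e)) w +i*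
   trig (nodes b (r e) (Fr e) (- (pi / 2)) (eta e) ++
         nodes b (r e) (Fi e) 0 (eta e)) w)%C.

Let Fr_sup : exists2 B, is_moderate sigma B &
   \forall e \near 0^'+, forall x, cube (kp e) x -> `|Fr e x| <= B e.
Proof.
apply: (cube_sup_moderate k_gt0); first by move=> e /FP.1[s _]; exact: smooth_continuous s.
by move=> x u kx ux; have [] := defining_net_moderate FP kx ux (@multi_index_seq0 n).
Qed.

Let Fi_sup : exists2 B, is_moderate sigma B &
   \forall e \near 0^'+, forall x, cube (kp e) x -> `|Fi e x| <= B e.
Proof.
apply: (cube_sup_moderate k_gt0); first by move=> e /FP.1[_ s]; exact: smooth_continuous s.
by move=> x u kx ux; have [] := defining_net_moderate FP kx ux (@multi_index_seq0 n).
Qed.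

(** The total amplitude is at most B (2 k)^n and each frequency is at most |k| + sum_i |eta_i|, so
    the bound does not involve the number of nodes. *)
Let nodes_moderate b (G : R -> 'rV[R]_n -> R) th B (u : R -> 'rV[R]_n) s :
  is_moderate sigma B ->
  (\forall e \near 0^'+, forall x, cube (kp e) x -> `|G e x| <= B e) ->
  is_moderate sigma (fun e => partials s (trig (nodes b (r e) (G e) th (eta e))) (u e)).
Proof.
move=> BM GB.
pose beta e := `|kp e| + \sum_i `|eta e ord0 i|.
have bM : is_moderate sigma beta.
  apply: moderateD; first exact: moderate_norm (moderate_repr k).
  exact: vrepresents_moderate eta_y.
have M := moderateM (moderateM BM (moderateX n (moderateM (moderate_cst sigma 2) (moderate_repr k))))
   (moderateX (size s) bM).
apply: moderate_le M _; near=> e.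
have ke : 0 < kp e by near: e.
have b0 : 0 <= beta e by rewrite addr_ge0// sumr_ge0.
have GBe : forall x, cube (kp e) x -> `|G e x| <= B e by near: e.
have B0 : 0 <= B e.
  by apply: le_trans (GBe 0 _) => // i; rewrite mxE oppr_le0 ltW.
rewrite [leRHS]ger0_norm ?mulr_ge0 ?exprn_ge0 ?mulr_ge0 ?(ltW ke)//.
have rPe : forall p, p \in r e -> 0 <= p.1 /\ cube (kp e) p.2 by near: e.
apply: (le_trans (@normr_partials_trig R n s _ (beta e) (u e) b0 _)).
  move=> _ /mapP[p /rPe[_ pk] ->] i /=.
  have H : `|(p.2 - eta e) ord0 i| <= beta e.
    rewrite !mxE (le_trans (ler_normB _ _))// lerD ?coord_le_sum//.
    by rewrite (le_trans _ (ler_norm _))// ler_norml; exact: pk.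
  by rewrite /signed; case: b => //; rewrite mxE normrN.
rewrite ler_wpM2r ?exprn_ge0// big_map.
rewrite -[X in _ <= B e * X](_ : \sum_(p <- r e) p.1 = _); last by near: e.
rewrite mulr_sumr big_seq [leRHS]big_seq; apply: ler_sum => p pr /=.
have [p0 pk] := rPe p pr.
rewrite normrM (ger0_norm p0) mulrC; apply: ler_wpM2r => //.
exact: GBe.
Unshelve. all: by end_near. Qed.

Let trig_catE L1 L2 (x : 'rV[R]_n) : trig (L1 ++ L2) x = trig L1 x + trig L2 x.
Proof. by rewrite /trig big_cat. Qed.

Let trig_catF (L1 L2 : seq (R * R * 'rV[R]_n)) : trig (L1 ++ L2) = fun x => trig L1 x + trig L2 x.
Proof. by apply/funext => x; exact: trig_catE. Qed.

Let quad_net_moderate b (u : R -> 'rV[R]_n) s :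
  is_moderate sigma (fun e => partials s (fun x => reC (quad_net b e x)) (u e)) /\
  is_moderate sigma (fun e => partials s (fun x => imC (quad_net b e x)) (u e)).
Proof.
have [Br BrM FrB] := Fr_sup; have [Bi BiM FiB] := Fi_sup.
have FiB' : \forall e \near 0^'+, forall x, cube (kp e) x -> `|- Fi e x| <= Bi e.
  by apply: filterS FiB => e H x /H; rewrite normrN.
split.
  have M := moderateD (nodes_moderate b 0 u s BrM FrB)
    (@nodes_moderate b (fun e x => - Fi e x) (- (pi / 2)) Bi u s BiM FiB').
  apply: moderate_le M _; apply: nearW => e.
  by rewrite /quad_net /= trig_catF (partialsD s (smooth_trig _) (smooth_trig _)).
have M := moderateD (nodes_moderate b (- (pi / 2)) u s BrM FrB) (nodes_moderate b 0 u s BiM FiB).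
apply: moderate_le M _; apply: nearW => e.
by rewrite /quad_net /= trig_catF (partialsD s (smooth_trig _) (smooth_trig _)).
Qed.

Lemma quad_netE b e w :
  quad_net b e w =
  (qsum (r e) (fun x => Fr e x * cos (dotp (signed b w) (x - eta e)) -
      Fi e x * sin (dotp (signed b w) (x - eta e))) +i*
   qsum (r e) (fun x => Fr e x * sin (dotp (signed b w) (x - eta e)) +
      Fi e x * cos (dotp (signed b w) (x - eta e))))%C.
Proof.
rewrite /quad_net !trig_catE !trig_nodes /qsum -!big_split /=.
congr (_ +i* _)%C; apply: eq_bigr => p _; rewrite !add0r [- (pi / 2) + _]addrC cosBpihalf; ring.
Qed.

Lemma vrepresents_signed b (u : R -> 'rV[R]_n) (x : 'rV[gR sigma]_n) :
  vrepresents u x -> vrepresents (fun e => signed b (u e)) (signed b x).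
Proof. by case: b => //; exact: vrepresentsN. Qed.

Lemma gcube_vrepresents (u : R -> 'rV[R]_n) (x : 'rV[gR sigma]_n) : gcube h x -> vrepresents u x ->
  \forall e \near 0^'+, cube (hp e + 1) (u e).
Proof.
move=> hx ux; apply: filter_forall => i; have [h1 h2] := hx i.
have H1 := gle_bound h1 (representsN (represents_repr h)) (ux i) 0.
have H2 := gle_bound h2 (ux i) (represents_repr h) 0.
near=> e; have : - repr_net h e <= u e ord0 i + sigma e ^+ 0 by near: e.
have : u e ord0 i <= repr_net h e + sigma e ^+ 0 by near: e.
by rewrite expr0 => ? ?; apply/andP; split; lra.
Unshelve. all: by end_near. Qed.

(** At each point of [gcube h] the sum differs from the inner integral times the outer exponential
    by at most 4 tau, which is negligible. Thus the sum is a defining net of the outer integrand,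
    and the moderateness of its derivatives is read off from the sum. *)
Lemma defining_net_quad b : defining_net (gcube h)
  (fun w => gmul (gint k (fun x => gmul (f x) (gexpi (gdot x (signed b w)))))
                 (gexpi (gdot y (signed (~~ b) w)))) (quad_net b).
Proof.
split; first by move=> e _; split; exact: smooth_trig.
move=> w nu hw nuw; split; last first.
  by move=> alpha; apply/cmoderateP; exact: quad_net_moderate.
have nuw' := vrepresents_signed b nuw.
have EP := defining_net_exp FP nuw'.
rewrite (gint_defining_net k_gt0 EP).
(* The outer exponential carries the opposite sign, which gives the phase [th] of [rule_shift]. *)
have th_rep : represents (fun e => - dotp (signed b (nu e)) (eta e)) (gdot y (signed (~~ b) w)).
  have [M <-] := gdot_represents eta_y (vrepresents_signed (~~ b) nuw).
  have E : (fun e => dotp (signed (~~ b) (nu e)) (eta e)) = (fun e => - dotp (signed b (nu e)) (eta e)).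
    have dNp (z x : 'rV[R]_n) : dotp (- z) x = - dotp z x by rewrite dotpC dotpN dotpC.
    by apply/funext => e; rewrite /signed; case: (b) => /=; rewrite dNp ?opprK.
  by rewrite -E.
rewrite (gexpi_represents th_rep).
have cr e : 0 < e <= 1 -> continuous (Fr e) by move=> /FP.1[s _]; exact: smooth_continuous s.
have ci e : 0 < e <= 1 -> continuous (Fi e) by move=> /FP.1[_ s]; exact: smooth_continuous s.
have cE e : 0 < e <= 1 -> continuous (fun x => reC (expnet F (fun e => signed b (nu e)) e x)) /\
    continuous (fun x => imC (expnet F (fun e => signed b (nu e)) e x)).
  by move=> /EP.1[h1 h2]; split; [exact: smooth_continuous h1|exact: smooth_continuous h2].
have mA : is_moderate sigma (fun e => cube_int (kp e) (fun x => reC (expnet F (fun e => signed b (nu e)) e x))).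
  apply: (moderate_cube_int k_gt0 (fun e e01 => (cE e e01).1)) => x u kx ux.
  by have [] := defining_net_moderate EP kx ux (@multi_index_seq0 n).
have mB : is_moderate sigma (fun e => cube_int (kp e) (fun x => imC (expnet F (fun e => signed b (nu e)) e x))).
  apply: (moderate_cube_int k_gt0 (fun e e01 => (cE e e01).2)) => x u kx ux.
  by have [] := defining_net_moderate EP kx ux (@multi_index_seq0 n).
have M := gmul_gclass mA mB (moderate_cos sigma (fun e => - dotp (signed b (nu e)) (eta e)))
   (moderate_sin sigma (fun e => - dotp (signed b (nu e)) (eta e))).
apply: etrans M _; rewrite /gCclass.
have N4 : null sigma (fun e => 4 * tau e) by apply: nullM => //; exact: moderate_cst.
have key : \forall e \near 0^'+,
   let th := - dotp (signed b (nu e)) (eta e) in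
   let A := cube_int (kp e) (fun x => reC (expnet F (fun e => signed b (nu e)) e x)) in
   let B := cube_int (kp e) (fun x => imC (expnet F (fun e => signed b (nu e)) e x)) in
   `|A * cos th - B * sin th - reC (quad_net b e (nu e))| <= 4 * tau e /\
   `|A * sin th + B * cos th - imC (quad_net b e (nu e))| <= 4 * tau e.
  have hnu := gcube_vrepresents hw nuw.
  near=> e.
  have e01 : 0 < e <= 1 by near: e; exact: near_01.
  have ke : 0 < kp e by near: e.
  have H : cube (hp e + 1) (signed b (nu e)).
    have : cube (hp e + 1) (nu e) by near: e.
    by rewrite /signed; case: (b) => // H i; rewrite mxE -ler_norml normrN ler_norml; exact: H.
  have rEe : forall z th, cube (hp e + 1) z ->
    `|cube_int (kp e) (fun x => Fr e x * cos (th + dotp z x)) -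
      qsum (r e) (fun x => Fr e x * cos (th + dotp z x))| <= tau e /\
    `|cube_int (kp e) (fun x => Fi e x * cos (th + dotp z x)) -
      qsum (r e) (fun x => Fi e x * cos (th + dotp z x))| <= tau e by near: e.
  have [] := rule_shift (eta e) (ltW ke) (cr e e01) (ci e e01) (fun th => rEe _ th H).
  by rewrite quad_netE => k1 k2; split; [exact: k1|exact: k2].
congr (_ +i* _)%C; apply: gclass_eq; apply: null_le N4 _; apply: filterS key => e [k1 k2].
  exact: le_trans k1 (ler_norm _).
exact: le_trans k2 (ler_norm _).
Unshelve. all: by end_near. Qed.

(** The right side is independent of [b] because [sinq] is even: this is the equality of the two
    compositions. The terms of phase - pi / 2 integrate to 0, as cos (- pi / 2) = 0. *)
Lemma gint_quad b :
  gint h (fun w => gmul (gint k (fun x => gmul (f x) (gexpi (gdot x (signed b w)))))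
                 (gexpi (gdot y (signed (~~ b) w)))) =
  (gclass sigma (fun e => 2 ^+ n * qsum (r e) (fun x => Fr e x * kernel e x)) +i*
   gclass sigma (fun e => 2 ^+ n * qsum (r e) (fun x => Fi e x * kernel e x)))%C.
Proof.
rewrite (gint_defining_net h_gt0 (defining_net_quad b)) /gCclass /ccube_int /=.
have sE (e : R) (p : R * 'rV[R]_n) : \prod_i (2 * sinq (hp e) ((signed b (p.2 - eta e)) ord0 i)) =
    2 ^+ n * kernel e p.2.
  rewrite big_split /= prodr_const card_ord; congr (_ * _); apply: eq_bigr => i _.
  by rewrite /signed; case: b; rewrite !mxE ?sinqN.
have c0 : cos (- (pi / 2)) = 0 :> R by rewrite cosN cos_pihalf.
congr (_ +i* _)%C; apply: gclass_near; near=> e.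
  have he : 0 < hp e by near: e.
  rewrite cube_int_trig ?ltW// big_cat /= !big_map /= [X in _ + X]big1 ?addr0; last first.
    by move=> p _; rewrite c0 mul0r mulr0.
  by rewrite /qsum mulr_sumr; apply: eq_bigr => p _; rewrite sE cos0; ring.
have he : 0 < hp e by near: e.
rewrite cube_int_trig ?ltW// big_cat /= !big_map /= [X in X + _]big1 ?add0r; last first.
  by move=> p _; rewrite c0 mul0r mulr0.
by rewrite /qsum mulr_sumr; apply: eq_bigr => p _; rewrite sE cos0; ring.
Unshelve. all: by end_near. Qed.

Lemma moderate_qsum : is_moderate sigma (fun e => 2 ^+ n * qsum (r e) (fun x => Fr e x * kernel e x)) /\
  is_moderate sigma (fun e => 2 ^+ n * qsum (r e) (fun x => Fi e x * kernel e x)).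
Proof.
have [Br BrM FrB] := Fr_sup; have [Bi BiM FiB] := Fi_sup.
have key (G : R -> 'rV[R]_n -> R) B : is_moderate sigma B ->
   (\forall e \near 0^'+, forall x, cube (kp e) x -> `|G e x| <= B e) ->
   is_moderate sigma (fun e => 2 ^+ n * qsum (r e) (fun x => G e x * kernel e x)).
  move=> BM GB; apply: moderateM; first exact: moderate_cst.
  have M := moderateM (moderateX n (moderateM (moderate_cst sigma 2) (moderate_repr k)))
    (moderateM BM (moderateX n (moderate_repr h))).
  apply: moderate_le M _; near=> e.
  have ke : 0 < kp e by near: e.
  have he : 0 < hp e by near: e.
  have GBe : forall x, cube (kp e) x -> `|G e x| <= B e by near: e.
  have B0 : 0 <= B e.
    by apply: le_trans (GBe 0 _) => // i; rewrite mxE oppr_le0 ltW.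
  have rPe : forall p, p \in r e -> 0 <= p.1 /\ cube (kp e) p.2 by near: e.
  rewrite [leRHS]ger0_norm; last first.
    by rewrite !mulr_ge0// exprn_ge0// ?mulr_ge0// ltW.
  rewrite -[X in _ <= X * _](_ : \sum_(p <- r e) p.1 = _); last by near: e.
  rewrite /qsum (le_trans (ler_norm_sum _ _ _))// mulr_suml big_seq [leRHS]big_seq.
  apply: ler_sum => p pr; have [p0 pk] := rPe p pr.
  rewrite normrM (ger0_norm p0) ler_wpM2l// normrM; apply: ler_pM => //.
    exact: GBe.
  rewrite /sinq_kernel normr_prod -[X in _ ^+ X]card_ord -prodr_const; apply: ler_prod => i _.
  by rewrite normr_ge0 normr_sinq_le// ltW.
split; [exact: key BrM FrB|exact: key BiM FiB].
Unshelve. all: by end_near. Qed.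

End Composition.

(** * The inversion formula *)

Section Final.
Context {R : realType}.
Variables (sigma rho : gauge R).
Hypothesis sigma_rho : auxiliary_gauge sigma rho.

Lemma auxiliary_moderate u : is_moderate rho u -> is_moderate sigma u.
Proof.
move=> [N uN]; have [Q HQ] := sigma_rho; exists Q.
apply: filterS (filterI uN (filterI (HQ N) (filterI (near_gauge sigma) (near_gauge rho)))).
move=> e /= [ue [sr [/andP[s0 _] /andP[r0 _]]]]; apply: le_trans ue _.
by rewrite lef_pV2 ?posrE ?exprn_gt0.
Qed.

Lemma represents_drhoX q : represents (fun e => rho e ^+ q) (drho sigma rho ^+ q).
Proof.
have rM : is_moderate sigma rho.
  apply: moderate_le (moderate_cst sigma 1) _; apply: filterS (near_gauge rho) => e /andP[r0 r1].
  by rewrite normr1 ger0_norm// ltW.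
by split; [exact: moderateX|rewrite gclassX].
Qed.

Lemma represents_drhoV q : represents (fun e => rho e ^- q) (drho sigma rho ^- q).
Proof.
have vM : is_moderate sigma (fun e => rho e ^- q).
  exact: auxiliary_moderate (moderateV_gauge rho q).
split=> //; have [M E] := represents_drhoX q; apply/esym/mulr1_eq.
rewrite -E -gclassM// -gclass1; apply: gclass_near.
apply: filterS (near_gauge rho) => e /andP[r0 _].
by rewrite mulfV// expf_neq0// gt_eqF.
Qed.

(** [gnorm] is computed on representatives picked by [repr], which costs two errors sigma^Q <=
    rho^(q+1). With the hypothesis at q + 1 the total is 3 rho^(q+1), and rho < 1/3 brings it below
    rho^q. *)
Lemma eq_rho_near (a b c d : R -> R) :
  is_moderate sigma a -> is_moderate sigma b -> is_moderate sigma c -> is_moderate sigma d ->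
  (forall q : nat, \forall e \near 0^'+, `|a e - c e| + `|b e - d e| <= rho e ^+ q) ->
  eq_rho rho (gclass sigma a +i* gclass sigma b)%C (gclass sigma c +i* gclass sigma d)%C.
Proof.
move=> aM bM cM dM H q.
pose A := repr_net (gclass sigma a - gclass sigma c).
pose B := repr_net (gclass sigma b - gclass sigma d).
have AM : is_moderate sigma A := moderate_repr _.
have BM : is_moderate sigma B := moderate_repr _.
have A0 : null sigma (fun e => A e - (a e - c e)).
  by apply/gclassPM; rewrite ?gclass_repr ?gclassB//; exact: moderateB.
have B0 : null sigma (fun e => B e - (b e - d e)).
  by apply/gclassPM; rewrite ?gclass_repr ?gclassB//; exact: moderateB.
have nM : is_moderate sigma (fun e => normC (A e +i* B e)%C).
  by apply/(cmoderateP sigma (fun e => A e +i* B e)%C).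
apply: gle_near (represents_gclass nM) (represents_drhoX q) _.
have [Q HQ] := sigma_rho.
have r3 : (0 : R) < 3^-1 by rewrite invr_gt0.
near=> e.
have /andP[r0 r1] : 0 < rho e <= 1 by near: e; exact: near_gauge.
have r13 : rho e < 3^-1 by near: e; exact: near_gauge_lt.
have sQ : sigma e ^+ Q <= rho e ^+ q.+1 by near: e; exact: HQ.
have He : `|a e - c e| + `|b e - d e| <= rho e ^+ q.+1 by near: e; exact: H.
have Ae : `|A e - (a e - c e)| <= sigma e ^+ Q by near: e; exact: A0.
have Be : `|B e - (b e - d e)| <= sigma e ^+ Q by near: e; exact: B0.
apply: le_trans (normc_le _ _) _.
have tA : `|A e| <= `|A e - (a e - c e)| + `|a e - c e|.
  by rewrite -[in leLHS](subrK (a e - c e) (A e)) ler_normD.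
have tB : `|B e| <= `|B e - (b e - d e)| + `|b e - d e|.
  by rewrite -[in leLHS](subrK (b e - d e) (B e)) ler_normD.
have r3' : 3 * rho e ^+ q.+1 <= rho e ^+ q.
  rewrite exprS mulrA ler_piMl ?exprn_ge0 ?(ltW r0)//.
  by rewrite -ler_pdivlMl// mulr1 ltW.
lra.
Unshelve. all: by end_near. Qed.

Lemma near_interior n (k : gR sigma) (y : 'rV[gR sigma]_n) eta :
  rho_immoderate rho k -> (forall i, rho_moderate rho (y ord0 i)) -> vrepresents eta y ->
  \forall e \near 0^'+, cube (repr_net k e - 1) (eta e).
Proof.
move=> k_imm ymod etay; apply: filter_forall => i.
have [v [vy [N vN]]] := ymod i.
have E0 := represents_null (etay i) vy 0.
have K := gle_bound (k_imm N.+1) (represents_drhoV N.+1) (represents_repr k) 0.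
(* With rho < 1/4, k is at least 4 rho^-N - 1, while |eta_i| <= rho^-N + 1. These two slacks and the
   required margin of 1 add up to 3 <= 3 rho^-N. *)
have r4 : (0 : R) < 4^-1 by rewrite invr_gt0.
near=> e.
have /andP[r0 r1] : 0 < rho e <= 1 by near: e; exact: near_gauge.
have r14 : rho e < 4^-1 by near: e; exact: near_gauge_lt.
have H1 : `|eta e ord0 i - v e| <= sigma e ^+ 0 by near: e; exact: E0.
have H2 : `|v e| <= rho e ^- N by near: e; exact: vN.
have H3 : rho e ^- N.+1 <= repr_net k e + sigma e ^+ 0 by near: e; exact: K.
have H4 : 4 * rho e ^- N <= rho e ^- N.+1.
  rewrite exprS invfM ler_wpM2r ?invr_ge0 ?exprn_ge0 ?(ltW r0)//.
  by rewrite -[leLHS]invrK lef_pV2 ?posrE// ltW.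
have H5 : 1 <= rho e ^- N by rewrite invf_ge1 ?exprn_gt0// exprn_ile1// ltW.
move: H1 H2 H3; rewrite expr0 !ler_norml => /andP[? ?] /andP[? ?] ?.
by apply/andP; split; lra.
Unshelve. all: by end_near. Qed.

(** If 1 + v <= sigma^-p, the logarithm is at most p / sigma, and p <= 1 / sigma for small e. The
    exponent 2 is the same for all v, as it must be since the threshold is chosen before h. *)
Lemma near_ln_le v : is_moderate sigma v -> (\forall e \near 0^'+, 0 <= v e) ->
  \forall e \near 0^'+, ln (1 + v e) <= sigma e ^- 2.
Proof.
move=> vM v0; have [p vp] := moderateD (moderate_cst sigma 1) vM.
have p0 : (0 : R) < (p.+1%:R)^-1 by rewrite invr_gt0.
near=> e.
have /andP[s0 s1] : 0 < sigma e <= 1 by near: e; exact: near_gauge.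
have sp : sigma e < (p.+1%:R)^-1 by near: e; exact: near_gauge_lt.
have ve : 0 <= v e by near: e.
have v1 : 0 < 1 + v e by rewrite ltr_pwDl.
have vpe : `|1 + v e| <= sigma e ^- p by near: e.
have si0 : 0 < (sigma e)^-1 by rewrite invr_gt0.
apply: (@le_trans _ _ (ln ((sigma e)^-1 ^+ p))).
  by rewrite ler_ln ?posrE ?exprn_gt0// exprVn -(gtr0_norm v1).
rewrite lnXn//; apply: (@le_trans _ _ (p%:R * (sigma e)^-1)).
  rewrite mulr_natl lerMn2r; apply/orP; right.
  exact/ltW/ln_sublinear.
rewrite expr2 invfM ler_wpM2r ?(ltW si0)//.
apply: (@le_trans _ _ p.+1%:R); first by rewrite ler_nat.
by rewrite -[leLHS]invrK lef_pV2 ?posrE// ltW.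
Unshelve. all: by end_near. Qed.

Variables (n : nat) (k : gR sigma).
Variables (f : 'rV[gR sigma]_n -> gC sigma) (F : R -> 'rV[R]_n -> R[i]).
Hypothesis FP : defining_net (gcube k) f F.
Hypothesis k_gt0 : \forall e \near 0^'+, 0 < repr_net k e.

(** Supplies the constant [M] of [cube_inversion], depending on f and k only; order 0 and the n
    first-order derivatives suffice. *)
Lemma derivative_bound : exists2 B, is_moderate sigma B & \forall e \near 0^'+,
  0 <= B e /\ forall x, cube (repr_net k e) x ->
   [/\ `|re_net F e x| <= B e, `|im_net F e x| <= B e,
    forall i, `|partial i (re_net F e) x| <= B e &
    forall i, `|partial i (im_net F e) x| <= B e].
Proof.
have sr e : 0 < e <= 1 -> smooth (re_net F e).
  by move=> e01; have [s _] := FP.1 e e01; exact: s.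
have si e : 0 < e <= 1 -> smooth (im_net F e).
  by move=> e01; have [_ s] := FP.1 e e01; exact: s.
have one alpha t : multi_index_seq alpha = t -> exists2 B, is_moderate sigma B & \forall e \near 0^'+,
    0 <= B e /\ forall x, cube (repr_net k e) x -> `|partials t (re_net F e) x| <= B e /\
    `|partials t (im_net F e) x| <= B e.
  move=> at_.
  have [|x u kx ux|Br BrM BrE] := @cube_sup_moderate R sigma n k k_gt0 (fun e => partials t (re_net F e)).
  - move=> e /sr s; exact: smooth_continuous (smooth_partials t s).
  - by have [] := defining_net_moderate FP kx ux at_.
  have [|x u kx ux|Bi BiM BiE] := @cube_sup_moderate R sigma n k k_gt0 (fun e => partials t (im_net F e)).
  - move=> e /si s; exact: smooth_continuous (smooth_partials t s).
  - by have [] := defining_net_moderate FP kx ux at_.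
  exists (fun e => `|Br e| + `|Bi e|); first by apply: moderateD; exact: moderate_norm.
  apply: filterS2 BrE BiE => e H1 H2; split; first by rewrite addr_ge0.
  move=> x kx; split; [apply: le_trans (H1 x kx) _|apply: le_trans (H2 x kx) _].
    by rewrite (le_trans (ler_norm _))// lerDl.
  by rewrite (le_trans (ler_norm _))// lerDr.
have [B0 B0M B0E] := one _ _ (@multi_index_seq0 n).
have /choice[B BP] : forall i : 'I_n, exists B, is_moderate sigma B /\ \forall e \near 0^'+,
    0 <= B e /\ forall x, cube (repr_net k e) x -> `|partial i (re_net F e) x| <= B e /\
    `|partial i (im_net F e) x| <= B e.
  by move=> i; have [alpha /one[B BM BE]] := multi_index_seq1 i; exists B.
exists (fun e => B0 e + \sum_i B i e).
  by apply: moderateD => //; exact: (gclass_sum (fun i => (BP i).1)).1.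
have BE : \forall e \near 0^'+, forall i, 0 <= B i e /\ forall x, cube (repr_net k e) x ->
    `|partial i (re_net F e) x| <= B i e /\ `|partial i (im_net F e) x| <= B i e.
  by apply: filter_forall => i; exact: (BP i).2.
apply: filterS2 B0E BE => e [b0 H0] H.
have S0 : 0 <= \sum_i B i e by apply: sumr_ge0 => i _; have [] := H i.
have Bi i : B i e <= B0 e + \sum_i B i e.
  rewrite (bigD1 i)//= addrCA lerDl addr_ge0//.
  by apply: sumr_ge0 => j _; have [] := H j.
split; first by rewrite addr_ge0.
move=> x kx; have [H1 H2] := H0 x kx; split.
- by rewrite (le_trans H1)// lerDl.
- by rewrite (le_trans H2)// lerDl.
- by move=> i; have [_ /(_ x kx)[h1 _]] := H i; exact: le_trans (Bi i).
- by move=> i; have [_ /(_ x kx)[_ h1]] := H i; exact: le_trans (Bi i).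
Qed.

Lemma gdotC (x w : 'rV[gR sigma]_n) : gdot x w = gdot w x.
Proof. by apply: eq_bigr => i _; rewrite mulrC. Qed.

Lemma gdotN (x w : 'rV[gR sigma]_n) : gdot x (- w) = - gdot x w.
Proof. by rewrite /gdot -sumrN; apply: eq_bigr => i _; rewrite mxE mulrN. Qed.

Lemma gmulA (z1 z2 z3 : gC sigma) : gmul (gmul z1 z2) z3 = gmul z1 (gmul z2 z3).
Proof.
case: z1 z2 z3 => [a1 b1] [a2 b2] [a3 b3]; rewrite /gmul /ComplexField.mulc.
by congr (_ +i* _)%C; ring.
Qed.

Local Notation scale := (real_complex (gR sigma) (gclass sigma (cst ((2 * pi) ^- n)))).

Lemma eq_gint (h : gR sigma) (g1 g2 : 'rV[gR sigma]_n -> gC sigma) :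
  g1 =1 g2 -> gint h g1 = gint h g2.
Proof. by move=> /funext ->. Qed.

Lemma inv_fourier_fourierE (h : gR sigma) y : inv_fourier h (fourier k f) y =
  gmul scale (gint h (fun w => gmul (gint k (fun x => gmul (f x) (gexpi (gdot x (signed true w)))))
    (gexpi (gdot y (signed (~~ true) w))))).
Proof.
have E w : fourier k f w = gint k (fun x => gmul (f x) (gexpi (gdot x (signed true w)))).
  by apply: eq_gint => x; rewrite -gdotN.
rewrite /inv_fourier; apply: (congr1 (gmul scale)); apply: eq_gint => w.
exact: (congr1 (fun z => gmul z (gexpi (gdot y w))) (E w)).
Qed.

Lemma fourier_inv_fourierE (h : gR sigma) y G :
  (\forall e \near 0^'+, 0 < repr_net h e) ->
  defining_net (gcube h) (fun w => gmul (gint k (fun x => gmul (f x) (gexpi (gdot x (signed false w)))))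
    (gexpi (gdot y (signed (~~ false) w)))) G ->
  fourier h (inv_fourier k f) y =
  gmul scale (gint h (fun w => gmul (gint k (fun x => gmul (f x) (gexpi (gdot x (signed false w)))))
    (gexpi (gdot y (signed (~~ false) w))))).
Proof.
move=> h0 GP; rewrite -(gintZ _ h0 GP); apply: eq_gint => w.
have E : inv_fourier k f w = gmul scale (gint k (fun x => gmul (f x) (gexpi (gdot x w)))).
  by rewrite /inv_fourier; apply: (congr1 (gmul scale)); apply: eq_gint => x; rewrite gdotC.
by rewrite E gmulA gdotC -gdotN.
Qed.

Lemma inversion : rho_immoderate rho k ->
  exists hbar : gR sigma, forall h : gR sigma, gle hbar h ->
  forall (y : 'rV[gR sigma]_n) eta, vrepresents eta y -> gcube k y ->
  (forall i, rho_moderate rho (y ord0 i)) ->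
  inv_fourier h (fourier k f) y = fourier h (inv_fourier k f) y /\
  eq_rho rho (fourier h (inv_fourier k f) y) (gCclass sigma (fun e => F e (eta e))).
Proof.
move=> k_imm; have [Q HQ] := sigma_rho.
have [B BM BE] := derivative_bound.
(* The error of [cube_inversion] times h, with each logarithm replaced by its bound sigma^-2;
   neither h nor y occurs in it. *)
pose bnd e := n%:R * (4 * (1 + sigma e ^- 2)) ^+ n * (12 * B e * (1 + sigma e ^- 2)).
have [N bN] : is_moderate sigma bnd.
  have M1 : is_moderate sigma (fun e => 1 + sigma e ^- 2).
    by apply: moderateD; [exact: moderate_cst|exact: moderateV_gauge].
  apply: moderateM; first apply: moderateM; first exact: moderate_cst.
    by apply: moderateX; apply: moderateM; first exact: moderate_cst.
  by apply: moderateM => //; apply: moderateM => //; exact: moderate_cst.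
(* For h >= sigma^-M the error sigma^-N / h is at most sigma^(Q+3); the spare powers absorb
   numerical factors. *)
pose M := (N + Q + 3)%N.
(* The additional power pays for the slack in [gle_bound]: sigma^-(M+1) - 1 >= 2 sigma^-M - 1 >=
   sigma^-M. *)
exists (gclass sigma (fun e => sigma e ^- M.+1)) => h hbar_h y eta etay ky ymod.
have h_large : \forall e \near 0^'+, sigma e ^- M <= repr_net h e.
  have H := gle_bound hbar_h (represents_gclass (moderateV_gauge sigma M.+1)) (represents_repr h) 0.
  have s2 : (0 : R) < 2^-1 by rewrite invr_gt0.
  near=> e.
  have /andP[s0 s1] : 0 < sigma e <= 1 by near: e; exact: near_gauge.
  have s12 : sigma e < 2^-1 by near: e; exact: near_gauge_lt.
  have : sigma e ^- M.+1 <= repr_net h e + sigma e ^+ 0 by near: e; exact: H.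
  have H4 : 2 * sigma e ^- M <= sigma e ^- M.+1.
    rewrite exprS invfM ler_wpM2r ?invr_ge0 ?exprn_ge0 ?(ltW s0)//.
    by rewrite -[leLHS]invrK lef_pV2 ?posrE// ltW.
  have H5 : 1 <= sigma e ^- M by rewrite invf_ge1 ?exprn_gt0// exprn_ile1// ltW.
  by rewrite expr0; lra.
have h_gt0 : \forall e \near 0^'+, 0 < repr_net h e.
  apply: filterS2 h_large (near_gauge sigma) => e He /andP[s0 _].
  by apply: lt_le_trans He; rewrite invr_gt0 exprn_gt0.
have [r [tau [tau0 rP rS rE rK]]] := near_sinq_rule FP k_gt0 h_gt0 eta.
have GI b := gint_quad FP k_gt0 h_gt0 etay tau0 rP rS rE b.
have GN b := defining_net_quad FP k_gt0 etay tau0 rP rS rE b.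
have [qr qi] := moderate_qsum FP k_gt0 h_gt0 eta rP rS.
have E1 := inv_fourier_fourierE h y.
have E2 := fourier_inv_fourierE h_gt0 (GN false).
have cM := moderate_cst sigma ((2 * pi) ^- n).
have m0 := moderate_cst sigma 0.
have V := gmul_gclass cM m0 qr qi; rewrite -real_complex_gclass in V.
have {}E1 := etrans E1 (congr1 (gmul _) (GI true)).
have {}E2 := etrans E2 (congr1 (gmul _) (GI false)).
split; first exact: etrans E1 (esym E2).
rewrite (etrans E2 V) /gCclass.
have [mFr mFi] := defining_net_moderate FP ky etay (@multi_index_seq0 n).
apply: (eq_rho_near (moderateB (moderateM cM qr) (moderateM m0 qi))
  (moderateD (moderateM cM qi) (moderateM m0 qr)) mFr mFi) => q.
have s4 : (0 : R) < 4^-1 by rewrite invr_gt0.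
have hint := near_interior k_imm ymod etay.
have hk : is_moderate sigma (fun e => repr_net h e * (2 * repr_net k e)).
  apply: moderateM (moderate_repr h) (moderateM (moderate_cst sigma 2) (moderate_repr k)).
have hk0 : \forall e \near 0^'+, 0 <= repr_net h e * (2 * repr_net k e).
  by apply: filterS2 h_gt0 k_gt0 => e h0 k0; rewrite !mulr_ge0// ltW.
have hln := near_ln_le hk hk0.
near=> e.
have e01 : 0 < e <= 1 by near: e; exact: near_01.
have /andP[s0 s1] : 0 < sigma e <= 1 by near: e; exact: near_gauge.
have s14 : sigma e < 4^-1 by near: e; exact: near_gauge_lt.
have he : 0 < repr_net h e by near: e.
have ke : 0 < repr_net k e by near: e.
have hl : sigma e ^- M <= repr_net h e by near: e.
have [b0 Be] : 0 <= B e /\ forall x, cube (repr_net k e) x ->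
   [/\ `|re_net F e x| <= B e, `|im_net F e x| <= B e,
    forall i, `|partial i (re_net F e) x| <= B e &
    forall i, `|partial i (im_net F e) x| <= B e] by near: e.
have be : `|bnd e| <= sigma e ^- N by near: e.
have le : ln (1 + repr_net h e * (2 * repr_net k e)) <= sigma e ^- 2 by near: e.
have ie : cube (repr_net k e - 1) (eta e) by near: e.
have te : `|tau e| <= sigma e ^+ (Q + 3) by near: e; exact: tau0.
have hke : 0 <= repr_net h e * (2 * repr_net k e) by near: e.
have [kr ki] : `|cube_int (repr_net k e) (fun x => re_net F e x * sinq_kernel (repr_net h e) (eta e) x) -
     qsum (r e) (fun x => re_net F e x * sinq_kernel (repr_net h e) (eta e) x)| <= tau e /\
   `|cube_int (repr_net k e) (fun x => im_net F e x * sinq_kernel (repr_net h e) (eta e) x) -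
     qsum (r e) (fun x => im_net F e x * sinq_kernel (repr_net h e) (eta e) x)| <= tau e by near: e.
have sQ : sigma e ^+ Q <= rho e ^+ q by near: e; exact: HQ.
have [sr si] := FP.1 e e01.
have L0 : 0 <= ln (1 + repr_net h e * (2 * repr_net k e)) by rewrite ln_ge0// lerDl.
have S0 : 0 <= sigma e ^- 2 by rewrite invr_ge0 exprn_ge0// ltW.
(* Both sources of error, the Dirichlet inversion and the quadrature with the kernel, are at most
   sigma^(Q+3). The claim is applied to the real and the imaginary part. *)
have Ie (G : 'rV[R]_n -> R) : smooth G -> (forall x, cube (repr_net k e) x -> `|G x| <= B e) ->
   (forall i x, cube (repr_net k e) x -> `|partial i G x| <= B e) ->
   `|cube_int (repr_net k e) (fun x => G x * sinq_kernel (repr_net h e) (eta e) x) -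
     qsum (r e) (fun x => G x * sinq_kernel (repr_net h e) (eta e) x)| <= tau e ->
   `|(2 * pi) ^- n * (2 ^+ n * qsum (r e) (fun x => G x * sinq_kernel (repr_net h e) (eta e) x)) -
      G (eta e)| <= 2 * sigma e ^+ (Q + 3).
  move=> sG GB dGB kG.
  have H := cube_inversion he (ltW ke) b0 (smooth_continuous sG)
    (fun i x => @smooth_derivable R n G i x sG) GB dGB ie.
  have err : n%:R * (4 * (1 + ln (1 + repr_net h e * (2 * repr_net k e)))) ^+ n *
     (12 * B e * (1 + ln (1 + repr_net h e * (2 * repr_net k e))) / repr_net h e) <= sigma e ^+ (Q + 3).
    apply: (@le_trans _ _ (sigma e ^- N / repr_net h e)).
      rewrite [X in X <= _]mulrA ler_wpM2r ?invr_ge0 ?(ltW he)//.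
      apply: le_trans be; apply: le_trans (ler_norm _); rewrite /bnd.
      apply: ler_pM.
      - by rewrite mulr_ge0// exprn_ge0// mulr_ge0// addr_ge0.
      - by rewrite !mulr_ge0// addr_ge0.
      - rewrite ler_wpM2l//; apply: lerXn2r; rewrite ?nnegrE ?mulr_ge0 ?addr_ge0//.
        by rewrite ler_wpM2l// lerD2l.
      - by rewrite ler_wpM2l ?mulr_ge0// lerD2l.
    rewrite ler_pdivrMr//; apply: (@le_trans _ _ (sigma e ^+ (Q + 3) * sigma e ^- M)).
      rewrite /M -addnA [sigma e ^+ (N + _)]exprD invfM mulrCA mulfV ?mulr1//.
      by rewrite expf_neq0// gt_eqF.
    by rewrite ler_wpM2l// exprn_ge0// ltW.
  have pi1 : (1 : R) <= pi by rewrite (le_trans _ (pi_ge2 R))// ler1n.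
  have pn : (1 : R) <= pi ^+ n by rewrite exprn_ege1.
  have pn0 : 0 < pi ^+ n :> R by rewrite (lt_le_trans _ pn).
  set I := cube_int _ _ in H kG; set q' := qsum _ _ in kG *.
  (* The factor 2^n from integrating the cosines reduces (2 pi)^-n to pi^-n, matching the pi^n of
     [cube_inversion]. *)
  have -> : (2 * pi) ^- n * (2 ^+ n * q') - G (eta e) = (q' - pi ^+ n * G (eta e)) / pi ^+ n.
    rewrite exprMn; field.
    by rewrite gt_eqF//= expf_neq0// pnatr_eq0.
  rewrite normrM normfV (gtr0_norm pn0) ler_pdivrMr//.
  apply: (@le_trans _ _ (2 * sigma e ^+ (Q + 3))); last first.
    by rewrite ler_peMr// mulr_ge0// exprn_ge0// ltW.
  have -> : q' - pi ^+ n * G (eta e) = (I - pi ^+ n * G (eta e)) - (I - q') by ring.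
  rewrite (le_trans (ler_normB _ _))// mulr_natl mulr2n lerD//.
    exact: le_trans H err.
  by apply: le_trans kG (le_trans (ler_norm _) te).
have Hr := Ie (re_net F e) sr (fun x kx => let: And4 H _ _ _ := Be x kx in H)
  (fun i x kx => let: And4 _ _ H _ := Be x kx in H i) kr.
have Hi := Ie (im_net F e) si (fun x kx => let: And4 _ H _ _ := Be x kx in H)
  (fun i x kx => let: And4 _ _ _ H := Be x kx in H i) ki.
apply: le_trans sQ; rewrite mul0r subr0 mul0r addr0.
apply: (@le_trans _ _ (2 * sigma e ^+ (Q + 3) + 2 * sigma e ^+ (Q + 3))); first exact: lerD.
(* The two components total 4 sigma^(Q+3), which is at most sigma^Q since sigma < 1/4. *)
rewrite addn3 !exprS.
have X0 : 0 <= sigma e ^+ Q by rewrite exprn_ge0// ltW.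
rewrite -mulrDl (_ : 2 + 2 = 4 :> R); last by ring.
apply: (@le_trans _ _ (4 * sigma e * sigma e ^+ Q)).
  rewrite -!mulrA ler_wpM2l// ler_wpM2l ?(ltW s0)//.
  by rewrite mulrA ler_piMl// mulr_ile1// ltW.
by rewrite ler_piMl// -ler_pdivlMl// mulr1 ltW.
Unshelve. all: by end_near. Qed.

End Final.

Theorem corollary64 (R : realType) (sigma rho : gauge R)
    (sigma_rho : auxiliary_gauge sigma rho)
    (n : nat) (k : gR sigma) (k_gt0 : glt 0 k) (k_imm : rho_immoderate rho k)
    (X : set 'rV[gR sigma]_n) (f : 'rV[gR sigma]_n -> gC sigma)
    (kX : gcube k `<=` X) (fX : GSF X f) :
  exists hbar : gR sigma, forall h : gR sigma, gle hbar h ->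
    forall y : 'rV[gR sigma]_n, gcube k y ->
      (forall i, rho_moderate rho (y ord0 i)) ->
      eq_rho rho (inv_fourier h (fourier k f) y) (fourier h (inv_fourier k f) y) /\
      eq_rho rho (fourier h (inv_fourier k f) y) (f y).
Proof.
have [F [Fs FM]] := fX.
have FP : defining_net (gcube k) f F by split=> // x u /kX; exact: FM.
(* The representative of k is at least rho^-1 - 1 for small e, which is positive once rho < 1/2. *)
have k0 : \forall e \near 0^'+, 0 < repr_net k e.
  have K := gle_bound (k_imm 1%N) (represents_drhoV sigma_rho 1) (represents_repr k) 0.
  have r2 : (0 : R) < 2^-1 by rewrite invr_gt0.
  near=> e.
  have /andP[r0 r1] : 0 < rho e <= 1 by near: e; exact: near_gauge.
  have r12 : rho e < 2^-1 by near: e; exact: near_gauge_lt.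
  have : rho e ^- 1 <= repr_net k e + sigma e ^+ 0 by near: e; exact: K.
  have : 2 < (rho e)^-1 by rewrite -[ltLHS]invrK ltf_pV2.
  by rewrite expr0 expr1; lra.
have [hbar H] := inversion sigma_rho FP k0 k_imm.
exists hbar => h hh y ky ymod.
have [E1 E2] := H h hh y _ (vrepresents_repr y) ky ymod.
split; last by rewrite (FM y _ (kX _ ky) (vrepresents_repr y)).1.
rewrite E1; case: (fourier h _ y) => a b.
rewrite -(gclass_repr a) -(gclass_repr b).
apply: eq_rho_near => //; try exact: moderate_repr.
move=> q; apply: filterS (near_gauge rho) => e /andP[r0 _].
by rewrite !subrr normr0 addr0 exprn_ge0// ltW.
Unshelve. all: by end_near. Qed.
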